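(* Let $M^2$ be a Riemann surface, $N^n$ an $n$-dimensional manifold ($n\ge2$), $r\in\mathbb N\cup\{0,\infty,\omega\}$, $\beta\in[0,1]$, $\tilde g$ a $C^{r+1,\beta}_{loc}$ Riemannian metric on $N^n$, and $f:M^2\to N^n$ a branched conformal immersion of class $C^{r+2,\beta}_{loc}$. Suppose that for each branch point $p\in M^2$ there exist coordinate systems $(U,x)$, $(V,y)$ at $p$, $f(p)$ respectively, with $x(p)=0$, such that for some $s\in\mathbb N$ the map $\hat f=y\circ f\circ x^{-1}$ satisfies on $x(U)$ $$\frac{\partial\hat f}{\partial z}(z)=(s+1)z^sd(z),\qquad\frac{\partial^2\hat f}{\partial\bar z\partial z}(z)=|z|^{2s}l(z),$$ where $l:x(U)\to\mathbb R^n$ is a $C^{r,\beta}_{loc}$-map and $d:x(U)\to\mathbb C^n$ is a $C^{r+1,\beta}_{loc}$-map with $d_1=\frac12(1+d_1')$, $d_2=-\frac i2(1+d_2')$, $d_1'(0)=d_2'(0)=0$ and $d_j(0)=0$ for $j=3,\dots,n$. Then the mean curvature vector $\mathcal H$ of $f$ has a $C^{r,\beta}_{loc}$-extension to $M^2$.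
   Context: Conventions. $\mathbb N=\{1,2,\dots\}$. $C^{r,\beta}_{loc}$ denotes local Hölder regularity in charts ($C^{r,0}_{loc}=C^r$); $C^{\infty,\beta}_{loc}=C^\infty$, $C^{\omega,\beta}_{loc}$ means real analytic; $\infty\pm k=\infty$, $\omega\pm k=\omega$. Manifolds are smooth (real analytic when analytic objects are considered). $\mathbb R^2=\mathbb C$ via $z=x_1+ix_2$; $\frac{\partial}{\partial z}=\frac12(\frac{\partial}{\partial x_1}-i\frac{\partial}{\partial x_2})$, $\frac{\partial}{\partial\bar z}=\frac12(\frac{\partial}{\partial x_1}+i\frac{\partial}{\partial x_2})$. For coordinate systems $(U,x)$ at $p$ and $(V,y)$ at $f(p)$, $f(U)\subset V$ is assumed. Branch points. For a $C^1$-map $f:M^2\to N^n$, $p$ is a branch point (of order $s\in\mathbb N$) if there are coordinate systems at $p$, $f(p)$ with $x(p)=0$, $y(f(p))=0$ such that $\sigma(z):=\hat f_1(z)+i\hat f_2(z)-z^{s+1}=o(|z|^{s+1})$, $\hat f_k(z)=o(|z|^{s+1})$ for $3\le k\le n$, and $\frac{\partial\sigma}{\partial x_j}(z),\frac{\partial\hat f_k}{\partial x_j}(z)=o(|z|^s)$ for $3\le k\le n$, $j=1,2$. A branched immersion is a $C^1$-map that is regular (injective differential) except at branch points; it is conformal if, in every chart of the Riemann surface $M^2$ (charts are complex charts), $\tilde g(f_*\frac{\partial}{\partial x_1},f_*\frac{\partial}{\partial x_1})=\tilde g(f_*\frac{\partial}{\partial x_2},f_*\frac{\partial}{\partial x_2})$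 and $\tilde g(f_*\frac{\partial}{\partial x_1},f_*\frac{\partial}{\partial x_2})=0$. Mean curvature vector. On the regular set $Reg(f)$, $\mathcal H(q)=\frac12\sum_{i=1}^2\alpha(X_i,X_i)$ with $X_1,X_2$ an orthonormal basis of $T_qM^2$ for the induced metric and $\alpha(X,Y)=(\tilde\nabla_Xf_*Y)^\perp$; it is a section of $f^*TN^n$ over $Reg(f)$, and an extension to $M^2$ is an extension as a section of $f^*TN^n$. *)

(* Defs.v *)
From HB Require Import structures.
From mathcomp Require Import all_boot all_order all_algebra complex.
From mathcomp Require Import all_classical all_reals all_analysis.
Set Implicit Arguments.
Unset Strict Implicit.
Unset Printing Implicit Defensive.
Import Order.TTheory GRing.Theory Num.Theory.
Import numFieldNormedType.Exports.
Local Open Scope classical_set_scope.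
Local Open Scope ring_scope.
Local Open Scope complex_scope.

(* [Cfin k], [Cinfty], [Comega] stand for the values k, infinity and omega of
   the regularity index. *)
Inductive diff_class := Cfin of nat | Cinfty | Comega.

Definition shift_class (r : diff_class) (k : nat) : diff_class :=
  if r is Cfin m then Cfin (m + k)%N else r.

(* Manifolds are smooth, and real analytic when analytic objects occur. *)
Definition structure_class (r : diff_class) : diff_class :=
  if r is Comega then Comega else Cinfty.

Section Regularity.
Context {R : realType} {m : nat} {V : normedModType R}.
Implicit Types (U : set 'rV[R]_m) (f : 'rV[R]_m -> V).

Definition basis_vec (i : 'I_m) : 'rV[R]_m := delta_mx 0 i.

(* All predicates below are meant for open U; f is total but only its values
   on U matter. *)
Definition continuous_on U f : Prop := forall a, U a -> {for a, continuous f}.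

Definition hoelder_loc (b : R) U f : Prop :=
  forall a, U a -> exists W : set 'rV[R]_m, nbhs a W /\
    exists C : R, forall x z, W x -> W z ->
      `|f x - f z| <= C * `|x - z| `^ b.

(* C^{k,b}_loc: partial derivatives up to order k exist and are continuous,
   those of order k being locally b-Hoelder if b > 0; C^{k,0}_loc = C^k. *)
Fixpoint class_fin (b : R) (k : nat) U f : Prop :=
  continuous_on U f /\
  if k is k'.+1 then
    forall i : 'I_m, (forall x, U x -> derivable f x (basis_vec i)) /\
                     class_fin b k' U ('D_(basis_vec i) f)
  else (0 < b -> hoelder_loc b U f).

Definition monomial (h : 'rV[R]_m) (al : {ffun 'I_m -> nat}) : R :=
  \prod_i h 0 i ^+ al i.

Definition cube_sum {W : zmodType} (F : {ffun 'I_m -> nat} -> W) (N : nat) : W :=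
  \sum_(al : {ffun 'I_m -> 'I_N}) F [ffun i => nat_of_ord (al i)].

(* Near each point, f is the sum of an absolutely convergent power series;
   the norm of 'rV is the sup norm, so the domain of convergence is a
   polydisc.  For absolutely convergent families, summing along the cubes
   {al | al_i < N} gives the unordered sum. *)
Definition analytic_on U f : Prop :=
  forall a, U a -> exists (c : {ffun 'I_m -> nat} -> V) (rho : R), 0 < rho /\
    forall x, `|x - a| < rho ->
      let term al := monomial (x - a) al *: c al in
      cvgn (cube_sum (fun al => `|term al|)) /\
      cube_sum term @ \oo --> f x.

Definition class_on (r : diff_class) (b : R) U f : Prop :=
  match r with
  | Cfin k => class_fin b k U f
  | Cinfty => forall k, class_fin 0 k U f
  | Comega => analytic_on U f
  end.

End Regularity.

Section ComplexCoordinate.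
Context {R : realType}.

Definition toC (z : 'rV[R]_2) : R[i] := z 0 0 +i* z 0 1.

Definition partialC (j : 'I_2) (F : 'rV[R]_2 -> R[i]) (z : 'rV[R]_2) : R[i] :=
  'D_(basis_vec j) (fun w => complex.Re (F w)) z
  +i* 'D_(basis_vec j) (fun w => complex.Im (F w)) z.

Definition dz (F : 'rV[R]_2 -> R[i]) (z : 'rV[R]_2) : R[i] :=
  2^-1 * (partialC 0 F z - 'i%C * partialC 1 F z).

Definition dzbar (F : 'rV[R]_2 -> R[i]) (z : 'rV[R]_2) : R[i] :=
  2^-1 * (partialC 0 F z + 'i%C * partialC 1 F z).

Definition dz_vec n (F : 'rV[R]_2 -> 'rV[R[i]]_n) (z : 'rV[R]_2) : 'rV[R[i]]_n :=
  \row_j dz (fun w => F w 0 j) z.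

Definition dzbar_vec n (F : 'rV[R]_2 -> 'rV[R[i]]_n) (z : 'rV[R]_2) :
    'rV[R[i]]_n :=
  \row_j dzbar (fun w => F w 0 j) z.

Definition complexify n (v : 'rV[R]_n) : 'rV[R[i]]_n := map_mx (real_complex R) v.

Definition class_onC n (r : diff_class) (b : R) (U : set 'rV[R]_2)
    (F : 'rV[R]_2 -> 'rV[R[i]]_n) : Prop :=
  class_on r b U (fun z => map_mx (@complex.Re R) (F z)) /\
  class_on r b U (fun z => map_mx (@complex.Im R) (F z)).

(* As holomorphic functions are real analytic, asking for analyticity rather
   than C^1 next to the Cauchy-Riemann equation loses no generality. *)
Definition holomorphic_on (U : set 'rV[R]_2) (T : 'rV[R]_2 -> 'rV[R]_2) : Prop :=
  analytic_on U T /\ forall z, U z -> dzbar (fun w => toC (T w)) z = 0.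

End ComplexCoordinate.

Section Manifolds.
Context {R : realType}.

(* [cmap] is relevant on [cdom] only, [cinv] on the image only. *)
Record chart (M : topologicalType) (n : nat) := Chart {
  cdom : set M;
  cmap : M -> 'rV[R]_n;
  cinv : 'rV[R]_n -> M;
  cdom_open : open cdom;
  cimg_open : open (cmap @` cdom);
  cmapK : forall p, cdom p -> cinv (cmap p) = p;
  cmap_cont : forall p, cdom p -> {for p, continuous cmap};
  cinv_cont : forall z, (cmap @` cdom) z -> {for z, continuous cinv} }.

Definition cimg M n (x : chart M n) : set 'rV[R]_n := cmap x @` cdom x.

Definition transition M n (x x' : chart M n) : 'rV[R]_n -> 'rV[R]_n :=
  cmap x' \o cinv x.

Definition transition_class n :=
  set 'rV[R]_n -> ('rV[R]_n -> 'rV[R]_n) -> Prop.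

Definition compatible M n (P : transition_class n) (x x' : chart M n) : Prop :=
  P (cmap x @` (cdom x `&` cdom x')) (transition x x') /\
  P (cmap x' @` (cdom x `&` cdom x')) (transition x' x).

Record manifold (n : nat) (P : transition_class n) := Manifold {
  carrier :> topologicalType;
  atlas : set (chart carrier n);
  manifold_hausdorff : hausdorff_space carrier;
  manifold_second_countable : @second_countable carrier;
  atlas_cover : forall p : carrier, exists2 x, atlas x & cdom x p;
  atlas_compatible : forall x x', atlas x -> atlas x' -> compatible P x x' }.

Definition of_class (q : diff_class) n : transition_class n :=
  fun U T => class_on q 0 U T.

Definition real_manifold (q : diff_class) n := manifold (@of_class q n).

Definition riemann_surface := manifold (@holomorphic_on R).

(* For Q = P: the charts of the maximal atlas of M.  For a Riemann surface M,
   Q = [of_class q 2] gives the coordinate systems of the underlying real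
   surface, Q = [holomorphic_on] the complex charts. *)
Definition coordinate_system n (P : transition_class n) (M : manifold P)
    (Q : transition_class n) (x : chart M n) : Prop :=
  forall a, atlas a -> compatible Q a x.

End Manifolds.

Arguments chart R M n : clear implicits.
Arguments real_manifold R q n : clear implicits.
Arguments riemann_surface R : clear implicits.

Definition inner {R : realType} {n : nat} (G : 'M[R]_n) (u w : 'rV[R]_n) : R :=
  (u *m G *m w^T) 0 0.

Section TargetManifold.
Context {R : realType} {q : diff_class} {n : nat} (N : real_manifold R q n).

Definition coordN (y : chart R N n) : Prop := coordinate_system (@of_class R q n) y.

(* A tangent vector of N at p, as the family of its components with respect
   to the coordinate systems at p. *)
Definition tangent_vector (p : N) (v : chart R N n -> 'rV[R]_n) : Prop :=
  forall y y', coordN y -> coordN y' -> cdom y p -> cdom y' p ->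
    v y' = 'D_(v y) (transition y y') (cmap y p).

(* [gram g y z] is the matrix of the metric with respect to the coordinate
   vector fields of y at the point of coordinates z. *)
Record riemannian_metric := RiemannianMetric {
  gram : chart R N n -> 'rV[R]_n -> 'M[R]_n;
  gram_sym : forall y, coordN y -> forall z, cimg y z -> (gram y z)^T = gram y z;
  gram_pos : forall y, coordN y -> forall z, cimg y z ->
    forall u, u != 0 -> 0 < inner (gram y z) u u;
  gram_change : forall y y', coordN y -> coordN y' ->
    forall p, cdom y p -> cdom y' p -> forall u w,
      inner (gram y (cmap y p)) u w =
      inner (gram y' (cmap y' p)) ('D_u (transition y y') (cmap y p))
                                  ('D_w (transition y y') (cmap y p)) }.

Definition metric_class (r : diff_class) (b : R) (g : riemannian_metric) : Prop :=
  forall y, coordN y -> class_on r b (cimg y) (gram g y).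

End TargetManifold.

(* Local geometry in coordinates: G is the matrix of the metric on an open set
   of R^n, phi a map from an open set of R^2 to R^n. *)
Section LocalGeometry.
Context {R : realType} {n : nat}.
Variables (G : 'rV[R]_n -> 'M[R]_n) (phi : 'rV[R]_2 -> 'rV[R]_n).

Definition christoffel (z : 'rV[R]_n) (k a b : 'I_n) : R :=
  2^-1 * \sum_l invmx (G z) k l *
    ('D_(basis_vec a) (fun w => G w b l) z
     + 'D_(basis_vec b) (fun w => G w a l) z
     - 'D_(basis_vec l) (fun w => G w a b) z).

(* Levi-Civita derivative, in the direction X, of a vector field W along phi. *)
Definition cov_deriv (X : 'rV[R]_2) (W : 'rV[R]_2 -> 'rV[R]_n) (z : 'rV[R]_2) :
    'rV[R]_n :=
  'D_X W z
  + \row_k \sum_a \sum_b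
      christoffel (phi z) k a b * ('D_X phi z) 0 a * (W z) 0 b.

Definition jacobian_rows (z : 'rV[R]_2) : 'M[R]_(2, n) :=
  \matrix_(i, k) ('D_(basis_vec i) phi z) 0 k.

Definition induced_gram (z : 'rV[R]_2) : 'M[R]_2 :=
  jacobian_rows z *m G (phi z) *m (jacobian_rows z)^T.

(* w minus its G-orthogonal projection to the span of the rows of the
   Jacobian; meaningful where phi is regular. *)
Definition normal_part (z : 'rV[R]_2) (w : 'rV[R]_n) : 'rV[R]_n :=
  w - w *m G (phi z) *m (jacobian_rows z)^T
        *m invmx (induced_gram z) *m jacobian_rows z.

(* X and Y are extended as fields with constant components; phi_* Y is then
   the field w |-> D_Y phi w along phi. *)
Definition second_fundamental_form (X Y z : 'rV[R]_2) : 'rV[R]_n :=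
  normal_part z (cov_deriv X (fun w => 'D_Y phi w) z).

Definition orthonormal_pair (X1 X2 z : 'rV[R]_2) : Prop :=
  [/\ inner (induced_gram z) X1 X1 = 1, inner (induced_gram z) X2 X2 = 1
    & inner (induced_gram z) X1 X2 = 0].

End LocalGeometry.

Section Surfaces.
Context {R : realType} {q : diff_class} {n : nat}.
Context {M : riemann_surface R} {N : real_manifold R q n.+2}.
Implicit Types (f : M -> N) (g : riemannian_metric N).
Implicit Types (x : chart R M 2) (y : chart R N n.+2).

Definition coordM x : Prop := coordinate_system (@of_class R q 2) x.
Definition complex_chart x : Prop := coordinate_system (@holomorphic_on R) x.

Definition local_rep f x y : 'rV[R]_2 -> 'rV[R]_n.+2 := cmap y \o f \o cinv x.

Definition chart_pair f x y : Prop :=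
  [/\ coordM x, coordN y & f @` cdom x `<=` cdom y].

Definition chart_pair_at f (p : M) x y : Prop := chart_pair f x y /\ cdom x p.

Definition map_class (r : diff_class) (b : R) f : Prop :=
  continuous f /\
  forall x y, chart_pair f x y -> class_on r b (cimg x) (local_rep f x y).

Definition regular_point f (p : M) : Prop :=
  forall x y, chart_pair_at f p x y -> injective ('d (local_rep f x y) (cmap x p)).

(* R[i]^o is R[i] as a normed space over itself, so that the Landau notation
   applies to complex valued functions. *)
Definition small_o (F : 'rV[R]_2 -> R[i]) (k : nat) : Prop :=
  (F : 'rV[R]_2 -> R[i]^o) =o_ (nbhs (0 : 'rV[R]_2)) (fun z => `|toC z| ^+ k : R[i]^o).

Definition branch_point_of_order (s : nat) f (p : M) : Prop :=
  (0 < s)%N /\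
  exists x y, chart_pair_at f p x y /\ cmap x p = 0 /\ cmap y (f p) = 0 /\
    let fh := local_rep f x y in
    let sigma z := fh z 0 0 +i* fh z 0 1 - toC z ^+ s.+1 in
    let fk (k : 'I_n.+2) z := (fh z 0 k)%:C in
    [/\ small_o sigma s.+1,
        forall k : 'I_n.+2, (1 < k)%N -> small_o (fk k) s.+1,
        forall j : 'I_2, small_o (partialC j sigma) s
      & forall (j : 'I_2) (k : 'I_n.+2), (1 < k)%N ->
          small_o (partialC j (fk k)) s].

Definition branch_point f (p : M) : Prop :=
  exists s, branch_point_of_order s f p.

Definition branched_immersion f : Prop :=
  map_class (Cfin 1) 0 f /\ forall p, ~ branch_point f p -> regular_point f p.

Definition conformal g f : Prop :=
  forall x y, complex_chart x -> coordN y -> f @` cdom x `<=` cdom y ->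
    forall z, cimg x z ->
      let fh := local_rep f x y in
      let G := gram g y (fh z) in
      let d1 := 'D_(basis_vec 0) fh z in
      let d2 := 'D_(basis_vec 1) fh z in
      inner G d1 d1 = inner G d2 d2 /\ inner G d1 d2 = 0.

(* v is the mean curvature vector of f at the regular point p. *)
Definition is_mean_curvature_vector g f (p : M)
    (v : chart R N n.+2 -> 'rV[R]_n.+2) : Prop :=
  tangent_vector (f p) v /\
  forall x y, chart_pair_at f p x y ->
    let G := gram g y in
    let fh := local_rep f x y in
    let z := cmap x p in
    forall X1 X2, orthonormal_pair G fh X1 X2 z ->
      v y = 2^-1 *: (second_fundamental_form G fh X1 X1 z
                     + second_fundamental_form G fh X2 X2 z).

Definition section_along f (H : M -> chart R N n.+2 -> 'rV[R]_n.+2) : Prop :=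
  forall p, tangent_vector (f p) (H p).

Definition section_class (r : diff_class) (b : R) f
    (H : M -> chart R N n.+2 -> 'rV[R]_n.+2) : Prop :=
  forall x y, chart_pair f x y ->
    class_on r b (cimg x) (fun z => H (cinv x z) y).

End Surfaces.

(* Main.v *)
(* In a complex chart where phi is the local representative of f, conformality
   gives H = (D_0 d_0 phi + D_1 d_1 phi) / (2 E), with D the Levi-Civita derivative
   along phi and E = |d_0 phi|^2: since D is metric and torsion-free, the numerator
   is automatically normal.  It is (d_0^2 phi + d_1^2 phi)
   + Gamma(d_0 phi, d_0 phi) + Gamma(d_1 phi, d_1 phi).  Near a branch point the
   Laplacian equals 4 |z|^(2s) l, and the quadratic terms in d phi carry the factor
   |(s + 1) z^s|^2.  Dividing numerator and E by |z|^(2s),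
     H = (l + (s + 1)^2 (Gamma(Re d, Re d) + Gamma(Im d, Im d)))
         / ((s + 1)^2 (|Re d|^2 + |Im d|^2)),
   where the denominator does not vanish at 0 because Re d_1 (0) = 1/2; this is of
   class C^{r,b}.  Intrinsically, the local extensions agree at regular points, and
   the values at the remaining points are the ones given by the formula.

   In the analytic case, products, compositions and inverses are handled through
   the characterization of analyticity by local bounds C B^k k! on the derivatives
   of order k. *)

Require Import Defs.
From HB Require Import structures.
From mathcomp Require Import all_boot all_order all_algebra complex.
From mathcomp Require Import all_classical all_reals all_analysis.
From mathcomp Require Import ring lra zify.
Set Implicit Arguments.
Unset Strict Implicit.
Unset Printing Implicit Defensive.
Import Order.TTheory GRing.Theory Num.Theory.
Import numFieldNormedType.Exports.
Local Open Scope classical_set_scope.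
Local Open Scope ring_scope.

(** * Differential calculus in coordinates *)

Section Lines.
Context {R : realType} {V W : normedModType R}.
Implicit Types (f : V -> W).

(** Three obstacles shape the proof. Composition with a merely Hölder inner map lowers the Hölder
    exponent, so the inner map must always have one order more than the result; orders of
    differentiability are therefore counted throughout. Next, the mean curvature vector is defined
    through arbitrary real coordinate systems and arbitrary orthonormal pairs, whereas the quotient
    formula holds in complex charts only; the transformation laws of the Levi-Civita derivative and
    of the second fundamental form, derived from Koszul's formula, connect the two. Finally, regular
    and branch points are described by quantifiers over charts, so the construction splits instead
    according to whether E is nonzero in some pair of a complex chart and a chart of the target. If
    it is, the value of H is forced and all choices agree. If not, the point is a branch point and
    takes the value of the quotient formula in one chosen pair. No comparison with other pairs has
    to be made at the point itself, and at the other points near it E is nonzero in the chosen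
    pair. *)

Lemma is_derive_line f x v (t : R) df :
  is_derive (x + t *: v) v f df <-> is_derive t 1 (fun s : R => f (x + s *: v)) df.
Proof.
have E : (fun h : R => h^-1 *: ((f \o shift (x + t *: v)) (h *: v) - f (x + t *: v)))
  = (fun h : R => h^-1 *: (((fun s => f (x + s *: v)) \o shift t) (h *: 1) - f (x + t *: v))).
  rewrite funeqE => h /=; congr (_ *: (f _ - _)).
  by rewrite [h *: 1]mulr1 scalerDl addrCA addrC -addrA [t *: v + _]addrC.
by split => -[d1 d2]; split; move: d1 d2; rewrite /derivable /derive E.
Qed.

(** Only a derivative along [v] is assumed, not differentiability of [f]; the scaling therefore goes
    through the one-variable chain rule for s |-> s h. *)
Lemma is_derive_scale f a v (h : R) df :
  is_derive a v f df -> is_derive a (h *: v) f (h *: df).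
Proof.
move=> fd.
have [->|h0] := eqVneq h 0.
  by rewrite !scale0r; split; [exact: derivable0 | rewrite derive0].
have fd0 : is_derive (0 : R) 1 (fun s : R => f (a + s *: v)) df.
  by apply/is_derive_line; rewrite scale0r addr0.
suff : is_derive (0 : R) 1 (fun s : R => f (a + s *: (h *: v))) (h *: df).
  by move/is_derive_line; rewrite scale0r addr0.
pose g := fun s : R => f (a + s *: v); pose k : R -> R := fun s => s * h.
have dk : differentiable k 0 by apply/derivable1_diffP; apply: derivableM.
have dg : differentiable g (k 0).
  by rewrite /k mul0r; apply/derivable1_diffP; case: fd0.
have -> : (fun s : R => f (a + s *: (h *: v))) = g \o k.
  by rewrite funeqE => s; rewrite /g /k /= scalerA.
split; first by apply: diff_derivable; exact: differentiable_comp.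
rewrite deriveE; last exact: differentiable_comp.
rewrite diff_comp //= -[in 'd k 0 1]deriveE //.
have -> : 'D_1 k 0 = h.
  rewrite /k (_ : (fun s => _) = id * cst h); last by rewrite funeqE.
  rewrite deriveM // derive_id derive_cst scaler0 add0r.
  by rewrite -[LHS]/(h * 1) mulr1.
have -> : 'd g (k 0) h = h *: 'd g (k 0) 1 by rewrite -linearZ /= [h *: 1]mulr1.
rewrite -deriveE //.
by case: fd0 => _ <-; rewrite /k mul0r.
Qed.

End Lines.

Section Mvt.
Context {R : realType} {V : normedModType R}.

Lemma MVT_line (f : V -> R) x v :
  (forall t : R, 0 <= t <= 1 -> derivable f (x + t *: v) v) ->
  exists2 t : R, 0 <= t <= 1 & f (x + v) - f x = 'D_v f (x + t *: v).
Proof.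
move=> fd; pose g := fun s : R => f (x + s *: v).
have gd (s : R) : 0 <= s <= 1 -> is_derive s 1 g ('D_v f (x + s *: v)).
  by move=> /fd/derivableP; apply: (is_derive_line f x v s _).1.
have gc : {within `[0, 1], continuous g}.
  apply: derivable_within_continuous => s; rewrite in_itv /= => s01.
  by case: (gd s s01).
have gd' (s : R) : s \in `]0, 1[ -> is_derive s 1 g ('D_v f (x + s *: v)).
  by rewrite in_itv /= => /andP[s0 s1]; apply: gd; rewrite !ltW.
have [c c01 E] := MVT_segment ler01 gd' gc.
exists c; first by rewrite in_itv /= in c01.
by move: E; rewrite /g scale1r scale0r addr0 subr0 mulr1.
Qed.

End Mvt.

Section Boxes.
Context {R : realType} {m : nat}.
Notation E := 'rV[R]_m.
Implicit Types (x z p a : E) (f : E -> R).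

(** Each coordinate has its own parameter: [p] ranges over the closed box with opposite corners [x]
    and [z], not over the segment. A path that changes one coordinate at a time leaves the segment
    but not the box. *)
Definition in_box x z p :=
  forall i, exists2 t : R, 0 <= t <= 1 & p 0 i = x 0 i + t * (z 0 i - x 0 i).

Lemma norm_rV_le (u : E) (e : R) :
  0 <= e -> (`|u| <= e) = [forall i, `|u 0 i| <= e].
Proof.
move=> e0; rewrite [X in X <= _]/Num.Def.normr /= mx_normrE.
apply/idP/forallP => [/bigmax_leP[_ H] i|H]; first exact: (H (0, i)).
by apply/bigmax_leP; split=> // -[i j] _ /=; rewrite ord1.
Qed.

Lemma norm_coord_le (u : E) i : `|u 0 i| <= `|u|.
Proof. by have := norm_rV_le u (normr_ge0 u); rewrite lexx => /esym/forallP. Qed.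

Lemma in_box_norm a x z p (e : R) :
  `|x - a| <= e -> `|z - a| <= e -> in_box x z p -> `|p - a| <= e.
Proof.
move=> xe ze box; have e0 : 0 <= e by apply: le_trans xe.
rewrite norm_rV_le //; apply/forallP => i; have [t t01 pE] := box i.
have := le_trans (norm_coord_le (x - a) i) xe.
have := le_trans (norm_coord_le (z - a) i) ze.
by rewrite !mxE pE !ler_norml => /andP[? ?] /andP[? ?]; apply/andP; split; nra.
Qed.

Lemma in_box_ball a x z p (e : R) :
  ball a e x -> ball a e z -> in_box x z p -> ball a e p.
Proof.
rewrite -!ball_normE /= ![`|a - _|]distrC => xe ze box.
have [xM zM] : `|x - a| <= Num.max `|x - a| `|z - a| /\ `|z - a| <= Num.max `|x - a| `|z - a|.
  by rewrite !le_max !lexx orbT.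
by apply: le_lt_trans (in_box_norm xM zM box) _; rewrite gt_max xe ze.
Qed.

Lemma in_box_dist x z p : in_box x z p -> `|p - x| <= `|z - x|.
Proof. by apply: in_box_norm; rewrite ?subrr ?normr0. Qed.

Let mix (k : nat) x z : E := \row_i (if (i < k)%N then z 0 i else x 0 i).

(** Telescoping along the points [mix k x z], whose first k coordinates are those of [z], so that
    each step is a mean value theorem in one coordinate. Only partial derivatives are at hand, hence
    one intermediate point per coordinate. *)
Lemma MVT_box f x z :
  (forall p i, in_box x z p -> derivable f p (basis_vec i)) ->
  exists2 xi : 'I_m -> E, forall i, in_box x z (xi i) &
    f z - f x = \sum_i (z 0 i - x 0 i) * 'D_(basis_vec i) f (xi i).
Proof.
move=> fd.
have step (i : 'I_m) : exists2 p, in_box x z p &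
    f (mix i.+1 x z) - f (mix i x z) = (z 0 i - x 0 i) * 'D_(basis_vec i) f p.
  pose h := z 0 i - x 0 i.
  have mixE : mix i.+1 x z = mix i x z + h *: basis_vec i.
    apply/rowP => j; rewrite !mxE /= -val_eqE /= ltnS leq_eqVlt.
    case: eqP => [/val_inj ->|_]; first by rewrite ltnn /= /h mulr1 addrC subrK.
    by rewrite /= mulr0 addr0.
  have box (t : R) : 0 <= t <= 1 -> in_box x z (mix i x z + t *: (h *: basis_vec i)).
    move=> t01 j; rewrite !mxE /=; have [<-|ne] := eqVneq i j.
      by exists t => //; rewrite ltnn /h !mulr1.
    rewrite mulr0n !mulr0 addr0; case: ifP => _.
      by exists 1; rewrite ?lexx ?ler01 // mul1r addrC subrK.
    by exists 0; rewrite ?lexx ?ler01 // mul0r addr0.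
  have dd (t : R) : 0 <= t <= 1 ->
     is_derive (mix i x z + t *: (h *: basis_vec i)) (h *: basis_vec i) f
        (h *: 'D_(basis_vec i) f (mix i x z + t *: (h *: basis_vec i))).
    by move=> /box t01; apply/is_derive_scale/derivableP/fd.
  have [t t01 Et] := MVT_line (fun t t01 => @ex_derive _ _ _ _ _ _ _ (dd t t01)).
  exists (mix i x z + t *: (h *: basis_vec i)); first exact: box.
  by rewrite mixE Et; case: (dd t t01).
have [xi xib xiE] : exists2 xi : 'I_m -> E, forall i, in_box x z (xi i) &
   forall i : 'I_m, f (mix i.+1 x z) - f (mix i x z) = (z 0 i - x 0 i) * 'D_(basis_vec i) f (xi i).
  have [xi H] := choice (fun i => let: ex_intro2 p a b := step i in ex_intro _ p (conj a b)).
  by exists xi => i; case: (H i).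
exists xi => //; under eq_bigr do rewrite -xiE.
rewrite -(big_mkord xpredT (fun i => f (mix i.+1 x z) - f (mix i x z))).
rewrite telescope_sumr //; congr (f _ - f _); apply/rowP => i; rewrite !mxE //.
by rewrite ltn_ord.
Qed.

Let dlin (c : 'I_m -> R) (v : E) : R := \sum_i v 0 i * c i.

Lemma sum_coord_continuous (c : 'I_m -> R) : continuous (dlin c).
Proof.
move=> x; apply/(@cvgrPdist_le _ _ _ (nbhs x)) => /= e e0.
have [K K0 cK] : exists2 K : R, 0 < K & \sum_i `|c i| <= K.
  by exists (\sum_i `|c i| + 1); rewrite ?lerDl // ltr_wpDl // sumr_ge0.
near=> y; rewrite /dlin -sumrB; apply: (le_trans (ler_norm_sum _ _ _)).
apply: (@le_trans _ _ (\sum_i `|c i| * (e / K))).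
  apply: ler_sum => i _; rewrite -mulrBl normrM mulrC ler_wpM2l //.
  have := norm_coord_le (x - y) i; rewrite !mxE => /le_trans; apply.
  by near: y; apply: cvgr_dist_le; rewrite ?divr_gt0.
by rewrite -mulr_suml mulrCA ler_piMr ?(ltW e0) // ler_pdivrMr // mul1r.
Unshelve. all: by end_near. Qed.

(** By [MVT_box] the error of the linear approximation is the sum of h_i times the variation of the
    i-th partial derivative between [a] and a point of the box, which continuity makes small. *)
Lemma C1_is_diff (U : set E) f a : open U -> U a ->
  (forall x i, U x -> derivable f x (basis_vec i)) ->
  (forall i, {for a, continuous ('D_(basis_vec i) f)}) ->
  is_diff a f (fun v => \sum_i v 0 i * 'D_(basis_vec i) f a).
Proof.
move=> Uo Ua fd fc; set c := fun i => 'D_(basis_vec i) f a.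
have [L LE] : exists L : {linear E -> R}, L = dlin c :> (E -> R).
  unshelve eexists; first exists (dlin c); do 2?[eexists]; do ?[constructor];
    rewrite /dlin //.
  - by rewrite big1 // => i _; rewrite mxE mul0r.
  - by move=> u v; rewrite -big_split; apply: eq_bigr => i _; rewrite mxE mulrDl.
  - by move=> k v; rewrite scaler_sumr; apply: eq_bigr => i _; rewrite mxE -mulrA.
have Lc : continuous L by rewrite LE; apply: sum_coord_continuous.
have lo (e : R) : 0 < e -> \forall h \near (0 : E),
    `|(f \o shift a - (cst (f a) + (L : E -> R))) h| <= e * `|h|.
  move=> e0.
  (* A share of [e] for each coordinate; m + 1 instead of m covers dimension 0. *)
  have em : 0 < e / m.+1%:R by rewrite divr_gt0.
  have : \forall p \near a, U p /\ forall i, `|c i - 'D_(basis_vec i) f p| <= e / m.+1%:R.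
    near=> p; split; first by near: p; apply: open_nbhs_nbhs.
    by near: p; apply: filter_forall => i; apply: cvgr_dist_le; [exact: fc|].
  move=> /nbhs_ballP[r /= r0 rP].
  near=> h.
  have hr : `|h| < r.
    near: h; apply/nbhs_ballP; exists r => // p.
    by rewrite -ball_normE /= sub0r normrN.
  have inb p : in_box a (h + a) p -> ball a r p.
    move=> /in_box_dist; rewrite addrK => ph.
    by rewrite -ball_normE /= distrC; apply: le_lt_trans hr.
  have [xi xib fE] : exists2 xi : 'I_m -> E, forall i, in_box a (h + a) (xi i) &
    f (h + a) - f a = \sum_i ((h + a) 0 i - a 0 i) * 'D_(basis_vec i) f (xi i).
    by apply: MVT_box => p i /inb/rP[Up _]; exact: fd.
  have -> : (f \o shift a - (cst (f a) + (L : E -> R))) h =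
     \sum_i h 0 i * ('D_(basis_vec i) f (xi i) - c i).
    rewrite -[LHS]/(f (h + a) - (f a + L h)) opprD addrA fE LE /dlin -sumrB.
    by apply: eq_bigr => i _; rewrite mxE addrK mulrBr.
  apply: (le_trans (ler_norm_sum _ _ _)).
  apply: (@le_trans _ _ (\sum_(i < m) `|h| * (e / m.+1%:R))).
    apply: ler_sum => i _; rewrite normrM ler_pM ?norm_coord_le //.
    by rewrite distrC; case: (rP _ (inb _ (xib i))).
  rewrite sumr_const card_ord -mulrnAr [leRHS]mulrC ler_wpM2l //.
  rewrite -mulr_natl mulrCA ler_piMr ?(ltW e0) // ler_pdivrMr // mul1r ler_nat.
  exact: leqnSn.
have dE : 'd f a = L :> (E -> R) by apply: diff_unique Lc _; apply/eqaddoP => e /lo.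
split; last by rewrite dE LE.
by apply/diff_locallyP; rewrite dE; split => //; apply/eqaddoP => e /lo.
Unshelve. all: by end_near. Qed.

End Boxes.

Lemma is_derive_translate {R : realType} {V W : normedModType R} (g : V -> W)
    (x v a : V) (l : W) :
  is_derive (x - a) v g l -> is_derive x v (fun y => g (y - a)) l.
Proof.
have E : (fun h : R => h^-1 *: ((g \o shift (x - a)) (h *: v) - g (x - a)))
  = (fun h : R => h^-1 *: (((fun y => g (y - a)) \o shift x) (h *: v) - g (x - a))).
  by rewrite funeqE => h /=; rewrite addrA.
by move=> [d1 d2]; split; move: d1 d2; rewrite /derivable /derive E.
Qed.

Lemma is_derive_mxP {R : realType} {V : normedModType R} {p q} (F : V -> 'M[R]_(p, q))
    (x v : V) (dF : 'M[R]_(p, q)) :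
  is_derive x v F dF <-> forall i j, is_derive x v (fun z => F z i j) (dF i j).
Proof.
split=> [[Fd <-] i j|H].
  by split; [exact: (derivable_mxP _ _ _).1 | rewrite derive_mx // mxE].
have Fd : derivable F x v by apply/derivable_mxP => i j; case: (H i j).
split=> //; rewrite derive_mx //; apply/matrixP => i j; rewrite mxE.
by case: (H i j).
Qed.

Local Opaque derive.

Notation pd i f := ('D_(basis_vec i) f).

(** * Symmetry of second derivatives *)

Section Schwarz.
Context {R : realType} {m : nat}.
Notation E := 'rV[R]_m.

Lemma norm_basis_vec_le (i : 'I_m) : `|basis_vec i : E| <= 1.
Proof.
rewrite norm_rV_le ?ler01 //; apply/forallP => j; rewrite mxE /=.
by case: eqP => _; rewrite ?normr1 ?normr0.
Qed.

(** Two mean value theorems: along e_i for u(z) = f(z + h e_j) - f(z), then along e_j for the i-th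
    partial derivative. The left side is symmetric in i and j. The points used lie within 2 h of
    [a], whence h + h < r. *)
Lemma second_difference (f : E -> R) (U : set E) a (r h : R) (i j : 'I_m) :
  ball a r `<=` U -> 0 < h -> h + h < r ->
  (forall x, U x -> derivable f x (basis_vec i)) ->
  (forall x, U x -> derivable (pd i f) x (basis_vec j)) ->
  exists2 p, ball a r p &
    f (a + h *: basis_vec i + h *: basis_vec j) - f (a + h *: basis_vec i)
    - f (a + h *: basis_vec j) + f a = h * h * pd j (pd i f) p.
Proof.
move=> aU h0 hr fi fij.
have inU (s t : R) : 0 <= s <= 1 -> 0 <= t <= 1 ->
    ball a r (a + s *: (h *: basis_vec i) + t *: (h *: basis_vec j)).
  move=> /andP[s0 s1] /andP[t0 t1]; rewrite -ball_normE /= -addrA opprD addNKr normrN.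
  apply: le_lt_trans hr; apply: (le_trans (ler_normD _ _)); apply: lerD;
    rewrite !scalerA normrZ normrM (gtr0_norm h0) -[leRHS]mulr1 ger0_norm //;
    by rewrite ler_pM // ?norm_basis_vec_le ?mulr_ge0 ?(ltW h0) // ler_piMl ?(ltW h0).
have in0 (s : R) : 0 <= s <= 1 -> ball a r (a + s *: (h *: basis_vec i)).
  move=> s01; have := inU s 0 s01; rewrite lexx ler01 scale0r addr0; exact.
pose u := fun z : E => f (z + h *: basis_vec j) - f z.
have fsh (t : R) z : U (z + t *: (h *: basis_vec j)) ->
   is_derive z (h *: basis_vec i) (fun z => f (z + t *: (h *: basis_vec j)))
     (h *: pd i f (z + t *: (h *: basis_vec j))).
  move=> /fi/derivableP Uz; apply: is_derive_scale.
  have := is_derive_line f (z + t *: (h *: basis_vec j)) (basis_vec i) 0 (pd i f (z + t *: (h *: basis_vec j))).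
  rewrite scale0r addr0 => -[/(_ Uz) H _].
  have [_] := is_derive_line (fun z => f (z + t *: (h *: basis_vec j))) z (basis_vec i) 0 (pd i f (z + t *: (h *: basis_vec j))).
  rewrite scale0r addr0; apply.
  rewrite (_ : (fun s => _) = (fun s : R => f (z + t *: (h *: basis_vec j) + s *: basis_vec i))) //.
  by rewrite funeqE => s; congr f; rewrite addrAC.
have ud (t : R) : 0 <= t <= 1 -> is_derive (a + t *: (h *: basis_vec i)) (h *: basis_vec i) u
   (h *: pd i f (a + t *: (h *: basis_vec i) + h *: basis_vec j)
    - h *: pd i f (a + t *: (h *: basis_vec i))).
  move=> t01.
  have U1 : U (a + t *: (h *: basis_vec i) + 1 *: (h *: basis_vec j)).
    by apply/aU/inU => //; rewrite ler01 lexx.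
  have U0 : U (a + t *: (h *: basis_vec i) + 0 *: (h *: basis_vec j)).
    by apply/aU/inU => //; rewrite ler01 lexx.
  have := is_deriveB (fsh _ _ U1) (fsh _ _ U0).
  rewrite scale1r scale0r addr0.
  rewrite (_ : (fun z => _) - _ = u) // funeqE => z.
  by rewrite /u -[LHS]/(_ - _) addr0.
have [t t01 Et] := MVT_line (fun t t01 => @ex_derive _ _ _ _ _ _ _ (ud t t01)).
have [|t' t'01 Et'] := @MVT_line R _ (pd i f) (a + t *: (h *: basis_vec i)) (h *: basis_vec j).
  by move=> t' t'01; have /aU/fij/derivableP/(is_derive_scale h)[] := inU _ _ t01 t'01.
exists (a + t *: (h *: basis_vec i) + t' *: (h *: basis_vec j)); first exact: inU.
have [_ uE] := ud _ t01.
have /aU/fij/derivableP/(is_derive_scale h)[_ vE] := inU _ _ t01 t'01.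
rewrite -mulrA -[h * pd j _ _]/(h *: _) -vE -Et' mulrBr.
rewrite -[h * _ - _]/(h *: _ - h *: _) -uE -Et /u.
ring.
Qed.

Lemma continuous_near_le (f : E -> R) a (e : R) :
  {for a, continuous f} -> 0 < e -> \forall p \near a, `|f a - f p| <= e.
Proof.
by move=> fc e0; have := @cvgr_dist_le _ _ _ _ _ _ _ fc; apply.
Qed.

Lemma dist_le_half (A B x y e : R) :
  `|A - x| <= e / 2 -> `|B - y| <= e / 2 -> y = x -> `|A - B| <= e.
Proof.
move=> Ax By yx; rewrite (splitr e) -(subrKA x).
by rewrite (le_trans (ler_normD _ _)) // lerD // distrC -yx.
Qed.

(** The symmetric second difference, expanded in both orders, shows that the two mixed derivatives
    take the same value at two nearby points; continuity moves both points to [a]. *)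
Lemma schwarz (f : E -> R) (U : set E) a (i j : 'I_m) :
  open U -> U a ->
  (forall x k, U x -> derivable f x (basis_vec k)) ->
  (forall x k l, U x -> derivable (pd k f) x (basis_vec l)) ->
  (forall k l, {for a, continuous (pd l (pd k f))}) ->
  pd i (pd j f) a = pd j (pd i f) a.
Proof.
move=> Uo Ua f1 f2 fc; apply/eqP; rewrite -subr_eq0 -normr_le0.
apply/ler_addgt0Pr => e e0; rewrite add0r.
have e2 : 0 < e / 2 by rewrite divr_gt0.
have Ha := filterI (open_nbhs_nbhs (conj Uo Ua)) (filterI
  (continuous_near_le (fc j i) e2) (continuous_near_le (fc i j) e2)).
have [r /= r0 rP] := iffLR (nbhs_ballP a _) (Ha _ _).
have aU : ball a r `<=` U by move=> p /rP[].
have h0 : 0 < r / 4 by rewrite divr_gt0.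
have hr : r / 4 + r / 4 < r by lra.
have [p /rP[_ [_ pe]] pE] := second_difference aU h0 hr (fun x => f1 x i) (fun x => f2 x i j).
have [q /rP[_ [qe _]] qE] := second_difference aU h0 hr (fun x => f1 x j) (fun x => f2 x j i).
have E : pd j (pd i f) p = pd i (pd j f) q.
  apply: (@mulfI _ (r / 4 * (r / 4))); first by rewrite mulf_neq0 // gt_eqF.
  apply: etrans (esym pE) (etrans _ qE).
  by rewrite [a + _ + _]addrAC; ring.
exact: (dist_le_half qe pe E).
Qed.

End Schwarz.

Section Chain.
Context {R : realType} {V : normedModType R} {m : nat}.
Notation E := 'rV[R]_m.

Lemma differentiable_rV (phi : V -> E) x :
  (forall i, differentiable (fun z => phi z 0 i) x) -> differentiable phi x.
Proof.
move=> H; have -> : phi = \sum_i (fun z => phi z 0 i *: basis_vec i).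
  rewrite funeqE => z; rewrite [LHS]row_sum_delta.
  by rewrite fct_sumE.
apply: differentiable_sum => i; exact: differentiableZl.
Qed.

Lemma chain_rule (U : set E) (g : E -> R) (phi : V -> E) x v :
  open U -> U (phi x) ->
  (forall y i, U y -> derivable g y (basis_vec i)) ->
  (forall i, {for phi x, continuous (pd i g)}) ->
  (forall i, differentiable (fun z => phi z 0 i) x) ->
  is_derive x v (fun z => g (phi z))
    (\sum_i 'D_v (fun z => phi z 0 i) x * pd i g (phi x)).
Proof.
move=> Uo Ux gd gc pd.
have gD := C1_is_diff Uo Ux gd gc.
have pD := differentiable_rV pd.
have gD' : differentiable g (phi x) by case: gD.
split; first by apply: diff_derivable; exact: differentiable_comp.
rewrite deriveE; last exact: (differentiable_comp pD gD').
rewrite (diff_comp pD gD') /=; case: gD => _ ->.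
apply: eq_bigr => i _; congr (_ * _).
rewrite -deriveE // derive_mx; last exact: diff_derivable.
by rewrite mxE.
Qed.

End Chain.

Section Topology.
Context {T S : topologicalType}.

Lemma near_open (U : set T) (a : T) (P : T -> Prop) :
  open U -> U a -> (forall x, U x -> P x) -> \forall x \near a, P x.
Proof. by move=> Uo Ua UP; apply: filterS UP _; exact: open_nbhs_nbhs. Qed.

Lemma continuous_at_ext (f g : T -> S) (a : T) :
  (\forall x \near a, f x = g x) -> {for a, continuous f} -> {for a, continuous g}.
Proof.
move=> fg fc; rewrite /prop_for /continuous_at -(nbhs_singleton fg).
by apply: cvg_trans fc; apply: near_eq_cvg; apply: filterS fg => x ->.
Qed.

Lemma near_forall (I : finType) (a : T) (P : I -> T -> Prop) :
  (forall i, \forall x \near a, P i x) -> \forall x \near a, forall i, P i x.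
Proof. by move=> H; exact: filter_forall. Qed.

End Topology.

(** * Hölder classes of finite order *)

Section General.
Context {R : realType} {m : nat} {W : normedModType R}.
Notation E := 'rV[R]_m.
Implicit Types (U V : set E) (f g : E -> W) (b : R).

Lemma class_fin_cont b k U f : class_fin b k U f -> continuous_on U f.
Proof. by case: k => [|k] []. Qed.

Lemma class_fin_sub b k U V f :
  V `<=` U -> class_fin b k U f -> class_fin b k V f.
Proof.
move=> VU; elim: k f => [|k IH] f [fc fk]; (split; first by move=> a /VU/fc).
  by move=> /fk H a /VU/H.
by move=> i; have [d c] := fk i; split; [move=> x /VU/d | exact: IH].
Qed.

Lemma class_fin_ext b k U f g : open U -> (forall x, U x -> f x = g x) ->
  class_fin b k U f -> class_fin b k U g.
Proof.
move=> Uo; elim: k f g => [|k IH] f g fg [fc fk].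
all: have fg' a : U a -> \forall x \near a, f x = g x by move=> Ua; exact: near_open fg.
all: split; first by move=> a Ua; apply: (continuous_at_ext (fg' _ Ua)); exact: fc.
  move=> /fk H a Ua; have [Y [Ya [C YC]]] := H a Ua.
  exists (Y `&` U); split; first by apply: filterI => //; exact: open_nbhs_nbhs.
  by exists C => x z [Yx Ux] [Yz Uz]; rewrite -!fg //; exact: YC.
move=> i; have [d c] := fk i; split.
  by move=> x Ux; apply: near_eq_derivable (fg' _ Ux) (d _ Ux).
by apply: IH c => x Ux; apply: near_eq_derive; exact: fg'.
Qed.

Lemma class_fin_local b k U f :
  (forall a, U a -> exists2 V, V a & class_fin b k V f) -> class_fin b k U f.
Proof.
elim: k f => [|k IH] f Uf; (split; first by move=> a /Uf[V Va /class_fin_cont]; apply).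
  by move=> b0 a /Uf[V Va [_ /(_ b0)]]; apply.
move=> i; split; first by move=> x /Uf[V Vx [_ /(_ i)[+ _]]]; apply.
by apply: IH => a /Uf[V Vx [_ /(_ i)[_ +]]]; exists V.
Qed.

End General.

Section Componentwise.
Context {R : realType} {m p q : nat}.
Notation E := 'rV[R]_m.
Implicit Types (U : set E) (F : E -> 'M[R]_(p, q)) (b : R).

Lemma norm_mx_coord_le (A : 'M[R]_(p, q)) i j : `|A i j| <= `|A|.
Proof.
by rewrite [leRHS]/Num.Def.normr /= mx_normrE; exact: (le_bigmax _ _ (i, j)).
Qed.

Lemma norm_mx_le (A : 'M[R]_(p, q)) (e : R) :
  0 <= e -> (forall i j, `|A i j| <= e) -> `|A| <= e.
Proof.
move=> e0 H; rewrite [leLHS]/Num.Def.normr /= mx_normrE.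
by apply/bigmax_leP; split=> // -[i j].
Qed.

Lemma continuous_mxP F a :
  {for a, continuous F} <-> forall i j, {for a, continuous (fun x => F x i j)}.
Proof.
split=> [Fc i j|Fc].
  exact: (continuous_comp Fc (@coord_continuous R p q i j (F a))).
apply/(@cvgrPdist_le _ _ _ (nbhs a)) => /= e e0.
have H : \forall x \near a, forall i j, `|F a i j - F x i j| <= e.
  by apply: near_forall => i; apply: near_forall => j; exact: continuous_near_le.
apply: filterS H => x H; apply: norm_mx_le (ltW e0) _ => i j.
by rewrite !mxE; exact: H.
Qed.

Lemma pd_mx F a i (k : 'I_p) (l : 'I_q) : derivable F a (basis_vec i) ->
  pd i F a k l = pd i (fun x => F x k l) a.
Proof. by move=> Fd; rewrite /= derive_mx // mxE. Qed.

Lemma class_fin_mxP b k U F : open U ->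
  class_fin b k U F <-> forall i j, class_fin b k U (fun x => F x i j).
Proof.
move=> Uo; elim: k F => [|k IH] F; split.
- move=> [Fc Fh] i j; split; first by move=> a /Fc/continuous_mxP.
  move=> /Fh H a /H[V [Va [C VC]]]; exists V; split=> //; exists C => x z Vx Vz.
  apply: le_trans (VC _ _ Vx Vz).
  by have := norm_mx_coord_le (F x - F z) i j; rewrite !mxE.
- move=> H; split; first by move=> a Ua; apply/continuous_mxP => i j; case: (H i j) => + _; apply.
  move=> b0 a Ua.
  have {}H i j : exists VC : set E * R, nbhs a VC.1 /\ forall x z, VC.1 x -> VC.1 z ->
      `|F x i j - F z i j| <= VC.2 * `|x - z| `^ b.
    by have [_ /(_ b0 a Ua)[V [Va [C VC]]]] := H i j; exists (V, C).
  pose V i j := (projT1 (cid (H i j))).1; pose C i j := (projT1 (cid (H i j))).2.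
  have VP i j : nbhs a (V i j) by have [] := projT2 (cid (H i j)).
  have CP i j x z : V i j x -> V i j z -> `|F x i j - F z i j| <= C i j * `|x - z| `^ b.
    by have [_] := projT2 (cid (H i j)); apply.
  exists (fun x => forall i j, V i j x); split.
    by apply: (@near_forall E _ a) => i; apply: (@near_forall E _ a) => j; exact: VP.
  exists (\sum_i \sum_j `|C i j|) => x z Vx Vz.
  apply: norm_mx_le => [|i j].
    by rewrite mulr_ge0 ?powR_ge0 ?sumr_ge0 // => i _; rewrite sumr_ge0.
  rewrite !mxE; apply: (le_trans (CP _ _ _ _ (Vx i j) (Vz i j))).
  rewrite ler_wpM2r ?powR_ge0 // (le_trans (ler_norm _)) //.
  rewrite (bigD1 i) //= (bigD1 j) //= -addrA lerDl addr_ge0 ?sumr_ge0 // => i' _.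
  by rewrite sumr_ge0.
- move=> [Fc Fk] i j; split; first by move=> a /Fc/continuous_mxP.
  move=> l; have [d c] := Fk l; split; first by move=> x /d/derivable_mxP.
  by apply: class_fin_ext (Uo) _ ((IH _).1 c i j) => x Ux; rewrite pd_mx //; exact: d.
- move=> H; split.
    by move=> a Ua; apply/continuous_mxP => i j; case: (H i j) => + _; apply.
  move=> l; have Fd x : U x -> derivable F x (basis_vec l).
    by move=> Ux; apply/derivable_mxP => i j; have [_ /(_ l)[+ _]] := H i j; apply.
  split=> //; apply/IH => i j; have [_ /(_ l)[_ +]] := H i j.
  by apply: class_fin_ext => // x Ux; rewrite pd_mx //; exact: Fd.
Qed.

End Componentwise.

Section Hoelder.
Context {R : realType} {m : nat}.
Notation E := 'rV[R]_m.
Implicit Types (U : set E) (f g : E -> R) (b : R).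

Lemma near_bounded f a : {for a, continuous f} ->
  exists2 K : R, 0 < K & \forall x \near a, `|f x| <= K.
Proof.
move=> fc; exists (`|f a| + 1); first by rewrite ltr_pwDr.
apply: filterS (continuous_near_le fc ltr01) => x H.
rewrite addrC -(subrK (f a) (f x)) (le_trans (ler_normD _ _)) // lerD2r.
by rewrite distrC.
Qed.

Lemma lipschitz_loc_hoelder b U f : b <= 1 -> 0 < b ->
  (forall a, U a -> exists W : set E, nbhs a W /\
    exists C : R, forall x z, W x -> W z -> `|f x - f z| <= C * `|x - z|) ->
  hoelder_loc b U f.
Proof.
move=> b1 b0 H a /H[W [Wa [C WC]]].
(* In a ball of radius 1/2 distances are at most 1, where t <= t^b because b <= 1. *)
exists (W `&` ball a 2^-1); split.
  by apply: filterI => //; apply: nbhsx_ballx; rewrite invr_gt0.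
exists `|C| => x z [Wx xa] [Wz za]; apply: le_trans (WC _ _ Wx Wz) _.
apply: (@le_trans _ _ (`|C| * `|x - z|)); first by rewrite ler_wpM2r // ler_norm.
rewrite ler_wpM2l // -[leLHS]powRr1 //.
have [->|xz0] := eqVneq `|x - z| 0; first by rewrite !powR0 ?gt_eqF.
apply: ger_powR => //; rewrite lt_neqAle eq_sym xz0 normr_ge0 /=.
move: xa za; rewrite -!ball_normE /= => xa za.
rewrite -[x - z](subrKA a) (le_trans (ler_normD _ _)) // distrC (splitr 1).
by rewrite div1r lerD // ltW.
Qed.

Lemma C1_lipschitz_loc U f a : open U -> U a ->
  (forall x i, U x -> derivable f x (basis_vec i)) ->
  (forall i, {for a, continuous (pd i f)}) ->
  exists W : set E, nbhs a W /\
    exists2 C : R, 0 <= C & forall x z, W x -> W z -> `|f x - f z| <= C * `|x - z|.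
Proof.
move=> Uo Ua fd fc.
have H (i : 'I_m) : exists K : R, 0 < K /\ \forall x \near a, `|pd i f x| <= K.
  by have [K ? ?] := near_bounded (fc i); exists K.
have [K /all_and2[K0 aK]] := choice H.
have N : nbhs a (U `&` (fun x => forall i, `|pd i f x| <= K i)).
  by apply: filterI; [exact: open_nbhs_nbhs | exact: (@near_forall E _ a)].
have [r /= r0 rP] := iffLR (nbhs_ballP a _) N.
exists (ball a r); split; first exact: nbhsx_ballx.
exists (\sum_i K i) => [|x z xa za]; first by apply: sumr_ge0 => i _; exact: ltW.
have [xi xib fE] : exists2 xi : 'I_m -> E, forall i, in_box z x (xi i) &
    f x - f z = \sum_i (x 0 i - z 0 i) * 'D_(basis_vec i) f (xi i).
  by apply: MVT_box => p i /(in_box_ball za xa)/rP[Up _]; exact: fd.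
rewrite fE (le_trans (ler_norm_sum _ _ _)) // mulr_suml; apply: ler_sum => i _.
rewrite normrM mulrC ler_pM //.
  by have [_] := rP _ (in_box_ball za xa (xib i)); apply.
by have := norm_coord_le (x - z) i; rewrite !mxE.
Qed.

Lemma class_fin_differentiable b k U f a :
  open U -> U a -> class_fin b k.+1 U f -> differentiable f a.
Proof.
move=> Uo Ua [_ fk].
have H : is_diff a f (fun v => \sum_i v 0 i * 'D_(basis_vec i) f a).
  apply: C1_is_diff (Uo) (Ua) _ _ => [x i Ux|i]; first by have [+ _] := fk i; apply.
  by have [_ /class_fin_cont/(_ a Ua)] := fk i.
by case: H.
Qed.

(** [b <= 1] matters at the bottom of the induction, where the Hölder condition has to come from C^1
    functions being locally Lipschitz. *)
Lemma class_fin_le1 b k U f : b <= 1 -> open U ->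
  class_fin b k.+1 U f -> class_fin b k U f.
Proof.
move=> b1 Uo; elim: k f => [|k IH] f [fc fk]; split=> //.
  move=> b0; apply: lipschitz_loc_hoelder => // a Ua.
  have [|i|W [Wa [C _ CW]]] := @C1_lipschitz_loc U f a Uo Ua.
  - by move=> x i Ux; have [+ _] := fk i; apply.
  - by have [_ [cc _]] := fk i; exact: cc.
  by exists W; split => //; exists C.
by move=> i; have [? ?] := fk i; split=> //; exact: IH.
Qed.

Lemma class_fin_le b k l U f : b <= 1 -> open U -> (k <= l)%N ->
  class_fin b l U f -> class_fin b k U f.
Proof.
move=> b1 Uo; elim: l => [|l IH]; first by rewrite leqn0 => /eqP ->.
by rewrite leq_eqVlt => /predU1P[-> //|/IH{}IH /(class_fin_le1 b1 Uo)].
Qed.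

Lemma class_fin_zero b k U f : class_fin b k U f -> class_fin 0 k U f.
Proof.
elim: k f => [|k IH] f [fc fk]; split => //; first by rewrite ltxx.
by move=> i; have [? /IH] := fk i.
Qed.

Lemma class_fin_smooth b k U f : b <= 1 -> open U ->
  class_fin 0 k.+1 U f -> class_fin b k U f.
Proof.
move=> b1 Uo; elim: k f => [|k IH] f [fc fk]; split=> //.
  move=> b0; apply: lipschitz_loc_hoelder => // a Ua.
  have [|i|W [Wa [C _ CW]]] := @C1_lipschitz_loc U f a Uo Ua.
  - by move=> x i Ux; have [+ _] := fk i; apply.
  - by have [_ [cc _]] := fk i; exact: cc.
  by exists W; split => //; exists C.
by move=> i; have [? ?] := fk i; split=> //; exact: IH.
Qed.

Lemma hoelder_locM b U f g : open U -> continuous_on U f -> continuous_on U g ->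
  hoelder_loc b U f -> hoelder_loc b U g -> hoelder_loc b U (fun x => f x * g x).
Proof.
move=> Uo fc gc fh gh a Ua.
have [V [Va [C VC]]] := fh a Ua; have [W [Wa [D WD]]] := gh a Ua.
have [K K0 fK] := near_bounded (fc a Ua); have [L L0 gL] := near_bounded (gc a Ua).
exists ((V `&` W) `&` ((fun x => `|f x| <= K) `&` (fun x => `|g x| <= L))); split.
  by do !apply: filterI.
exists (K * D + L * C) => x z [[Vx Wx] [Kx Lx]] [[Vz Wz] [Kz Lz]].
have -> : f x * g x - f z * g z = f x * (g x - g z) + g z * (f x - f z) by ring.
rewrite (le_trans (ler_normD _ _)) // !normrM mulrDl -!mulrA lerD // ler_pM //.
  exact: WD.
exact: VC.
Qed.

Lemma hoelder_locD b U f g : hoelder_loc b U f -> hoelder_loc b U g ->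
  hoelder_loc b U (fun x => f x + g x).
Proof.
move=> fh gh a Ua.
have [V [Va [C VC]]] := fh a Ua; have [W [Wa [D WD]]] := gh a Ua.
exists (V `&` W); split; first exact: filterI.
exists (C + D) => x z [Vx Wx] [Vz Wz]; rewrite opprD addrACA mulrDl.
by rewrite (le_trans (ler_normD _ _)) // lerD ?VC ?WD.
Qed.

Lemma hoelder_locV b U f : continuous_on U f -> (forall x, U x -> f x != 0) ->
  hoelder_loc b U f -> hoelder_loc b U (fun x => (f x)^-1).
Proof.
move=> fc f0 fh a Ua.
have [V [Va [C VC]]] := fh a Ua.
have fVc : {for a, continuous (fun x => (f x)^-1)}.
  by apply: continuousV; [exact: f0 | exact: fc].
have [K K0 fK] := near_bounded fVc.
have fa0 : 0 < `|f a| / 2 by rewrite divr_gt0 // normr_gt0 f0.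
have fne : \forall x \near a, f x != 0.
  apply: filterS (continuous_near_le (fc a Ua) fa0) => x H.
  apply/eqP => fx; move: H fa0; rewrite fx subr0.
  by move=> H fa0; lra.
exists (V `&` ((fun x => `|(f x)^-1| <= K) `&` (fun x => f x != 0))); split.
  by do !apply: filterI.
exists (K * K * `|C|) => x z [Vx [Kx x0]] [Vz [Kz z0]].
have -> : (f x)^-1 - (f z)^-1 = (f x)^-1 * (f z)^-1 * (f z - f x).
  by field; rewrite x0 z0.
rewrite 2!normrM -[leRHS]mulrA; apply: ler_pM => //; first by rewrite ler_pM.
rewrite distrC (le_trans (VC _ _ Vx Vz)) // ler_wpM2r ?powR_ge0 //.
exact: ler_norm.
Qed.

End Hoelder.

Section Algebra.
Context {R : realType} {m : nat}.
Notation E := 'rV[R]_m.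
Implicit Types (U : set E) (f g : E -> R) (b : R).

Lemma class_fin_cst b k U (c : R) : class_fin b k U (fun=> c).
Proof.
elim: k c => [|k IH] c; (split; first by move=> a _; exact: cst_continuous).
  move=> b0 a Ua; exists setT; split; first exact: filterT.
  by exists 0 => x z _ _; rewrite subrr normr0 mul0r.
move=> i; split; first by move=> x _; exact: derivable_cst.
have -> : pd i (fun=> c) = (fun=> 0 : R) by rewrite funeqE => x; exact: derive_cst.
exact: IH.
Qed.

Lemma class_fin_add b k U f g : open U ->
  class_fin b k U f -> class_fin b k U g -> class_fin b k U (fun x => f x + g x).
Proof.
move=> Uo; elim: k f g => [|k IH] f g [fc fk] [gc gk].
all: split; first by move=> a Ua; apply: continuousD; [exact: fc|exact: gc].
  by move=> b0; apply: hoelder_locD; [exact: fk|exact: gk].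
move=> i; have [fd fD] := fk i; have [gd gD] := gk i; split.
  by move=> x Ux; apply: derivableD; [exact: fd|exact: gd].
apply: class_fin_ext (IH _ _ fD gD) => // x Ux.
exact: esym (deriveD (fd _ Ux) (gd _ Ux)).
Qed.

Lemma class_fin_mul b k U f g : b <= 1 -> open U ->
  class_fin b k U f -> class_fin b k U g -> class_fin b k U (fun x => f x * g x).
Proof.
move=> b1 Uo; elim: k f g => [|k IH] f g Hf Hg.
all: have [fc fk] := Hf; have [gc gk] := Hg.
all: split; first by move=> a Ua; apply: continuousM; [exact: fc|exact: gc].
  by move=> b0; apply: hoelder_locM => //; [exact: fk|exact: gk].
move=> i; have [fd fD] := fk i; have [gd gD] := gk i; split.
  by move=> x Ux; apply: derivableM; [exact: fd|exact: gd].
apply: class_fin_ext (class_fin_add Uo (IH _ _ (class_fin_le1 b1 Uo Hf) gD)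
  (IH _ _ (class_fin_le1 b1 Uo Hg) fD)) => // x Ux.
exact: esym (deriveM (fd _ Ux) (gd _ Ux)).
Qed.

Lemma class_fin_inv b k U f : b <= 1 -> open U -> (forall x, U x -> f x != 0) ->
  class_fin b k U f -> class_fin b k U (fun x => (f x)^-1).
Proof.
move=> b1 Uo f0; elim: k f f0 => [|k IH] f f0 Hf; have [fc fk] := Hf.
all: split; first by move=> a Ua; apply: continuousV; [exact: f0 | exact: fc].
  by move=> b0; apply: hoelder_locV => //; exact: fk.
move=> i; have [fd fD] := fk i; split.
  by move=> x Ux; apply: derivableV; [exact: f0|exact: fd].
have Hi := IH _ f0 (class_fin_le1 b1 Uo Hf).
have := class_fin_mul b1 Uo (class_fin_cst b k U (-1)) (class_fin_mul b1 Uo (class_fin_mul b1 Uo Hi Hi) fD).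
apply: class_fin_ext => // x Ux; rewrite /= deriveV ?f0 //; last exact: fd.
by rewrite -[RHS]/(_ * _) mulN1r mulNr -exprVn expr2.
Qed.

Lemma class_fin_sum (I : finType) b k U (F : I -> E -> R) : open U ->
  (forall i, class_fin b k U (F i)) -> class_fin b k U (fun x => \sum_i F i x).
Proof.
move=> Uo H; have : forall s : seq I, class_fin b k U (fun x => \sum_(i <- s) F i x).
  elim=> [|i s IH].
    by apply: class_fin_ext (class_fin_cst b k U 0) => // x _; rewrite big_nil.
  by apply: class_fin_ext (class_fin_add Uo (H i) IH) => // x _; rewrite big_cons.
exact.
Qed.

End Algebra.

Section Composition.
Context {R : realType} {p m : nat}.
Implicit Types (U : set 'rV[R]_p) (V : set 'rV[R]_m) (g : 'rV[R]_m -> R).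

Lemma class_fin_rV_continuous b k U (phi : 'rV[R]_p -> 'rV[R]_m) a : U a ->
  (forall i, class_fin b k U (fun z => phi z 0 i)) -> {for a, continuous phi}.
Proof.
move=> Ua H; apply/continuous_mxP => i j; rewrite ord1.
by have /class_fin_cont/(_ a Ua) := H j.
Qed.

Lemma hoelder_loc_comp b U V g (phi : 'rV[R]_p -> 'rV[R]_m) : 0 < b -> open U ->
  (forall x, U x -> V (phi x)) -> hoelder_loc b V g ->
  (forall i, class_fin b 1 U (fun z => phi z 0 i)) ->
  hoelder_loc b U (fun z => g (phi z)).
Proof.
move=> b0 Uo UV gh H a Ua.
have [W [Wa [C WC]]] := gh _ (UV _ Ua).
have Hi (i : 'I_m) : exists WC : set 'rV[R]_p * R, [/\ nbhs a WC.1, 0 <= WC.2 & forall x z,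
    WC.1 x -> WC.1 z -> `|phi x 0 i - phi z 0 i| <= WC.2 * `|x - z|].
  have [_ dk] := H i.
  have [|j|V' [V'a [D D0 DV]]] := @C1_lipschitz_loc _ _ U (fun z => phi z 0 i) a Uo Ua.
  - by move=> x j Ux; have [+ _] := dk j; apply.
  - by have [_ [cc _]] := dk j; exact: cc.
  by exists (V', D).
have [WC' HW] := choice Hi.
exists ((phi @^-1` W) `&` (fun x => forall i, (WC' i).1 x)); split.
  apply: filterI; first exact: (class_fin_rV_continuous Ua H).
  by apply: (@near_forall _ _ a) => i; case: (HW i).
pose K : R := \sum_i (WC' i).2.
have K0 : 0 <= K by apply: sumr_ge0 => i _; case: (HW i).
exists (`|C| * K `^ b) => x z [Wx xW] [Wz zW].
apply: le_trans (WC _ _ Wx Wz) _; rewrite -mulrA -powRM //.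
apply: (@le_trans _ _ (`|C| * `|phi x - phi z| `^ b)).
  by rewrite ler_wpM2r ?powR_ge0 // ler_norm.
rewrite ler_wpM2l //; apply: ge0_ler_powR; rewrite ?nnegrE ?mulr_ge0 // ?(ltW b0) //.
apply: norm_mx_le => [|i j]; first by rewrite mulr_ge0.
rewrite ord1 !mxE; have [_ _ /(_ _ _ (xW j) (zW j)) H1] := HW j.
apply: le_trans H1 _; rewrite ler_wpM2r // /K (bigD1 j) //= lerDl sumr_ge0 // => i' _.
by case: (HW i').
Qed.

(** Two b-Hölder maps compose to a b^2-Hölder map in general. One order more for [phi] makes it
    locally Lipschitz, so that the exponent b survives, and gives class k to the derivatives of
    [phi] in the chain rule. *)
Lemma class_fin_comp b k U V g (phi : 'rV[R]_p -> 'rV[R]_m) : b <= 1 ->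
  open U -> open V -> (forall x, U x -> V (phi x)) -> class_fin b k V g ->
  (forall i, class_fin b k.+1 U (fun z => phi z 0 i)) ->
  class_fin b k U (fun z => g (phi z)).
Proof.
move=> b1 Uo Vo UV; elim: k g => [|k IH] g [gc gk] H.
all: split; first by move=> a Ua;
  apply: continuous_comp (class_fin_rV_continuous Ua H) (gc _ (UV _ Ua)).
  by move=> b0; apply: hoelder_loc_comp UV (gk b0) H.
have chain x i : U x -> is_derive x (basis_vec i) (fun z => g (phi z))
    (\sum_j pd i (fun z => phi z 0 j) x * pd j g (phi x)).
  move=> Ux; apply: (chain_rule _ Vo (UV _ Ux)) => [y j Vy|j|j].
  - by have [+ _] := gk j; apply.
  - by have [_ /class_fin_cont/(_ _ (UV _ Ux))] := gk j.
  - exact: class_fin_differentiable Uo Ux (H j).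
move=> i; split=> [x Ux|]; first by case: (chain x i Ux).
have : class_fin b k U (fun x => \sum_j pd i (fun z => phi z 0 j) x * pd j g (phi x)).
  apply: class_fin_sum => // j; apply: class_fin_mul => //.
    by have [_ /(_ i)[_ /(class_fin_le1 b1 Uo)]] := H j.
  have [_ gD] := gk j.
  exact: (IH (pd j g) gD (fun l => class_fin_le1 b1 Uo (H l))).
by apply: class_fin_ext => // x Ux; case: (chain x i Ux).
Qed.

End Composition.

Lemma class_fin_coord {R : realType} {m : nat} (b : R) k (U : set 'rV[R]_m) i :
  b <= 1 -> open U -> class_fin b k U (fun z : 'rV[R]_m => z 0 i).
Proof.
(* Passing to order k + 1 exposes the partial derivatives, which are constants; no induction is
   left. *)
move=> b1 Uo; apply: (class_fin_le b1 Uo (leqnSn k)).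
have d j (x : 'rV[R]_m) : is_derive x (basis_vec j) (fun z : 'rV[R]_m => z 0 i) ((i == j)%:R).
  have dd := @differentiable_coord R 1 m x 0 i.
  split; first exact: diff_derivable.
  have <- : 'D_(basis_vec j) id x 0 i = (i == j)%:R by rewrite derive_id mxE /=.
  by rewrite derive_mx ?mxE //; exact: derivable_id.
split; first by move=> a _; exact: coord_continuous.
move=> j; split; first by move=> x _; case: (d j x).
apply: class_fin_ext (class_fin_cst b k U (i == j)%:R) => // x _.
by case: (d j x).
Qed.

(** * Real analyticity and derivative estimates *)

Section Words.
Context {R : realType} {m : nat}.
Notation E := 'rV[R]_m.
Implicit Types (U : set E) (f g : E -> R) (w : seq 'I_m).

Definition smooth U f := forall k, class_fin 0 k U f.

(* Words, rather than multi-indices, allow inductions that never reorder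
   derivatives. *)
Definition pdw w f : E -> R := foldl (fun g i => pd i g) f w.

Lemma pdw_rcons w i f : pdw (rcons w i) f = pd i (pdw w f).
Proof. by rewrite /pdw -cats1 foldl_cat. Qed.

Lemma smooth_pd U f i : smooth U f -> smooth U (pd i f).
Proof. by move=> H k; have [_ /(_ i)[]] := H k.+1. Qed.

Lemma smooth_pdw U f w : smooth U f -> smooth U (pdw w f).
Proof. by elim: w f => //= i w IH f /(@smooth_pd _ _ i)/IH. Qed.

Lemma smooth_derivable U f i x : smooth U f -> U x -> derivable f x (basis_vec i).
Proof. by move=> /(_ 1%N)[_ /(_ i)[+ _]]; apply. Qed.

Lemma smooth_differentiable U f x : open U -> smooth U f -> U x -> differentiable f x.
Proof. by move=> Uo /(_ 1%N) fs Ux; exact: class_fin_differentiable Uo Ux fs. Qed.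

Lemma smooth_ext U f g : open U -> (forall x, U x -> f x = g x) ->
  smooth U f -> smooth U g.
Proof. by move=> Uo fg fs k; exact: class_fin_ext Uo fg (fs k). Qed.

Lemma smooth_cst U (c : R) : smooth U (fun=> c).
Proof. by move=> k; exact: class_fin_cst. Qed.

Lemma smooth_add U f g : open U ->
  smooth U f -> smooth U g -> smooth U (fun x => f x + g x).
Proof. by move=> Uo fs gs k; exact: class_fin_add. Qed.

Lemma smooth_mul U f g : open U ->
  smooth U f -> smooth U g -> smooth U (fun x => f x * g x).
Proof. by move=> Uo fs gs k; exact: class_fin_mul. Qed.

Lemma pdw_ext U f g w x : open U -> (forall x, U x -> f x = g x) -> U x ->
  pdw w f x = pdw w g x.
Proof.
move=> Uo; elim: w f g => [|i w IH] f g fg Ux /=; first exact: fg.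
by apply: IH => // y Uy; apply: near_eq_derive; exact: near_open fg.
Qed.

Lemma pdw_cst w (c : R) x : w != [::] -> pdw w (fun=> c) x = 0.
Proof.
have H v (z : R) : pdw v (fun=> z) x = if v is [::] then z else 0.
  elim: v z => //= i v IH z; have -> : pd i (fun=> z) = (fun=> 0 : R).
    by rewrite funeqE => y; exact: derive_cst.
  by rewrite IH; case: v {IH}.
by case: w => // i w _; rewrite H.
Qed.

Lemma pdw_add U f g w x : open U -> smooth U f -> smooth U g -> U x ->
  pdw w (fun x => f x + g x) x = pdw w f x + pdw w g x.
Proof.
move=> Uo; elim: w f g => [|i w IH] f g fs gs Ux //=.
rewrite -(IH _ _ (smooth_pd i fs) (smooth_pd i gs) Ux).
apply: pdw_ext (Uo) _ Ux => y Uy.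
exact: (deriveD (smooth_derivable fs Uy) (smooth_derivable gs Uy)).
Qed.

Lemma pdw_sum (I : finType) U (F : I -> E -> R) w x : open U ->
  (forall i, smooth U (F i)) -> U x ->
  pdw w (fun x => \sum_i F i x) x = \sum_i pdw w (F i) x.
Proof.
move=> Uo Fs Ux; have H (s : seq I) : smooth U (fun x => \sum_(i <- s) F i x) /\
    pdw w (fun x => \sum_(i <- s) F i x) x = \sum_(i <- s) pdw w (F i) x.
  elim: s => [|i s [IHs IH]].
    have E0 y : \sum_(i <- [::]) F i y = 0 by rewrite big_nil.
    have -> : (fun x => \sum_(i <- [::]) F i x) = (fun=> 0).
      by rewrite funeqE => y; rewrite E0.
    split; first exact: smooth_cst.
    by rewrite big_nil; case: w => // j w; rewrite pdw_cst.
  have -> : (fun x => \sum_(i <- i :: s) F i x) = (fun x => F i x + \sum_(i <- s) F i x).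
    by rewrite funeqE => y; rewrite big_cons.
  split; first by apply: smooth_add.
  by rewrite (pdw_add _ Uo) // IH big_cons.
by case: (H (index_enum I)).
Qed.

(** Pascal's rule in summed form: the two sums on the left arise when the product rule puts one more
    derivative on the first or on the second factor. *)
Lemma pascal_sum (F G : nat -> R) k :
  \sum_(p < k.+1) 'C(k, p)%:R * F p.+1 * G (k - p)%N
  + \sum_(p < k.+1) 'C(k, p)%:R * F p * G (k - p).+1
  = \sum_(p < k.+2) 'C(k.+1, p)%:R * F p * G (k.+1 - p)%N.
Proof.
rewrite [RHS]big_ord_recl /= bin0 subn0 mul1r.
under [in RHS]eq_bigr => p _ do rewrite /bump /= add1n binS subSS natrD 2!mulrDl.
rewrite big_split /= [in RHS]addrA [LHS]addrC; congr (_ + _).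
rewrite [LHS]big_ord_recl /= bin0 subn0 mul1r; congr (_ + _).
rewrite [RHS]big_ord_recr /= bin_small // mul0r mul0r addr0.
by apply: eq_bigr => p _; rewrite /bump /= add1n subnSK.
Qed.

(** Leibniz formula as an inequality: each letter of [w] goes to one of the factors, and bounds that
    depend on lengths alone collect the distributions of letters into binomial coefficients. *)
Lemma pdw_mul_le U f g w x (F G : nat -> R) :
  open U -> smooth U f -> smooth U g -> U x ->
  (forall v, (size v <= size w)%N -> `|pdw v f x| <= F (size v)) ->
  (forall v, (size v <= size w)%N -> `|pdw v g x| <= G (size v)) ->
  `|pdw w (fun x => f x * g x) x|
    <= \sum_(p < (size w).+1) 'C(size w, p)%:R * F p * G (size w - p)%N.
Proof.
move=> Uo; elim: w f g F G => [|i w IH] f g F G fs gs Ux fF gG /=.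
  rewrite big_ord_recl big_ord0 addr0 bin0 mul1r normrM ler_pM //.
    exact: (fF [::]).
  exact: (gG [::]).
have -> : pdw w (pd i (fun x => f x * g x)) x
    = pdw w (fun x => pd i f x * g x) x + pdw w (fun x => f x * pd i g x) x.
  rewrite -(pdw_add _ Uo) //; [|exact/smooth_mul/gs/smooth_pd|exact/smooth_mul/smooth_pd].
  apply: pdw_ext (Uo) _ Ux => y Uy; rewrite addrC [pd i f y * _]mulrC.
  exact: (deriveM (smooth_derivable fs Uy) (smooth_derivable gs Uy)).
rewrite (le_trans (ler_normD _ _)) // -pascal_sum lerD //.
  apply: (IH _ _ (F \o succn)) => // [|v vw|v vw]; first exact: smooth_pd.
    by apply: (fF (i :: v)).
  by apply: gG; exact: leqW.
apply: (IH _ _ _ (G \o succn)) => // [|v vw|v vw]; first exact: smooth_pd.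
  by apply: fF; exact: leqW.
by apply: (gG (i :: v)).
Qed.

End Words.

Section Gevrey.
Context {R : realType} {m : nat}.
Notation E := 'rV[R]_m.
Implicit Types (U : set E) (f g : E -> R) (w : seq 'I_m).

(* Unlike power series, these estimates are visibly stable under products,
   compositions and inverses; analyticP shows that they characterize analyticity. *)
Definition gevrey U f := smooth U f /\
  forall a, U a -> exists W : set E, nbhs a W /\ exists C B : R, [/\ 0 <= C, 0 < B &
    forall w x, W x -> `|pdw w f x| <= C * B ^+ size w * (size w)`!%:R].

Lemma gevrey_pd U f i : gevrey U f -> gevrey U (pd i f).
Proof.
move=> [fs fb]; split; first exact: smooth_pd.
move=> a /fb[W [Wa [C [B [C0 B0 WB]]]]]; exists W; split => //.
(* One more derivative turns k! into (k + 1)!; the factor k + 1 <= 2^k is absorbed by doubling B. *)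
exists (C * B), (2 * B); split; rewrite ?mulr_ge0 ?mulr_gt0 ?(ltW B0) // => w x Wx.
apply: le_trans (WB (i :: w) x Wx) _; rewrite /= factS natrM exprS exprMn.
rewrite [leLHS](_ : _ = C * B * B ^+ size w * (size w)`!%:R * (size w).+1%:R); last by ring.
rewrite [leRHS](_ : _ = C * B * B ^+ size w * (size w)`!%:R * 2 ^+ size w); last by ring.
rewrite ler_wpM2l ?mulr_ge0 ?exprn_ge0 ?(ltW B0) //.
by rewrite -natrX ler_nat ltn_expl.
Qed.

Lemma gevrey_smooth U f : gevrey U f -> smooth U f.
Proof. by case. Qed.

Lemma gevrey_ext U f g : open U -> (forall x, U x -> f x = g x) ->
  gevrey U f -> gevrey U g.
Proof.
move=> Uo fg [fs fb]; split; first exact: smooth_ext fs.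
move=> a Ua; have [W [Wa [C [B [C0 B0 WB]]]]] := fb a Ua.
exists (W `&` U); split; first by apply: filterI => //; exact: open_nbhs_nbhs.
exists C, B; split=> // w x [Wx Ux].
by rewrite -(@pdw_ext _ _ U f g) //; exact: WB.
Qed.

Lemma gevrey_cst U (c : R) : gevrey U (fun=> c).
Proof.
split; first exact: smooth_cst.
move=> a _; exists setT; split; first exact: filterT.
exists `|c|, 1; split => // -[|i w] x _; first by rewrite /= !mulr1.
by rewrite pdw_cst // normr0 !mulr_ge0 // exprn_ge0.
Qed.

Lemma gevrey_bound2 U f g a : gevrey U f -> gevrey U g -> U a ->
  exists W : set E, nbhs a W /\ exists C D B : R, [/\ 0 <= C, 0 <= D, 0 < B,
    forall w x, W x -> `|pdw w f x| <= C * B ^+ size w * (size w)`!%:R &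
    forall w x, W x -> `|pdw w g x| <= D * B ^+ size w * (size w)`!%:R].
Proof.
move=> [_ fb] [_ gb] Ua.
have [W [Wa [C [B [C0 B0 WB]]]]] := fb a Ua.
have [W' [W'a [C' [B' [C'0 B'0 WB']]]]] := gb a Ua.
exists (W `&` W'); split; first exact: filterI.
exists C, C', (B + B'); split=> //; first exact: addr_gt0.
  move=> w x [/(WB w x) H _]; apply: le_trans H _; rewrite ler_wpM2r // ler_wpM2l //.
  by rewrite lerXn2r ?nnegrE ?addr_ge0 ?(ltW B0) ?(ltW B'0) // lerDl ltW.
move=> w x [_ /(WB' w x) H]; apply: le_trans H _; rewrite ler_wpM2r // ler_wpM2l //.
by rewrite lerXn2r ?nnegrE ?addr_ge0 ?(ltW B0) ?(ltW B'0) // lerDr ltW.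
Qed.

Lemma gevrey_add U f g : open U ->
  gevrey U f -> gevrey U g -> gevrey U (fun x => f x + g x).
Proof.
move=> Uo Hf Hg; split; first exact: smooth_add Uo Hf.1 Hg.1.
move=> a Ua; have [W [Wa [C [D [B [C0 D0 B0 WC WD]]]]]] := gevrey_bound2 Hf Hg Ua.
exists (W `&` U); split; first by apply: filterI => //; exact: open_nbhs_nbhs.
exists (C + D), B; split=> //; first exact: addr_ge0.
move=> w x [Wx Ux]; rewrite (pdw_add _ Uo Hf.1 Hg.1) // (le_trans (ler_normD _ _)) //.
by rewrite !mulrDl lerD ?WC ?WD.
Qed.

Lemma gevrey_mul U f g : open U ->
  gevrey U f -> gevrey U g -> gevrey U (fun x => f x * g x).
Proof.
move=> Uo Hf Hg; split; first exact: smooth_mul Uo Hf.1 Hg.1.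
move=> a Ua; have [W [Wa [C [D [B [C0 D0 B0 WC WD]]]]]] := gevrey_bound2 Hf Hg Ua.
exists (W `&` U); split; first by apply: filterI => //; exact: open_nbhs_nbhs.
(* The binomial coefficient cancels the factorials, so each of the k + 1 Leibniz terms equals C D
   B^k k!; again k + 1 <= 2^k. *)
exists (C * D), (2 * B); split=> //; [exact: mulr_ge0|exact: mulr_gt0|].
move=> w x [Wx Ux].
apply: le_trans (pdw_mul_le (F := fun k => C * B ^+ k * k`!%:R)
  (G := fun k => D * B ^+ k * k`!%:R) Uo Hf.1 Hg.1 Ux _ _) _.
- by move=> v _; exact: WC.
- by move=> v _; exact: WD.
set k := size w.
rewrite (eq_bigr (fun=> C * D * B ^+ k * k`!%:R)) => [|p _].
  rewrite sumr_const card_ord -[leLHS]mulr_natl exprMn.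
  rewrite [leRHS](_ : _ = 2 ^+ k * (C * D * B ^+ k * k`!%:R)); last by ring.
  rewrite ler_wpM2r ?mulr_ge0 ?exprn_ge0 ?(ltW B0) //.
  by rewrite -natrX ler_nat ltn_expl.
have pk : (p <= k)%N by rewrite -ltnS.
have -> : k`! = ('C(k, p) * (p`! * (k - p)`!))%N by rewrite bin_fact.
have -> : B ^+ k = B ^+ p * B ^+ (k - p) by rewrite -exprD subnKC.
by rewrite !natrM; ring.
Qed.

End Gevrey.

(** Monotonicity in a of the binomial coefficient C(a + s, s), cleared of denominators. *)
Lemma fact_ratio_le a k s : (a <= k)%N -> (k`! * (a + s)`! <= a`! * (k + s)`!)%N.
Proof.
move=> ak; elim: s => [|s IH]; first by rewrite !addn0 mulnC.
rewrite !addnS !factS mulnCA [leqRHS]mulnCA leq_mul // ltnS.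
by rewrite leq_add2r.
Qed.

Section Composition.
Context {R : realType} {p m : nat}.
Implicit Types (U : set 'rV[R]_p) (V : set 'rV[R]_m) (g : 'rV[R]_m -> R).
Implicit Types (phi : 'rV[R]_p -> 'rV[R]_m).

Lemma smooth_comp U V g phi : open U -> open V -> (forall x, U x -> V (phi x)) ->
  smooth V g -> (forall i, smooth U (fun z => phi z 0 i)) ->
  smooth U (fun z => g (phi z)).
Proof.
move=> Uo Vo UV gs ps k; apply: (class_fin_comp ler01 Uo Vo UV (gs k)) => i.
exact: ps.
Qed.

Lemma pd_comp U V g phi x i : open U -> open V -> (forall x, U x -> V (phi x)) ->
  smooth V g -> (forall i, smooth U (fun z => phi z 0 i)) -> U x ->
  pd i (fun z => g (phi z)) x = \sum_j pd i (fun z => phi z 0 j) x * pd j g (phi x).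
Proof.
move=> Uo Vo UV gs ps Ux.
have [||j|_ ->//] := @chain_rule R _ m V g phi x (basis_vec i) Vo (UV _ Ux).
- by move=> y j; exact: smooth_derivable.
- by move=> j; have [_ /(_ j)[_ [cc _]]] := gs 1%N; exact: cc (UV _ Ux).
- exact: smooth_differentiable Uo (ps j) Ux.
Qed.

(* The induction on the length of w works because all the derivatives of g,
   composed with phi, are estimated at the same time. *)
Lemma pdw_comp_le U V g phi x (C K B L : R) k : open U -> open V ->
  (forall x, U x -> V (phi x)) -> smooth V g ->
  (forall i, smooth U (fun z => phi z 0 i)) -> U x ->
  0 <= C -> 0 <= K -> 0 < B -> 0 < L ->
  (forall v, `|pdw v g (phi x)| <= C * B ^+ size v * (size v)`!%:R) ->
  (forall i j w, `|pdw w (pd i (fun z => phi z 0 j)) x| <= K * L ^+ size w * (size w)`!%:R) ->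
  forall v w, size w = k -> `|pdw w (fun z => pdw v g (phi z)) x|
    <= C * (2 * L + 2 * m%:R * K * B) ^+ k * B ^+ size v * (k + size v)`!%:R.
Proof.
move=> Uo Vo UV gs ps Ux C0 K0 B0 L0 gB pB.
(* 2 L <= A makes the Leibniz sum geometric of ratio 1/2, hence at most twice its first term;
   summing over the m terms of the chain rule then costs 2 m K B <= A, which is the one extra power
   of A. *)
set A := 2 * L + 2 * m%:R * K * B.
have AL : 2 * L <= A by rewrite lerDl !mulr_ge0 // ltW.
have AK : 2 * m%:R * K * B <= A by rewrite lerDr mulr_ge0 // ltW.
have A0 : 0 < A by apply: lt_le_trans AL; rewrite mulr_gt0.
elim/ltn_ind: k => -[_ v w /size0nil ->|k IH v [//|i w] [wk]].
  by rewrite /= mulr1 add0n; exact: gB.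
have cs u : smooth U (fun z => pdw u g (phi z)).
  by apply: smooth_comp Uo Vo UV (smooth_pdw u gs) ps.
rewrite /= (_ : pdw w _ x = \sum_j pdw w (fun z => pd i (fun z => phi z 0 j) z
    * pdw (rcons v j) g (phi z)) x); last first.
  rewrite -(pdw_sum _ Uo) //; last first.
    by move=> j; apply: smooth_mul Uo (smooth_pd i (ps j)) (cs _).
  apply: pdw_ext (Uo) _ Ux => y Uy.
  rewrite (pd_comp i Uo Vo UV (smooth_pdw v gs) ps Uy).
  by apply: eq_bigr => j _; rewrite pdw_rcons.
apply: (@le_trans _ _ (\sum_(j < m) 2 * (C * K * B ^+ (size v).+1 * A ^+ k * (k + (size v).+1)`!%:R))).
  apply: le_trans (ler_norm_sum _ _ _) _; apply: ler_sum => j _.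
  apply: le_trans (pdw_mul_le
    (F := fun n => K * L ^+ n * n`!%:R)
    (G := fun n => C * A ^+ n * B ^+ (size v).+1 * (n + (size v).+1)`!%:R)
    Uo (smooth_pd i (ps j)) (cs _) Ux _ _) _.
  - by move=> u _; exact: pB.
  - by move=> u; rewrite wk => uk; have := IH (size u) uk (rcons v j) u erefl; rewrite size_rcons.
  rewrite wk.
  apply: (@le_trans _ _ (\sum_(q < k.+1) (2^-1) ^+ q * (C * K * B ^+ (size v).+1 * A ^+ k * (k + (size v).+1)`!%:R))).
    apply: ler_sum => q _; have qk : (q <= k)%N by rewrite -ltnS.
    have LA : L ^+ q * A ^+ (k - q) <= (2^-1) ^+ q * A ^+ k.
      have -> : A ^+ k = A ^+ q * A ^+ (k - q) by rewrite -exprD subnKC.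
      rewrite mulrA -exprMn ler_wpM2r ?exprn_ge0 ?(ltW A0) //.
      by rewrite lerXn2r ?nnegrE ?(ltW L0) ?mulr_ge0 ?invr_ge0 ?(ltW A0) // ler_pdivlMl.
    have FA : 'C(k, q)%:R * q`!%:R * (k - q + (size v).+1)`!%:R <= (k + (size v).+1)`!%:R :> R.
      rewrite -!natrM ler_nat -(@leq_pmul2r (k - q)`!) ?fact_gt0 //.
      have := fact_ratio_le (size v).+1 (leq_subr q k).
      by rewrite -(bin_fact qk); lia.
    rewrite [leLHS](_ : _ = C * K * B ^+ (size v).+1 * (L ^+ q * A ^+ (k - q))
      * ('C(k, q)%:R * q`!%:R * (k - q + (size v).+1)`!%:R)); last by ring.
    rewrite [leRHS](_ : _ = C * K * B ^+ (size v).+1 * ((2^-1) ^+ q * A ^+ k)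
      * (k + (size v).+1)`!%:R); last by ring.
    by rewrite ler_pM // ?mulr_ge0 ?exprn_ge0 ?(ltW A0) ?(ltW B0) ?(ltW L0) //
      ler_wpM2l // ?mulr_ge0 ?exprn_ge0 ?(ltW A0) ?(ltW B0).
  rewrite -mulr_suml ler_wpM2r ?mulr_ge0 ?exprn_ge0 ?(ltW A0) ?(ltW B0) //.
  have := subrXX (1 : R) 2^-1 k.+1; rewrite expr1n.
  under eq_bigr do rewrite expr1n mul1r.
  have : 0 <= (2^-1 : R) ^+ k.+1 by rewrite exprn_ge0 ?invr_ge0.
  by set s := \sum_(q < _) _; set z := _ ^+ k.+1; lra.
rewrite sumr_const card_ord -[leLHS]mulr_natl addnS -[(k + size v).+1]addSn.
rewrite [leLHS](_ : _ = C * A ^+ k * B ^+ size v * (k.+1 + size v)`!%:R * (2 * m%:R * K * B)).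
  rewrite [leRHS](_ : _ = C * A ^+ k * B ^+ size v * (k.+1 + size v)`!%:R * A).
    by rewrite ler_wpM2l ?mulr_ge0 ?exprn_ge0 ?(ltW A0) ?(ltW B0).
  by rewrite exprS; ring.
by rewrite exprS; ring.
Qed.

Lemma gevrey_comp U V g phi : open U -> open V -> (forall x, U x -> V (phi x)) ->
  gevrey V g -> (forall i, gevrey U (fun z => phi z 0 i)) ->
  gevrey U (fun z => g (phi z)).
Proof.
move=> Uo Vo UV gg pg.
have gs := gevrey_smooth gg; have ps i := gevrey_smooth (pg i).
split; first exact: smooth_comp Uo Vo UV gs ps.
move=> a Ua; have [_ /(_ _ (UV _ Ua))[W [Wa [C [B [C0 B0 WB]]]]]] := gg.
have H (ij : 'I_p * 'I_m) : exists WKL : set 'rV[R]_p * R * R,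
    [/\ nbhs a WKL.1.1, 0 <= WKL.1.2, 0 < WKL.2 &
    forall w x, WKL.1.1 x -> `|pdw w (pd ij.1 (fun z => phi z 0 ij.2)) x|
       <= WKL.1.2 * WKL.2 ^+ size w * (size w)`!%:R].
  have [_ /(_ a Ua)[X [Xa [K [L [K0 L0 XK]]]]]] := gevrey_pd ij.1 (pg ij.2).
  by exists (X, K, L).
have [F HF] := choice H.
(* The sums dominate all the individual constants; the summand 1 keeps L positive even when there is
   no pair of indices. *)
pose K := \sum_ij (F ij).1.2; pose L := 1 + \sum_ij (F ij).2.
have KF ij : (F ij).1.2 <= K.
  by rewrite /K (bigD1 ij) //= lerDl sumr_ge0 // => kl _; case: (HF kl).
have LF ij : (F ij).2 <= L.
  rewrite /L (bigD1 ij) //= addrCA lerDl addr_ge0 // sumr_ge0 // => kl _.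
  by case: (HF kl) => _ _ /ltW.
have K0 : 0 <= K by apply: sumr_ge0 => kl _; case: (HF kl).
have L0 : 0 < L by apply: ltr_pwDl => //; apply: sumr_ge0 => kl _; case: (HF kl) => _ _ /ltW.
exists (U `&` ((phi @^-1` W) `&` (fun x => forall ij, (F ij).1.1 x))); split.
  apply: filterI; first exact: open_nbhs_nbhs.
  apply: filterI; first exact: (class_fin_rV_continuous Ua (fun i => ps i 0%N)).
  by apply: (@near_forall _ _ a) => ij; case: (HF ij).
exists C, (2 * L + 2 * m%:R * K * B); split => //.
  by rewrite ltr_wpDr ?mulr_ge0 ?mulr_gt0 ?(ltW B0).
move=> w x [Ux [Wx Fx]].
have := @pdw_comp_le U V g phi x C K B L (size w) Uo Vo UV gs ps Ux C0 K0 B0 L0.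
move=> /(_ _ _ [::] w erefl) /=; rewrite mulr1 addn0; apply => [v|i j v].
  exact: WB.
have [_ F1 F2 /(_ v x (Fx (i, j)))] := HF (i, j); move/le_trans; apply.
rewrite ler_wpM2r // ler_pM // ?exprn_ge0 ?(ltW F2) // ?KF //.
by rewrite lerXn2r ?nnegrE ?(ltW F2) ?(ltW L0) ?LF.
Qed.

End Composition.

Section Coordinates.
Context {R : realType} {m : nat}.
Implicit Types (U : set 'rV[R]_m).

Lemma is_derive_coord (x : 'rV[R]_m) i j :
  is_derive x (basis_vec j) (fun z : 'rV[R]_m => z 0 i) ((i == j)%:R : R).
Proof.
have dd := @differentiable_coord R 1 m x 0 i.
split; first exact: diff_derivable.
have <- : 'D_(basis_vec j) id x 0 i = (i == j)%:R by rewrite derive_id mxE /=.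
by rewrite derive_mx ?mxE //; exact: derivable_id.
Qed.

End Coordinates.

Section Inverse.
Context {R : realType}.

Lemma open_coord_neq0 : open [set u : 'rV[R]_1 | u 0 0 != 0].
Proof.
rewrite openE => u /= u0.
have H := continuous_near_le (@coord_continuous R 1 1 0 0 u) (e := `|u 0 0| / 2).
have e0 : 0 < `|u 0 0| / 2 by rewrite divr_gt0 // normr_gt0.
apply: filterS (H e0) => z /= uz; apply/eqP => z0; move: uz e0; rewrite z0 subr0.
by move=> ? ?; lra.
Qed.

(** Differentiating c u^-(n+1) gives -(n+1) c u^-(n+2), of the same form; the general c and n, and
    the factor n! on the left, let the accumulated integers build one factorial. *)
Lemma pdw_inv_power w (c : R) n (x : 'rV[R]_1) : x 0 0 != 0 ->
  `|pdw w (fun u : 'rV[R]_1 => c * (u 0 0)^-1 ^+ n.+1) x| * n`!%:R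
  <= `|c| * `|x 0 0|^-1 ^+ (n + size w).+1 * (n + size w)`!%:R.
Proof.
have Uo := open_coord_neq0.
elim: w c n => [|i w IH] c n x0.
  by rewrite /= addn0 normrM normrX normfV.
rewrite [pdw _ _]/= [size _]/= (@pdw_ext _ _ _ _ (fun u : 'rV[R]_1 => - (n.+1%:R * c) * (u 0 0)^-1 ^+ n.+2) w x Uo) //.
  have := IH (- (n.+1%:R * c)) n.+1 x0.
  rewrite addSnnS; set X := pdw w _ x; set k := (n + _)%N; set Y := _ ^+ k.+1.
  rewrite factS natrM normrN normrM normr_nat => H.
  rewrite -(@ler_pM2l _ n.+1%:R) ?ltr0n //; move: H.
  by rewrite mulrCA -!mulrA.
move=> y /= y0.
have dy := is_derive_coord y 0 i.
have dV : is_derive y (basis_vec i) (fun u : 'rV[R]_1 => (u 0 0)^-1) (- (y 0 0) ^- 2 *: ((0 == i)%:R : R)).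
  split; first by apply: derivableV => //; case: dy.
  by rewrite deriveV //; case: dy => // _ ->.
have dX := @is_deriveX _ _ _ n.+1 _ _ _ dV.
have dZ := @is_deriveZ _ _ _ _ c _ _ _ dX.
case: dZ => _; rewrite exprfctE => dE; apply: etrans dE _.
rewrite (ord1 i) eqxx /GRing.scale /= -exprVn; set z := (y 0 0)^-1.
by rewrite !exprS expr0; ring.
Qed.

Lemma gevrey_inv1 : gevrey [set u : 'rV[R]_1 | u 0 0 != 0] (fun u => (u 0 0)^-1).
Proof.
split.
  move=> k; apply: class_fin_inv => //; first exact: open_coord_neq0.
  by apply: class_fin_coord => //; exact: open_coord_neq0.
move=> a /= a0.
have ac : {for a, continuous (fun u : 'rV[R]_1 => (u 0 0)^-1)}.
  by apply: continuousV => //; exact: coord_continuous.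
have [K K0 Ka] := near_bounded ac.
exists ([set u : 'rV[R]_1 | u 0 0 != 0] `&` (fun x => `|(x 0 0)^-1| <= K)); split.
  by apply: filterI => //; apply: open_nbhs_nbhs; split=> //; exact: open_coord_neq0.
exists K, K; split => // [|w x [/= x0 xK]]; first exact: ltW.
have := pdw_inv_power w 1 0 x0; rewrite fact0 mulr1 normr1 mul1r add0n.
rewrite (_ : (fun u => _) = (fun u : 'rV[R]_1 => (u 0 0)^-1)); last first.
  by rewrite funeqE => u; rewrite mul1r expr1.
move/le_trans; apply; rewrite ler_wpM2r // -exprS lerXn2r ?nnegrE ?invr_ge0 ?(ltW K0) //.
by rewrite -normfV.
Qed.

(** Inversion is composition with u |-> 1/u on the punctured line, so that explicit derivatives are
    computed for that one function. *)
Lemma gevrey_inv m (U : set 'rV[R]_m) (f : 'rV[R]_m -> R) : open U ->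
  (forall x, U x -> f x != 0) -> gevrey U f -> gevrey U (fun x => (f x)^-1).
Proof.
move=> Uo f0 fg.
have := @gevrey_comp R m 1 U _ _ (fun x => \row_(i < 1) f x) Uo open_coord_neq0 _ gevrey_inv1.
rewrite (_ : (fun z => _) = (fun x => (f x)^-1)); last by rewrite funeqE => x; rewrite mxE.
apply => [x Ux|i]; first by rewrite /= mxE f0.
by rewrite (_ : (fun z => _) = f) // funeqE => x; rewrite mxE.
Qed.

End Inverse.

(** * Multi-index series and their termwise differentiation *)

Section CubeSums.
Context {R : realType} {m : nat}.
Notation A := {ffun 'I_m -> nat}.
Implicit Types (F G : A -> R).

Lemma cube_sum_ge0 F N : (forall al, 0 <= F al) -> 0 <= cube_sum F N.
Proof. by move=> F0; apply: sumr_ge0. Qed.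

Lemma cube_sum_le F G N : (forall al, F al <= G al) -> cube_sum F N <= cube_sum G N.
Proof. by move=> FG; apply: ler_sum. Qed.

Lemma cube_sum_norm F N : `|cube_sum F N| <= cube_sum (fun al => `|F al|) N.
Proof. exact: ler_norm_sum. Qed.

Lemma cube_sumB F G N :
  cube_sum (fun al => F al - G al) N = cube_sum F N - cube_sum G N.
Proof. exact: sumrB. Qed.

Lemma cube_sumZ c F N : cube_sum (fun al => c * F al) N = c * cube_sum F N.
Proof. by rewrite /cube_sum mulr_sumr. Qed.

Lemma cube_sum_homo F : (forall al, 0 <= F al) ->
  {homo cube_sum F : N N' / (N <= N')%N >-> N <= N'}.
Proof.
move=> F0 N N' NN'.
pose w (al : {ffun 'I_m -> 'I_N}) : {ffun 'I_m -> 'I_N'} := [ffun i => widen_ord NN' (al i)].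
have winj : injective w.
  move=> al be /ffunP H; apply/ffunP => i; apply/val_inj.
  by have := H i; rewrite !ffunE => /(congr1 val).
rewrite /cube_sum (eq_bigr (fun al => F [ffun i => nat_of_ord (w al i)])); last first.
  by move=> al _; congr F; apply/ffunP => i; rewrite !ffunE.
rewrite -(big_imset (fun be : {ffun 'I_m -> 'I_N'} => F [ffun i => nat_of_ord (be i)])) /=; last first.
  by move=> al be _ _; exact: winj.
by rewrite big_mkcond /=; apply: ler_sum => be _; case: ifP.
Qed.

Lemma cube_sum_cvgn_ge0 F (M : R) : (forall al, 0 <= F al) ->
  (forall N, cube_sum F N <= M) -> cvgn (cube_sum F).
Proof.
move=> F0 FM; apply: nondecreasing_is_cvgn; first exact: cube_sum_homo.
by exists M => _ [N _ <-].
Qed.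

(** F is the difference of F + |F| and |F|, two nonnegative families whose cube sums are monotone
    and bounded. *)
Lemma cube_sum_cvgn F (M : R) :
  (forall N, cube_sum (fun al => `|F al|) N <= M) -> cvgn (cube_sum F).
Proof.
move=> FM.
have -> : cube_sum F = cube_sum (fun al => F al + `|F al|) \- cube_sum (fun al => `|F al|).
  by rewrite funeqE => N /=; rewrite -cube_sumB; apply: eq_bigr => al _; rewrite addrK.
apply: is_cvgB; last exact: cube_sum_cvgn_ge0 FM.
apply: (@cube_sum_cvgn_ge0 _ (M + M)) => [al|N].
  by rewrite -lerBlDr sub0r lerNnormlW.
rewrite /cube_sum big_split /=; apply: lerD (FM N).
by apply: le_trans (FM N); apply: ler_sum => al _; exact: ler_norm.
Qed.

Lemma limn_norm_le (u : R^nat) (M : R) : cvgn u -> (forall N, `|u N| <= M) ->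
  `|limn u| <= M.
Proof.
move=> uc uM; rewrite ler_norml; apply/andP; split.
  by apply: limr_ge => //; apply: nearW => N; have := uM N; rewrite ler_norml => /andP[].
by apply: limr_le => //; apply: nearW => N; have := uM N; rewrite ler_norml => /andP[].
Qed.

End CubeSums.

Section PowerTaylor.
Context {R : realType}.

Lemma power_taylor2 (x d X e : R) k : `|x| <= X -> 0 < e -> `|d| <= e ->
  `|(x + d) ^+ k - x ^+ k - d * (k%:R * x ^+ k.-1)| <= (`|d| / e) ^+ 2 * (X + e) ^+ k.
Proof.
move=> xX e0 de.
have X0 : 0 <= X by apply: le_trans xX.
(* [T k] is the same remainder at x = X and d = e, defined by the recursion that it satisfies. The
   absolute value of the remainder at (x, d) obeys this recursion as an inequality, with d^2 in
   place of e^2, whence the ratio (|d| / e)^2. *)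
pose T := fix T k := if k is k'.+1 then (X + e) * T k' + k'%:R * e ^+ 2 * X ^+ k'.-1 else 0.
have T0 j : 0 <= T j by elim: j => //= j IH; rewrite addr_ge0 ?mulr_ge0 ?addr_ge0 ?exprn_ge0 // ltW.
have T1 : T 1%N = 0 by rewrite /= mulr0 mul0r mul0r addr0.
have TE j : T j.+1 = (X + e) ^+ j.+1 - X ^+ j.+1 - e * (j.+1%:R * X ^+ j).
  elim: j => [|j IH]; first by rewrite T1 !expr1 expr0; ring.
  rewrite -[T j.+2]/((X + e) * T j.+1 + j.+1%:R * e ^+ 2 * X ^+ j) IH.
  by rewrite !exprS expr0 -[j.+2%:R]natr1; ring.
have TX j : T j <= (X + e) ^+ j.
  case: j => [|j]; first by rewrite expr0 /= ler01.
  by rewrite TE -addrA gerDl -opprD oppr_le0 addr_ge0 ?mulr_ge0 ?exprn_ge0 // ltW.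
apply: le_trans (_ : _ <= (`|d| / e) ^+ 2 * T k) _; last first.
  by rewrite ler_wpM2l // exprn_ge0 // divr_ge0 // ltW.
elim: k => [|k IH]; first by rewrite !expr0 mul0r mulr0 !subr0 subrr normr0 /= mulr0.
have -> : (x + d) ^+ k.+1 - x ^+ k.+1 - d * (k.+1%:R * x ^+ k)
  = (x + d) * ((x + d) ^+ k - x ^+ k - d * (k%:R * x ^+ k.-1)) + k%:R * d ^+ 2 * x ^+ k.-1.
  case: k {IH} => [|k]; first by rewrite !expr1 !expr0 /=; ring.
  by rewrite /= !exprS expr0 -[k.+2%:R]natr1; ring.
have -> : T k.+1 = (X + e) * T k + k%:R * e ^+ 2 * X ^+ k.-1 by [].
rewrite [leRHS]mulrDr (le_trans (ler_normD _ _)) // lerD //.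
  rewrite normrM [leRHS]mulrCA ler_pM // (le_trans (ler_normD _ _)) //.
  by rewrite lerD.
have -> : (`|d| / e) ^+ 2 * (k%:R * e ^+ 2 * X ^+ k.-1) = k%:R * `|d| ^+ 2 * X ^+ k.-1.
  by field; rewrite gt_eqF.
rewrite !normrM normr_nat !normrX ler_wpM2l ?mulr_ge0 ?exprn_ge0 //.
by rewrite lerXn2r ?nnegrE.
Qed.

(** The left side is one term of the binomial expansion of the right side. It serves as a Cauchy
    estimate for monomials: a derivative is paid for by a factor 1/e and a radius larger by e. *)
Lemma mulrn_exp_le (x e : R) k : 0 <= x -> 0 < e ->
  k%:R * x ^+ k.-1 * e <= (x + e) ^+ k.
Proof.
move=> x0 e0; elim: k => [|k IH]; first by rewrite !mul0r exprn_ge0 // addr_ge0 // ltW.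
case: k IH => [_|k IH]; first by rewrite /= expr1 expr0 !mul1r lerDr.
rewrite -natr1 /= [leLHS](_ : _ = x * (k.+1%:R * x ^+ k * e) + x ^+ k.+1 * e).
  rewrite [in leRHS]exprS mulrDl lerD //; first by rewrite ler_wpM2l.
  by rewrite mulrC ler_wpM2l ?(ltW e0) // lerXn2r ?nnegrE ?addr_ge0 ?(ltW e0) // lerDl ltW.
by rewrite exprS; ring.
Qed.

(** (k + 1)^k is at most the falling factorial (2k)(2k - 1)...(k + 1) = C(2k, k) k!, and C(2k, k) <=
    4^k. This takes the place of Stirling's formula when a radius is divided into k + 1 steps. *)
Lemma expS_le_fact k : ((k.+1 ^ k) <= 4 ^ k * k`!)%N.
Proof.
have H a n : (a.+1 ^ n <= (a + n) ^_ n)%N.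
  elim: n => [|n IH]; first by rewrite expn0.
  by rewrite addnS ffactSS expnS leq_mul // ltnS leq_addr.
have B a n : ('C(a, n) <= 2 ^ a)%N.
  elim: a n => [|a IH] [|n]; rewrite ?bin0 ?expn_gt0 // ?bin0n //.
  by rewrite binS expnS mul2n -addnn leq_add.
apply: leq_trans (H k k) _; rewrite -bin_ffact leq_mul2r.
by rewrite addnn -mul2n (leq_trans (B _ _)) ?orbT // expnM.
Qed.

End PowerTaylor.

Section QuadraticDerive.
Context {R : realType} {V : normedModType R}.

(** For a series, a quadratic remainder bound can be proved term by term; it yields the derivative
    without an exchange of two limits. *)
Lemma is_derive_quadratic (f : V -> R) (x v : V) (l K e : R) : 0 < e ->
  (forall d : R, `|d| <= e -> `|f (x + d *: v) - f x - d * l| <= K * `|d| ^+ 2) ->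
  is_derive x v f l.
Proof.
move=> e0 H.
have K0 : 0 <= K.
  have := H e; rewrite ger0_norm ?lexx ?(ltW e0) // => /(_ isT)/(le_trans (normr_ge0 _)).
  by rewrite pmulr_lge0 // exprn_gt0.
have L : (fun h => h^-1 *: ((f \o shift x) (h *: v) - f x)) @ 0^' --> l.
  apply/cvgrPdist_le => /= r r0; near=> d.
  have d0 : d != 0 by near: d; exact: nbhs_dnbhs_neq.
  have de : `|d| <= e by near: d; exact: dnbhs0_le.
  have dr : `|d| <= r / (K + 1) by near: d; apply: dnbhs0_le; rewrite divr_gt0 // ltr_wpDl.
  have -> : l - d^-1 *: (f (d *: v + x) - f x) = - (d^-1 * (f (x + d *: v) - f x - d * l)).
    by rewrite [d *: v + x]addrC /GRing.scale /=; field.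
  rewrite normrN normrM normfV ler_pdivrMl ?normr_gt0 //.
  apply: le_trans (H d de) _; rewrite expr2 mulrA mulrC ler_wpM2l //.
  apply: (@le_trans _ _ (K * (r / (K + 1)))); first by rewrite ler_wpM2l.
  rewrite mulrCA ler_piMr ?(ltW r0) // ler_pdivrMr ?ltr_wpDl // mul1r lerDl //.
by split; [apply/cvg_ex; exists l | apply: cvg_lim].
Unshelve. all: by end_near. Qed.

End QuadraticDerive.

Section PowerSeries.
Context {R : realType} {m : nat}.
Notation E := 'rV[R]_m.
Notation A := {ffun 'I_m -> nat}.
Implicit Types (u : A -> R) (ga : A -> A) (h : E) (al : A).

Definition mdeg (al : A) : nat := (\sum_i al i)%N.

(* Derivatives of a power series stay indexed by the multi-index of the original
   term: only the coefficients and the exponents change. *)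
Definition gpsum u ga h : R := limn (cube_sum (fun al => u al * monomial h (ga al))).

Definition gpbound u ga (s M : R) :=
  forall N, cube_sum (fun al => `|u al| * s ^+ mdeg (ga al)) N <= M.

(** Truncated subtraction leaves a zero exponent at zero; such terms are harmless, since their
    coefficient in the derivative carries the vanishing exponent as a factor. *)
Definition lower (i : 'I_m) (al : A) : A := [ffun j => (al j - (j == i))%N].

Lemma mdeg_lower (i : 'I_m) (al : A) : al i != 0%N -> mdeg al = (mdeg (lower i al)).+1.
Proof.
move=> ai; rewrite /mdeg (bigD1 i) //= [in RHS](bigD1 i) //= ffunE eqxx -addSn.
congr (_ + _)%N; first by case: (al i) ai => //= k _; rewrite subn1.
by apply: eq_bigr => j ji; rewrite ffunE (negbTE ji) subn0.
Qed.

Lemma monomial_const (s : R) (al : A) : monomial (const_mx s) al = s ^+ mdeg al.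
Proof. by rewrite /mdeg -prodrXr; apply: eq_bigr => i _; rewrite mxE. Qed.

Lemma norm_monomial_le h al (s : R) : `|h| <= s -> `|monomial h al| <= s ^+ mdeg al.
Proof.
move=> hs; rewrite -monomial_const /monomial normr_prod; apply: ler_prod => i _.
rewrite normr_ge0 mxE normrX lerXn2r ?nnegrE //.
  by apply: le_trans hs.
exact: le_trans (norm_coord_le h i) hs.
Qed.

Lemma gpsum_cvgn u ga s M h : gpbound u ga s M -> `|h| <= s ->
  cvgn (cube_sum (fun al => u al * monomial h (ga al))).
Proof.
move=> uM hs; apply: (@cube_sum_cvgn _ _ _ M) => N; apply: le_trans (uM N).
by apply: cube_sum_le => al; rewrite normrM ler_wpM2l // norm_monomial_le.
Qed.

Lemma gpsum_le u ga s M h : gpbound u ga s M -> `|h| <= s -> `|gpsum u ga h| <= M.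
Proof.
move=> uM hs; apply: limn_norm_le; first exact: gpsum_cvgn uM hs.
move=> N; apply: le_trans (cube_sum_norm _ _) (le_trans _ (uM N)).
by apply: cube_sum_le => al; rewrite normrM ler_wpM2l // norm_monomial_le.
Qed.

Lemma monomial_split h al i : monomial h al = h 0 i ^+ al i *
  \prod_(j | j != i) h 0 j ^+ al j.
Proof. by rewrite /monomial (bigD1 i). Qed.

Lemma monomial_shift h al i (d : R) : monomial (h + d *: basis_vec i) al
  = (h 0 i + d) ^+ al i * \prod_(j | j != i) h 0 j ^+ al j.
Proof.
rewrite (monomial_split _ _ i) !mxE !eqxx mulr1; congr (_ * _).
by apply: eq_bigr => j ji; rewrite !mxE /= (negbTE ji) mulr0 addr0.
Qed.

Lemma monomial_lower h al i : monomial h (lower i al)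
  = h 0 i ^+ (al i).-1 * \prod_(j | j != i) h 0 j ^+ al j.
Proof.
rewrite (monomial_split _ _ i) ffunE eqxx subn1; congr (_ * _).
by apply: eq_bigr => j ji; rewrite ffunE (negbTE ji) subn0.
Qed.

Lemma monomial_taylor2 h al i (d e : R) : 0 < e -> `|d| <= e ->
  `|monomial (h + d *: basis_vec i) al - monomial h al
    - d * ((al i)%:R * monomial h (lower i al))|
  <= (`|d| / e) ^+ 2 * (`|h| + e) ^+ mdeg al.
Proof.
move=> e0 de; rewrite monomial_shift (monomial_split h al i) monomial_lower.
set P := \prod_(j | _) _.
have -> : (h 0 i + d) ^+ al i * P - h 0 i ^+ al i * P
   - d * ((al i)%:R * (h 0 i ^+ (al i).-1 * P))
   = ((h 0 i + d) ^+ al i - h 0 i ^+ al i - d * ((al i)%:R * h 0 i ^+ (al i).-1)) * P by ring.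
rewrite normrM -(monomial_const (`|h| + e)) (monomial_split _ _ i) mxE [leRHS]mulrA.
apply: ler_pM => //; first exact: power_taylor2 (norm_coord_le h i) e0 de.
rewrite /P normr_prod; apply: ler_prod => j _; rewrite normr_ge0 mxE normrX.
rewrite lerXn2r ?nnegrE ?addr_ge0 ?(ltW e0) //.
by rewrite (le_trans (norm_coord_le h j)) // lerDl ltW.
Qed.

Let dcoef i u ga : A -> R := fun al => (ga al i)%:R * u al.

(** Cauchy's estimate for the series: reducing the radius by e costs a factor 1/e, by [mulrn_exp_le]
    in each term. *)
Lemma gpbound_lower i u ga s M (e : R) : 0 < e -> 0 <= s -> gpbound u ga (s + e) M ->
  gpbound (dcoef i u ga) (lower i \o ga) s (M / e).
Proof.
move=> e0 s0 uM N; rewrite ler_pdivlMr // mulrC -cube_sumZ.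
apply: le_trans (uM N); apply: cube_sum_le => al; rewrite /dcoef /= normrM normr_nat.
have [->|g0] := eqVneq (ga al i) 0%N.
  by rewrite mul0r mul0r mulr0 mulr_ge0 // exprn_ge0 // addr_ge0 // ltW.
rewrite (mdeg_lower g0) /mdeg.
rewrite [leLHS](_ : _ = `|u al| * ((ga al i)%:R * s ^+ mdeg (lower i (ga al)) * e)); last by ring.
rewrite ler_wpM2l // -/(mdeg _).
apply: le_trans (mulrn_exp_le (mdeg (lower i (ga al))).+1 s0 e0) => /=.
rewrite -!mulrA ler_wpM2r ?mulr_ge0 ?exprn_ge0 ?(ltW e0) // ler_nat.
by rewrite -mdeg_lower // /mdeg (bigD1 i) //= leq_addr.
Qed.

Lemma gpsum_is_derive i u ga s M h : gpbound u ga s M -> `|h| < s ->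
  is_derive h (basis_vec i) (gpsum u ga) (gpsum (dcoef i u ga) (lower i \o ga) h).
Proof.
move=> uM hs; pose e := s - `|h|.
have e0 : 0 < e by rewrite subr_gt0.
have he : `|h| + e = s by rewrite addrC subrK.
have dM : gpbound (dcoef i u ga) (lower i \o ga) `|h| (M / e).
  by apply: gpbound_lower => //; rewrite he.
(* By [monomial_taylor2] each term errs by at most |u| (|d| / e)^2 s^deg, and these errors add up to
   at most M |d|^2 / e^2. *)
apply: (@is_derive_quadratic _ _ _ _ _ _ (M / e ^+ 2) e) => // d de.
have hd : `|h + d *: basis_vec i| <= s.
  rewrite -he (le_trans (ler_normD _ _)) // lerD2l normrZ.
  by rewrite -[leRHS]mulr1 ler_pM // norm_basis_vec_le.
have c1 := gpsum_cvgn uM hd; have c2 := gpsum_cvgn uM (ltW hs).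
have c3 := gpsum_cvgn dM (lexx _).
have c4 : cvgn (fun N => d * cube_sum (fun al => dcoef i u ga al * monomial h ((lower i \o ga) al)) N).
  by apply: is_cvgMr.
have -> : gpsum u ga (h + d *: basis_vec i) - gpsum u ga h
  - d * gpsum (dcoef i u ga) (lower i \o ga) h = limn (fun N =>
    cube_sum (fun al => u al * monomial (h + d *: basis_vec i) (ga al)) N
    - cube_sum (fun al => u al * monomial h (ga al)) N
    - d * cube_sum (fun al => dcoef i u ga al * monomial h ((lower i \o ga) al)) N).
  apply/esym/cvg_lim => //; apply: cvgB; first by apply: cvgB.
  by apply: cvgMr.
apply: limn_norm_le => [|N]; first by apply: is_cvgB c4; exact: is_cvgB.
rewrite -!cube_sumB -cube_sumZ -cube_sumB.
apply: (le_trans (cube_sum_norm _ _)).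
rewrite [leRHS](_ : _ = (`|d| / e) ^+ 2 * M); last by field; rewrite gt_eqF.
apply: (le_trans _ (ler_wpM2l _ (uM N))); last by rewrite exprn_ge0 // divr_ge0 // ltW.
rewrite -cube_sumZ; apply: cube_sum_le => al.
have -> : u al * monomial (h + d *: basis_vec i) (ga al) - u al * monomial h (ga al)
   - d * (dcoef i u ga al * monomial h ((lower i \o ga) al))
  = u al * (monomial (h + d *: basis_vec i) (ga al) - monomial h (ga al)
    - d * ((ga al i)%:R * monomial h (lower i (ga al)))).
  by rewrite /dcoef /=; ring.
by rewrite normrM [leRHS]mulrCA ler_wpM2l // -he monomial_taylor2.
Qed.

End PowerSeries.

(** * From power series to derivative estimates *)

Section AnalyticGevrey.
Context {R : realType} {m : nat}.
Notation E := 'rV[R]_m.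
Notation A := {ffun 'I_m -> nat}.
Implicit Types (u : A -> R) (ga : A -> A) (f : E -> R) (U : set E).

(** [MVT_box] gives a Lipschitz bound around [x]. For power series this turns bounds on the derived
    series into continuity, without an argument of uniform convergence. *)
Lemma bounded_partials_continuous f (x : E) (r K : R) : 0 < r ->
  (forall y i, ball x r y -> derivable f y (basis_vec i)) ->
  (forall y i, ball x r y -> `|pd i f y| <= K) -> {for x, continuous f}.
Proof.
move=> r0 fd fK.
apply/(@cvgrPdist_le _ _ _ (nbhs x)) => /= e e0.
have xx : ball x r x by exact: ballxx.
pose C := m%:R * `|K| + 1; have C0 : 0 < C by rewrite ltr_wpDl // mulr_ge0.
apply/nbhs_ballP; exists (Num.min r (e / C)); first by rewrite /= lt_min r0 divr_gt0.
move=> z; rewrite -ball_normE /= lt_min => /andP[zr ze].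
have zb : ball x r z by rewrite -ball_normE.
have [xi xib fE] : exists2 xi : 'I_m -> E, forall i, in_box z x (xi i) &
    f x - f z = \sum_i (x 0 i - z 0 i) * 'D_(basis_vec i) f (xi i).
  by apply: MVT_box => p i /(in_box_ball zb xx); exact: fd.
rewrite fE (le_trans (ler_norm_sum _ _ _)) //.
apply: (@le_trans _ _ (\sum_(i < m) `|x - z| * `|K|)).
  apply: ler_sum => i _; rewrite normrM ler_pM //.
    by have := norm_coord_le (x - z) i; rewrite !mxE.
  by apply: le_trans (ler_norm _); apply: fK; exact: in_box_ball (xib i).
rewrite sumr_const card_ord -mulrnAr -mulr_natl.
rewrite ltr_pdivlMr // in ze; apply: le_trans (ltW ze).
by rewrite ler_wpM2l // /C lerDl.
Qed.

(** Each of the k differentiations gives up a width e of the ball and costs a factor 1/e in the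
    bound. *)
Lemma gpsum_class k u ga (s M : R) f a (e : R) : 0 < e -> k%:R * e < s ->
  (forall x, `|x - a| < s -> f x = gpsum u ga (x - a)) -> gpbound u ga s M ->
  class_fin 0 k (ball a (s - k%:R * e)) f /\
  forall w, size w = k -> forall x, ball a (s - k%:R * e) x -> `|pdw w f x| <= M / e ^+ k.
Proof.
move=> e0.
have deriv ga' u' (s' M' : R) g i x : gpbound u' ga' s' M' ->
    (forall x, `|x - a| < s' -> g x = gpsum u' ga' (x - a)) -> `|x - a| < s' ->
    is_derive x (basis_vec i) g
      (gpsum (fun al => (ga' al i)%:R * u' al) (lower i \o ga') (x - a)).
  move=> uM gE xs.
  apply: (@near_eq_is_derive _ _ _ (fun y => gpsum u' ga' (y - a))).
    have Bo : open (ball a s') by exact: ball_open.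
    have xB : ball a s' x by rewrite -ball_normE /= distrC.
    apply: (near_open Bo xB) => y; rewrite -ball_normE /= distrC => ys.
    by rewrite gE.
  exact/is_derive_translate/(gpsum_is_derive i uM).
have cont ga' u' (s' M' : R) g x : gpbound u' ga' s' M' ->
    (forall x, `|x - a| < s' -> g x = gpsum u' ga' (x - a)) -> `|x - a| < s' ->
    {for x, continuous g}.
  move=> uM gE xs; pose r := (s' - `|x - a|) / 2.
  have r0 : 0 < r by rewrite divr_gt0 // subr_gt0.
  have ball_r y : ball x r y -> `|y - a| <= s' - r /\ `|y - a| < s'.
    rewrite -ball_normE /= => xy; have : `|y - a| <= `|x - y| + `|x - a|.
      by rewrite [`|x - y|]distrC -[y - a](subrKA x) ler_normD.
    by move: xy; rewrite /r => xy ?; split; lra.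
  have sr : 0 <= s' - r by apply: (le_trans (normr_ge0 (x - a))); rewrite /r; move: xs; lra.
  apply: (bounded_partials_continuous (r := r) (K := M' / r)) => // y i /ball_r[yr ys].
    by case: (deriv ga' u' s' M' g i y uM gE ys).
  have [_ ->] := deriv ga' u' s' M' g i y uM gE ys.
  have bd : gpbound (fun al => (ga' al i)%:R * u' al) (lower i \o ga') (s' - r) (M' / r).
    by apply: gpbound_lower; rewrite ?subrK.
  exact: gpsum_le bd yr.
elim: k u ga s M f => [|k IH] u ga s M f ks fE uM.
  rewrite mul0r subr0; split.
    split; last by rewrite ltxx.
    by move=> x; rewrite -ball_normE /= distrC => xs; exact: cont uM fE xs.
  move=> w /size0nil -> x; rewrite -ball_normE /= distrC expr0 divr1 => xs.
  by rewrite fE // (gpsum_le uM (ltW xs)).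
have ks' : k%:R * e < s - e by move: ks; rewrite -natr1; lra.
have sk : s - k.+1%:R * e = s - e - k%:R * e by rewrite -natr1; lra.
have se : 0 <= s - e by apply: le_trans (ltW ks'); rewrite mulr_ge0 // ltW.
have sub x : ball a (s - k.+1%:R * e) x -> `|x - a| < s.
  rewrite -ball_normE /= distrC => /lt_le_trans; apply.
  by rewrite gerBl mulr_ge0 // ltW.
have bd i : gpbound (fun al => (ga al i)%:R * u al) (lower i \o ga) (s - e) (M / e).
  by apply: gpbound_lower => //; rewrite subrK.
have pE i x : `|x - a| < s - e ->
    pd i f x = gpsum (fun al => (ga al i)%:R * u al) (lower i \o ga) (x - a).
  move=> xs; have xs' : `|x - a| < s by apply: lt_le_trans xs _; rewrite gerBl ltW.
  by case: (deriv ga u s M f i x uM fE xs').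
have IHi i := IH _ _ _ _ (pd i f) ks' (pE i) (bd i).
split.
  split; first by move=> x /sub xs; exact: cont uM fE xs.
  move=> i; split; first by move=> x /sub xs; case: (deriv ga u s M f i x uM fE xs).
  by rewrite sk; case: (IHi i).
move=> [//|i w] [wk] x; rewrite sk => xs.
have [_ /(_ w wk x xs)] := IHi i.
by rewrite exprS invfM mulrA.
Qed.

Lemma analytic_gevrey U f : analytic_on U f -> gevrey U f.
Proof.
move=> fU.
have loc a : U a -> exists s M : R, [/\ 0 < s, 0 <= M &
    forall k, class_fin 0 k (ball a s) f /\
    forall w x, size w = k -> ball a s x -> `|pdw w f x| <= M * (4 / s) ^+ k * k`!%:R].
  move=> /fU[c [rho [rho0 H]]]; pose s := rho / 2.
  have s0 : 0 < s by rewrite divr_gt0.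
  have srho : s < rho by rewrite /s; lra.
  have sum_at x : `|x - a| < rho -> f x = gpsum c id (x - a).
    move=> /H/= [_ /cvg_lim <- //]; congr (limn _); rewrite funeqE => N.
    by apply: eq_bigr => al _; rewrite mulrC.
  have [M [M0 cM]] : exists M : R, 0 <= M /\ gpbound c id s M.
    (* Absolute convergence at the single point a + (s, ..., s), where every monomial equals s^deg,
       bounds the series on the whole polydisc of radius s. *)
    have : `|(a + const_mx s) - a| < rho.
      rewrite addrC addKr (le_lt_trans _ srho) // norm_rV_le ?ltW //.
      by apply/forallP => i; rewrite mxE ger0_norm // ltW.
    move=> /H/= [cc _].
    have cE : cube_sum (fun al => `|c al| * s ^+ mdeg al)
       = cube_sum (fun al => `|monomial (a + const_mx s - a) al *: c al|).
      rewrite funeqE => N; apply: eq_bigr => al _.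
      rewrite [a + _]addrC addrK monomial_const [_ *: _]mulrC normrM.
      by rewrite [`|s ^+ _|]ger0_norm // exprn_ge0 // ltW.
    exists (limn (cube_sum (fun al => `|c al| * s ^+ mdeg al))); rewrite cE; split.
      by apply: limr_ge => //; apply: nearW => N; exact: cube_sum_ge0.
    move=> N; have -> : cube_sum (fun al => `|c al| * s ^+ mdeg (id al)) N
      = cube_sum (fun al => `|monomial (a + const_mx s - a) al *: c al|) N by rewrite -cE.
    by apply: nondecreasing_cvgn_le cc N; apply: cube_sum_homo.
  exists (s / 2), M; split => // [|k]; first by rewrite divr_gt0.
  (* With this width the k steps use up at most s / 2, so that one ball serves all orders. The price
     is (2 (k + 1) / s)^k, which [expS_le_fact] turns into (8 / s)^k k!. *)
  pose e := s / 2 / k.+1%:R.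
  have e0 : 0 < e by rewrite !divr_gt0.
  have ke : k%:R * e <= s / 2.
    have s2 : 0 <= s / 2 by rewrite divr_ge0 // ltW.
    by rewrite /e mulrCA ler_piMr // ler_pdivrMr // mul1r ler_nat.
  have [|x xs|cf bf] := @gpsum_class k c id s M f a e e0 _ _ cM.
  - by apply: le_lt_trans ke _; lra.
  - by apply: sum_at; exact: lt_trans xs srho.
  have sub : ball a (s / 2) `<=` ball a (s - k%:R * e) by apply: le_ball; lra.
  split; first exact: class_fin_sub sub cf.
  move=> w x wk /sub xs; apply: le_trans (bf w wk x xs) _.
  rewrite -mulrA ler_wpM2l // /e.
  rewrite [leLHS](_ : _ = (2 / s) ^+ k * k.+1%:R ^+ k); last first.
    by rewrite -exprVn -exprMn; congr (_ ^+ k); field; rewrite gt_eqF //= -natr1 natr1 pnatr_eq0.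
  rewrite [leRHS](_ : _ = (2 / s) ^+ k * (4 ^+ k * k`!%:R)); last first.
    by rewrite mulrA -exprMn; congr (_ ^+ k * _); field; rewrite gt_eqF.
  rewrite ler_wpM2l ?exprn_ge0 ?divr_ge0 ?(ltW s0) ?(ltW rho0) //.
  by rewrite -!natrX -natrM ler_nat expS_le_fact.
split=> [k|a /loc[s [M [s0 M0 H]]]].
  apply: class_fin_local => a /loc[s [M [s0 M0 H]]].
  by exists (ball a s); [exact: ballxx | case: (H k)].
exists (ball a s); split; first exact: nbhsx_ballx.
exists M, (4 / s); split => // [|w x xs]; first by rewrite divr_gt0.
by case: (H (size w)) => _; exact.
Qed.

End AnalyticGevrey.

(** * From derivative estimates to power series *)

Section Taylor1.
Context {R : realType}.

(* Mean value theorem for t |-> \sum_(k < n) phi_k(t) (1 - t)^k / k!, whose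
   derivative telescopes. *)
Lemma taylor_remainder (phi : nat -> R -> R) (M : R) n :
  (forall k (t : R), 0 <= t <= 1 -> is_derive t 1 (phi k) (phi k.+1 t)) ->
  (forall t : R, 0 <= t <= 1 -> `|phi n.+1 t| <= M) ->
  `|phi 0%N 1 - \sum_(k < n.+1) phi k 0 / k`!%:R| <= M / n`!%:R.
Proof.
move=> dphi phiM.
pose F (t : R) := \sum_(k < n.+1) phi k t * ((1 - t) ^+ k / k`!%:R).
have dF (t : R) : 0 <= t <= 1 -> is_derive t 1 F (phi n.+1 t * ((1 - t) ^+ n / n`!%:R)).
  move=> t01; rewrite /F; elim: n {phiM F} => [|n IH].
    rewrite (_ : (fun t => _) = phi 0%N); last first.
      by rewrite funeqE => s; rewrite big_ord1 expr0 divr1 mulr1.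
    by rewrite expr0 divr1 mulr1; exact: dphi.
  rewrite (_ : (fun t => _) = (fun t => \sum_(k < n.+1) phi k t * ((1 - t) ^+ k / k`!%:R))
     + (phi n.+1 * (fun t => (1 - t) ^+ n.+1 * (n.+1)`!%:R^-1))); last first.
    by rewrite funeqE => s; rewrite big_ord_recr.
  have dP : is_derive t 1 (fun s : R => (1 - s) ^+ n.+1 * (n.+1)`!%:R^-1)
     (- ((1 - t) ^+ n / n`!%:R)).
    have d1 : is_derive t 1 (fun s : R => 1 - s) (-1).
      have := is_deriveB (is_derive_cst (1 : R) t 1) (is_derive_id t 1).
      by rewrite sub0r.
    have := is_deriveM (@is_deriveX _ _ _ n.+1 _ _ _ d1) (is_derive_cst ((n.+1)`!%:R^-1 : R) t 1).
    rewrite exprfctE scaler0 add0r => H; apply: is_derive_eq H _.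
    rewrite /cst /GRing.scale /= factS natrM; field.
    by rewrite nat1r !pnatr_eq0 -lt0n fact_gt0.
  have := is_deriveD IH (is_deriveM (dphi n.+1 t t01) dP).
  move/is_derive_eq; apply; rewrite /GRing.scale /=; ring.
have dF' (t : R) : t \in `]0, 1[ -> is_derive t 1 F (phi n.+1 t * ((1 - t) ^+ n / n`!%:R)).
  by rewrite in_itv /= => /andP[t0 t1]; apply: dF; rewrite !ltW.
have Fc : {within `[0, 1], continuous F}.
  by apply: derivable_within_continuous => t; rewrite in_itv /= => /dF[].
have [c + E] := MVT_segment ler01 dF' Fc; rewrite in_itv /= => c01.
move: E; rewrite subr0 mulr1.
have -> : F 1 = phi 0%N 1.
  rewrite /F big_ord_recl expr0 divr1 mulr1 big1 ?addr0 // => i _.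
  by rewrite subrr /bump /= expr0n /= mul0r mulr0.
have -> : F 0 = \sum_(k < n.+1) phi k 0 / k`!%:R.
  by apply: eq_bigr => k _; rewrite subr0 expr1n mul1r.
move=> ->; have /andP[c0 c1] := c01.
(* This is Cauchy's form of the remainder; with (1 - c)^n <= 1 it gives M / n! instead of M / (n +
   1)!, and the lost factor n + 1 is later absorbed by a geometric decay. *)
rewrite normrM ler_pM // ?phiM // normrM normfV normr_nat ler_piMl // ?invr_ge0 //.
by rewrite normrX exprn_ile1 // ger0_norm ?subr_ge0 // gerBl.
Qed.

End Taylor1.

Section WordSums.
Context {R : realType} {m : nat}.
Notation E := 'rV[R]_m.
Notation A := {ffun 'I_m -> nat}.
Implicit Types (h : E) (w : seq 'I_m).

Fixpoint words (k : nat) : seq (seq 'I_m) :=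
  if k is k'.+1 then [seq rcons w i | w <- words k', i <- enum 'I_m] else [:: [::]].

Lemma size_words k w : w \in words k -> size w = k.
Proof.
elim: k w => [|k IH] w /=; first by rewrite inE => /eqP ->.
by move=> /allpairsP[[v i] [/= /IH vk _ ->]]; rewrite size_rcons vk.
Qed.

Lemma sum_words_S (G : seq 'I_m -> R) k :
  \sum_(w <- words k.+1) G w = \sum_(w <- words k) \sum_i G (rcons w i).
Proof.
by rewrite /= big_allpairs_dep; apply: eq_bigr => w _; rewrite big_enum.
Qed.

Definition word_power h w : R := \prod_(i <- w) h 0 i.

Definition content w : A := [ffun i => count_mem i w].

Lemma monomial_content h w : monomial h (content w) = word_power h w.
Proof.
rewrite /word_power; elim: w => [|i w IH].
  by rewrite big_nil /monomial big1 // => i _; rewrite ffunE.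
rewrite big_cons -IH /monomial (bigD1 i) //= [in RHS](bigD1 i) //= mulrA.
rewrite !ffunE /= eqxx add1n exprS; congr (_ * _).
by apply: eq_bigr => j ji; rewrite !ffunE /= eq_sym (negbTE ji).
Qed.

Lemma mdeg_content w : mdeg (content w) = size w.
Proof.
rewrite /mdeg; elim: w => [|i w IH]; first by rewrite big1 // => i _; rewrite ffunE.
rewrite (bigD1 i) //= -IH [in RHS](bigD1 i) //= !ffunE /= eqxx -addnA add1n; congr (_.+1).
by congr (_ + _)%N; apply: eq_bigr => j ji; rewrite !ffunE /= eq_sym (negbTE ji).
Qed.

Lemma word_power_rcons h w i : word_power h (rcons w i) = word_power h w * h 0 i.
Proof. by rewrite /word_power -cats1 big_cat big_seq1. Qed.

Lemma norm_word_power h w : `|word_power h w| <= `|h| ^+ size w.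
Proof. by rewrite -monomial_content -mdeg_content; exact: norm_monomial_le. Qed.

Lemma sum_words_cst (c : R) k : \sum_(w <- words k) c ^+ k = (m%:R * c) ^+ k.
Proof.
elim: k => [|k IH]; first by rewrite big_seq1.
rewrite sum_words_S; under eq_bigr do rewrite sumr_const card_ord exprS -mulr_natl mulrA.
by rewrite -mulr_sumr IH exprS.
Qed.

End WordSums.

Section GevreyAnalytic.
Context {R : realType} {m : nat}.
Notation E := 'rV[R]_m.
Notation A := {ffun 'I_m -> nat}.
Implicit Types (f : E -> R) (U : set E) (h : E).

Definition word_term f (a h : E) (w : seq 'I_m) : R :=
  word_power h w * pdw w f a / (size w)`!%:R.

(* Grouping the words by content avoids any appeal to the symmetry of higher
   derivatives. *)
Definition taylor_coef f (a : E) (al : A) : R :=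
  \sum_(w <- words (mdeg al) | content w == al) pdw w f a / (size w)`!%:R.

Definition words_lt K : seq (seq 'I_m) := flatten [seq words k | k <- iota 0 K].

Lemma sum_words_lt (G : seq 'I_m -> R) K :
  \sum_(w <- words_lt K) G w = \sum_(k < K) \sum_(w <- words k) G w.
Proof.
rewrite /words_lt big_flatten big_map -(big_mkord xpredT (fun k => \sum_(w <- words k) G w)).
by rewrite /index_iota subn0.
Qed.

(** Taylor's formula for t |-> f(a + t h): by the chain rule its k-th derivative is a sum over the
    m^k words of length k, each term being at most C (|h| B)^k k!. The factor n + 1 is (n + 1)! /
    n!. *)
Lemma taylor_remainder_words f U (a h : E) (r C B : R) n : open U -> smooth U f ->
  ball a r `<=` U -> `|h| < r -> 0 <= C -> 0 < B ->
  (forall w x, ball a r x -> `|pdw w f x| <= C * B ^+ size w * (size w)`!%:R) ->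
  `|f (a + h) - \sum_(w <- words_lt n.+1) word_term f a h w|
    <= C * n.+1%:R * (m%:R * (`|h| * B)) ^+ n.+1.
Proof.
move=> Uo fs aU hr C0 B0 fB.
have seg (t : R) : 0 <= t <= 1 -> ball a r (a + t *: h).
  move=> /andP[t0 t1]; rewrite -ball_normE /= opprD addNKr normrN normrZ.
  by apply: le_lt_trans hr; rewrite ger0_norm // ler_piMl.
pose phi k (t : R) := \sum_(w <- words k) word_power h w * pdw w f (a + t *: h).
have dw w (t : R) : 0 <= t <= 1 ->
    is_derive t 1 (fun s : R => pdw w f (a + s *: h)) (\sum_i h 0 i * pdw (rcons w i) f (a + t *: h)).
  move=> t01; have Ut := aU _ (seg t t01).
  apply/(is_derive_line (pdw w f) a h t).
  have ws := smooth_pdw w fs.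
  have dd : is_diff (a + t *: h) (pdw w f) (fun v => \sum_i v 0 i * pd i (pdw w f) (a + t *: h)).
    apply: C1_is_diff (Uo) Ut _ _ => [x i Ux|i]; first exact: smooth_derivable ws Ux.
    by have [_ /(_ i)[_ [cc _]]] := ws 1%N; exact: cc (aU _ (seg t t01)).
  have dd' : differentiable (pdw w f) (a + t *: h) by case: dd.
  split; first exact: diff_derivable.
  rewrite deriveE //; case: dd => _ ->; apply: eq_bigr => i _; by rewrite pdw_rcons.
have dphi k (t : R) : 0 <= t <= 1 -> is_derive t 1 (phi k) (phi k.+1 t).
  move=> t01; rewrite /phi sum_words_S.
  elim: (words k) => [|w s IH].
    rewrite big_nil (_ : (fun t => _) = cst 0); first exact: is_derive_cst.
    by rewrite funeqE => u; rewrite big_nil.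
  rewrite big_cons (_ : (fun t => _) = (word_power h w *: (fun s : R => pdw w f (a + s *: h)))
     + (fun t => \sum_(j <- s) word_power h j * pdw j f (a + t *: h))); last first.
    by rewrite funeqE => u; rewrite big_cons.
  apply: is_derive_eq (is_deriveD (is_deriveZ (word_power h w) (dw w t t01)) IH) _.
  congr (_ + _); rewrite [LHS]mulr_sumr; apply: eq_bigr => i _.
  by rewrite word_power_rcons mulrA.
have phiM (t : R) : 0 <= t <= 1 -> `|phi n.+1 t| <= C * (m%:R * (`|h| * B)) ^+ n.+1 * (n.+1)`!%:R.
  move=> /seg tb; rewrite /phi (le_trans (ler_norm_sum _ _ _)) //.
  rewrite -sum_words_cst mulr_sumr mulr_suml big_seq [leRHS]big_seq; apply: ler_sum => w /size_words wn.
  rewrite normrM; have := fB w _ tb; have := norm_word_power h w; rewrite wn => H1 H2.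
  apply: (le_trans (ler_pM _ _ H1 H2)) => //.
  by rewrite exprMn; rewrite le_eqVlt; apply/predU1P; left; ring.
have := taylor_remainder dphi phiM; rewrite /phi /= big_seq1 /word_power big_nil mul1r scale1r.
rewrite sum_words_lt => H; apply: le_trans (le_trans _ H) _.
  rewrite le_eqVlt; apply/predU1P; left; congr (`|_ - _|); apply: eq_bigr => k _.
  rewrite mulr_suml big_seq [RHS]big_seq; apply: eq_bigr => w /size_words wk.
  by rewrite /word_term wk scale0r addr0.
rewrite factS natrM; rewrite le_eqVlt; apply/predU1P; left; field.
by rewrite pnatr_eq0 -lt0n fact_gt0.
Qed.

Definition in_cube N (w : seq 'I_m) : bool := [forall i, content w i < N]%N.

(** A multi-index of the cube has degree at most m N, so all words with that content are shorter
    than K; after the exchange of sums each word meets exactly one multi-index, its own content. *)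
Lemma cube_sum_words (T : seq 'I_m -> R) N K : (m * N < K)%N ->
  cube_sum (fun al => \sum_(w <- words (mdeg al) | content w == al) T w) N
  = \sum_(w <- words_lt K | in_cube N w) T w.
Proof.
move=> NK; rewrite /cube_sum [RHS]big_mkcond /=.
rewrite (eq_bigr (fun al : {ffun 'I_m -> 'I_N} => \sum_(w <- words_lt K)
    if content w == [ffun i => nat_of_ord (al i)] then T w else 0)); last first.
  move=> al _; set be := [ffun i => _].
  have dK : (mdeg be < K)%N.
    apply: leq_ltn_trans NK; rewrite -[X in (_ <= X * _)%N]card_ord -sum_nat_const.
    by apply: leq_sum => i _; rewrite ffunE ltnW.
  rewrite sum_words_lt (bigD1 (Ordinal dK)) //= [X in _ = _ + X]big1 ?addr0 => [|k kd].
    by rewrite big_mkcond.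
  rewrite big_seq big1 // => w /size_words wk; case: eqP => // wbe.
  by move: kd; rewrite -val_eqE /= -wbe mdeg_content wk eqxx.
rewrite exchange_big /=; apply: eq_bigr => w _.
case: (boolP (in_cube N w)) => [/forallP wN|wN].
  pose al : {ffun 'I_m -> 'I_N} := [ffun i => Ordinal (wN i)].
  rewrite (bigD1 al) //= big1 ?addr0 => [|be bal].
    by case: eqP => // -[]; apply/ffunP => i; rewrite [RHS]ffunE [al i]ffunE.
  case: eqP => // wbe; case/eqP: bal; apply/ffunP => i; apply/val_inj.
  by rewrite ffunE /= wbe ffunE.
rewrite big1 // => al _; case: eqP => // wal; case/negP: wN; apply/forallP => i.
by rewrite wal ffunE.
Qed.

Lemma in_cube_size N w : (size w < N)%N -> in_cube N w.
Proof.
move=> wN; apply/forallP => i; rewrite ffunE; apply: leq_ltn_trans wN.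
exact: count_size.
Qed.

Lemma taylor_coef_term f a h al :
  monomial h al * taylor_coef f a al
  = \sum_(w <- words (mdeg al) | content w == al) word_term f a h w.
Proof.
rewrite mulr_sumr; apply: eq_bigr => w /eqP <-.
by rewrite monomial_content /word_term mulrA.
Qed.

Lemma half_geometric_le K : \sum_(k < K) (2^-1 : R) ^+ k <= 2.
Proof.
have := subrXX (1 : R) 2^-1 K; rewrite expr1n.
under eq_bigr do rewrite expr1n mul1r.
have : 0 <= (2^-1 : R) ^+ K by rewrite exprn_ge0 ?invr_ge0.
by set s := \sum_(q < _) _; set z := _ ^+ K; lra.
Qed.

Lemma gevrey_analytic U f : open U -> gevrey U f -> analytic_on U f.
Proof.
move=> Uo [fs fb] a Ua; have [W [Wa [C [B [C0 B0 fB]]]]] := fb a Ua.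
have N0 : nbhs a (U `&` W) by apply: filterI => //; exact: open_nbhs_nbhs.
have [r /= r0 rP] := iffLR (nbhs_ballP a _) N0.
(* Makes q = m |h| B at most 1/4 = 1/2 * 1/2: one factor gives a convergent geometric series, the
   other the decay 2^-N of the tail. The same margin pays for the linear factor of the Taylor
   remainder. Taking m + 1 keeps the inverse meaningful in dimension 0. *)
pose rho := Num.min r (4 * m.+1%:R * B)^-1.
have rho0 : 0 < rho by rewrite lt_min r0 invr_gt0 !mulr_gt0.
exists (taylor_coef f a), rho; split => // x xa.
set h := x - a in xa *.
have hr : `|h| < r by apply: lt_le_trans xa _; rewrite ge_min lexx.
pose q := m%:R * (`|h| * B).
have q0 : 0 <= q by rewrite !mulr_ge0 // ltW.
have q4 : q <= 4^-1.
  have hB : `|h| < (4 * m.+1%:R * B)^-1 by apply: lt_le_trans xa _; rewrite ge_min lexx orbT.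
  have /ltW : `|h| * (4 * m.+1%:R * B) < 1 by rewrite -ltr_pdivlMr ?mulr_gt0 // mul1r.
  rewrite -[m.+1%:R]natr1 (_ : `|h| * _ = 4 * (q + `|h| * B)); last by rewrite /q; ring.
  have : 0 <= `|h| * B by rewrite mulr_ge0 // ltW.
  by move: (`|h| * B) => y y0 H; lra.
have Xk k : \sum_(w <- words k) `|word_term f a h w| <= C * q ^+ k.
  rewrite -sum_words_cst mulr_sumr big_seq [leRHS]big_seq; apply: ler_sum => w /size_words wk.
  rewrite /word_term 2!normrM normfV normr_nat ler_pdivrMr ?ltr0n ?fact_gt0 //.
  have [_ Wa'] := rP _ (ballxx a r0).
  have := fB w a Wa'; have := norm_word_power h w; rewrite wk => H1 H2.
  apply: (le_trans (ler_pM _ _ H1 H2)) => //.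
  by rewrite exprMn le_eqVlt; apply/predU1P; left; ring.
have qk k : q ^+ k <= (2^-1) ^+ k.
  by rewrite lerXn2r ?nnegrE ?invr_ge0 //; lra.
(* Exceeds m N, so that all words of the cube are included, and N, so that the Taylor remainder is
   at most C 2^-N. *)
pose K N := (m * N + N).+1.
have NK N : (m * N < K N)%N by rewrite ltnS leq_addr.
split=> /=.
  apply: (@cube_sum_cvgn_ge0 _ _ _ (C * 2)) => // N.
  apply: (@le_trans _ _ (cube_sum (fun al => \sum_(w <- words (mdeg al) | content w == al)
     `|word_term f a h w|) N)).
    by apply: cube_sum_le => al; rewrite [_ *: _]taylor_coef_term; exact: ler_norm_sum.
  rewrite (cube_sum_words _ (NK N)).
  apply: (@le_trans _ _ (\sum_(w <- words_lt (K N)) `|word_term f a h w|)).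
    by rewrite big_mkcond; apply: ler_sum => w _; case: ifP.
  rewrite sum_words_lt; apply: le_trans (_ : \sum_(k < K N) C * (2^-1) ^+ k <= _).
    by apply: ler_sum => k _; apply: le_trans (Xk k) _; rewrite ler_wpM2l.
  by rewrite -mulr_sumr ler_wpM2l // half_geometric_le.
(* 3 = 1 + 2: the Taylor remainder, and the words shorter than [K N] outside the cube. The latter
   have length at least N, since a word of length below N has all its letter counts below N. *)
have est N : `|f x - cube_sum (fun al => monomial h al *: taylor_coef f a al) N|
    <= 3 * C * (2^-1) ^+ N.
  have -> : cube_sum (fun al => monomial h al *: taylor_coef f a al) N
     = \sum_(w <- words_lt (K N) | in_cube N w) word_term f a h w.
    rewrite -(cube_sum_words _ (NK N)); apply: eq_bigr => al _; exact: taylor_coef_term.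
  have -> : f x = f (a + h) by rewrite /h addrC subrK.
  have := @taylor_remainder_words f U a h r C B (K N).-1 Uo fs _ hr C0 B0 _.
  move=> /(_ (fun p bp => (rP p bp).1) (fun w p bp => fB w p (rP p bp).2)).
  rewrite -/(K N) -/q (bigID (in_cube N)) /=.
  set S1 := \sum_(w <- _ | in_cube N w) _; set S2 := \sum_(w <- _ | _) _ => T1.
  have T2 : `|S2| <= 2 * C * (2^-1) ^+ N.
    rewrite /S2 (le_trans (ler_norm_sum _ _ _)) // big_mkcond /=.
    apply: (@le_trans _ _ (\sum_(w <- words_lt (K N)) if (N <= size w)%N then `|word_term f a h w| else 0)).
      apply: ler_sum => w _; case: ifP => [wN|]; last by case: ifP.
      by case: ifP => // /negbT; rewrite -ltnNge => /in_cube_size; rewrite (negbTE wN).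
    rewrite sum_words_lt; apply: le_trans (_ : \sum_(k < K N) (C * (2^-1) ^+ N) * (2^-1) ^+ k <= _).
      apply: ler_sum => k _; case: (leqP N k) => Nk; last first.
        rewrite big_seq big1 ?mulr_ge0 ?exprn_ge0 ?invr_ge0 // => w /size_words ->.
        by rewrite leqNgt Nk.
      apply: le_trans (_ : \sum_(w <- words k) `|word_term f a h w| <= _).
        by apply: ler_sum => w _; case: ifP.
      apply: le_trans (Xk k) _; rewrite -mulrA ler_wpM2l //.
      apply: (@le_trans _ _ ((2^-1) ^+ k * (2^-1) ^+ k)).
        by rewrite -exprMn lerXn2r ?nnegrE ?mulr_ge0 ?invr_ge0 //; lra.
      rewrite ler_wpM2r ?exprn_ge0 ?invr_ge0 //.
      by apply: ler_wiXn2l => //; rewrite ?invr_ge0 // invf_le1 // ler1n.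
    by rewrite -mulr_sumr mulrC -mulrA ler_wpM2r ?mulr_ge0 ?exprn_ge0 ?invr_ge0 // half_geometric_le.
  have T3 : C * (K N)%:R * q ^+ K N <= C * (2^-1) ^+ N.
    rewrite -mulrA ler_wpM2l //.
    apply: (@le_trans _ _ ((2 * q) ^+ K N)).
      rewrite [leRHS]exprMn ler_wpM2r ?exprn_ge0 // -natrX ler_nat; exact/ltnW/ltn_expl.
    apply: (@le_trans _ _ ((2^-1) ^+ K N)).
      by rewrite lerXn2r ?nnegrE ?mulr_ge0 ?invr_ge0 //; lra.
    apply: ler_wiXn2l; rewrite ?invr_ge0 // ?invf_le1 ?ler1n //.
    by rewrite /K leqW // leq_addl.
  have -> : f (a + h) - S1 = (f (a + h) - (S1 + S2)) + S2 by ring.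
  rewrite (le_trans (ler_normD _ _)) //; move: T1 T2 T3.
  by move: (_ ^+ N) => z; move: (`|_|) (`|_|) (C * _ * _) => ? ? ?; lra.
apply/cvgrPdist_le => /= e e0.
have e3 : 0 < e / (3 * C + 1) by rewrite divr_gt0 // ltr_wpDl // mulr_ge0.
near=> N; apply: le_trans (est N) _.
apply: (@le_trans _ _ (3 * C * (e / (3 * C + 1)))).
  rewrite ler_wpM2l ?mulr_ge0 //; near: N.
  have h1 : `|2^-1 : R| < 1 by rewrite ger0_norm ?invr_ge0 // invf_lt1 // ltr1n.
  have := cvg_expr h1 => /cvgr0_norm_le /(_ _ e3); apply: filterS => N.
  by rewrite ger0_norm // exprn_ge0 // invr_ge0.
rewrite mulrCA ler_piMr ?(ltW e0) // ler_pdivrMr ?mul1r ?lerDl //.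
by rewrite ltr_wpDl // mulr_ge0.
Unshelve. all: by end_near. Qed.

End GevreyAnalytic.

Section AnalyticComponents.
Context {R : realType} {m p q : nat}.
Notation E := 'rV[R]_m.
Notation A := {ffun 'I_m -> nat}.
Implicit Types (U : set E) (F : E -> 'M[R]_(p, q)).

Lemma cube_sum_mxE (F : A -> 'M[R]_(p, q)) N i j :
  cube_sum F N i j = cube_sum (fun al => F al i j) N.
Proof. exact: summxE. Qed.

Lemma cvg_mxP (u : nat -> 'M[R]_(p, q)) (l : 'M[R]_(p, q)) :
  u @ \oo --> l <-> forall i j, (fun N => u N i j) @ \oo --> l i j.
Proof.
split=> [ul i j|H].
  apply/cvgrPdist_le => /= e e0.
  have N1 : \forall N \near \oo, `|l - u N| <= e by exact: (iffLR (cvgrPdist_le _ _) ul).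
  apply: filterS N1 => N; apply: le_trans.
  by have := norm_mx_coord_le (l - u N) i j; rewrite !mxE.
apply/cvgrPdist_le => /= e e0.
have N1 : \forall N \near \oo, forall i j, `|l i j - u N i j| <= e.
  apply: filter_forall => i; apply: filter_forall => j.
  exact: (iffLR (cvgrPdist_le _ _) (H i j)).
apply: filterS N1 => N N1; apply: norm_mx_le (ltW e0) _ => i j.
by rewrite !mxE; exact: N1.
Qed.

Lemma analytic_mxP U F :
  analytic_on U F <-> forall i j, analytic_on U (fun x => F x i j).
Proof.
split=> [H i j a /H[c [rho [rho0 {}H]]]|H a Ua].
  exists (fun al => c al i j), rho; split => // x /H /= [H1 H2]; split.
    apply: (@cube_sum_cvgn_ge0 _ _ _ (limn (cube_sum (fun al => `|monomial (x - a) al *: c al|)))) => // N.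
    apply: le_trans (nondecreasing_cvgn_le _ H1 N); last exact: cube_sum_homo.
    apply: cube_sum_le => al.
    by have := norm_mx_coord_le (monomial (x - a) al *: c al) i j; rewrite !mxE.
  have /(_ i j) := iffLR (cvg_mxP _ _) H2.
  rewrite (_ : (fun N => _) = cube_sum (fun al => monomial (x - a) al *: c al i j)) //.
  rewrite funeqE => N; rewrite cube_sum_mxE; apply: eq_bigr => al _.
  by rewrite mxE.
have K (ij : 'I_p * 'I_q) : exists cr : (A -> R) * R, 0 < cr.2 /\ forall x, `|x - a| < cr.2 ->
    cvgn (cube_sum (fun al => `|monomial (x - a) al *: cr.1 al|)) /\
    cube_sum (fun al => monomial (x - a) al *: cr.1 al) @ \oo --> F x ij.1 ij.2.
  by have [c [rho [rho0 cH]]] := H ij.1 ij.2 a Ua; exists (c, rho).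
have [cr Hcr] := choice K.
(* A positive lower bound for all the radii, also when the matrix has no entry. *)
pose rho := (1 + \sum_ij (cr ij).2^-1)^-1.
have s0 : 0 < 1 + \sum_ij (cr ij).2^-1.
  by rewrite ltr_pwDl // sumr_ge0 // => ij _; rewrite invr_ge0 ltW //; case: (Hcr ij).
have rle ij : rho <= (cr ij).2.
  have [r0 _] := Hcr ij.
  rewrite -[leRHS]invrK /rho lef_pV2 ?posrE ?invr_gt0 // (bigD1 ij) //= addrCA lerDl.
  by rewrite addr_ge0 // sumr_ge0 // => kl _; rewrite invr_ge0 ltW //; case: (Hcr kl).
pose c al : 'M[R]_(p, q) := \matrix_(i, j) (cr (i, j)).1 al.
exists c, rho; split; first by rewrite invr_gt0.
move=> x xa /=.
have Hx ij := (Hcr ij).2 x (lt_le_trans xa (rle ij)).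
split; last first.
  apply/cvg_mxP => i j; have [_] := Hx (i, j).
  rewrite (_ : (fun N => _) = cube_sum (fun al => monomial (x - a) al *: (cr (i, j)).1 al)) //.
  rewrite funeqE => N; rewrite cube_sum_mxE; apply: eq_bigr => al _.
  by rewrite !mxE.
pose L ij := limn (cube_sum (fun al => `|monomial (x - a) al *: (cr ij).1 al|)).
apply: (@cube_sum_cvgn_ge0 _ _ _ (\sum_ij L ij)) => // N.
apply: (@le_trans _ _ (cube_sum (fun al => \sum_ij `|monomial (x - a) al *: (cr ij).1 al|) N)).
  apply: cube_sum_le => al; apply: norm_mx_le => [|i j]; first by apply: sumr_ge0.
  by rewrite !mxE (bigD1 (i, j)) //= lerDl sumr_ge0.
rewrite /cube_sum exchange_big /=; apply: ler_sum => ij _.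
apply: (nondecreasing_cvgn_le _ (Hx ij).1 N).
by apply: cube_sum_homo.
Qed.

End AnalyticComponents.

Lemma analyticP {R : realType} {m : nat} (U : set 'rV[R]_m) (f : 'rV[R]_m -> R) :
  open U -> analytic_on U f <-> gevrey U f.
Proof.
by move=> Uo; split; [exact: analytic_gevrey | exact: gevrey_analytic].
Qed.

Lemma shift_class_add r k l : shift_class (shift_class r k) l = shift_class r (k + l).
Proof. by case: r => //= n; rewrite addnA. Qed.

Lemma shift_structure_class r k : shift_class (structure_class r) k = structure_class r.
Proof. by case: r. Qed.

(** * Regularity classes, finite, smooth and analytic *)

Section ClassOn.
Context {R : realType} {m : nat}.
Notation E := 'rV[R]_m.
Variable b : R.
Hypothesis b1 : b <= 1.
Implicit Types (r : diff_class) (U V : set E) (f g : E -> R).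

Lemma class_on_mxP p q r U (F : E -> 'M[R]_(p, q)) : open U ->
  class_on r b U F <-> forall i j, class_on r b U (fun x => F x i j).
Proof.
move=> Uo; case: r => [k||] /=; first exact: class_fin_mxP.
  split=> [H i j k|H k].
    by have /class_fin_mxP := H k; apply.
  by apply/class_fin_mxP => // i j; exact: H.
exact: analytic_mxP.
Qed.

Lemma class_on_rVP q r U (F : E -> 'rV[R]_q) : open U ->
  class_on r b U F <-> forall j, class_on r b U (fun x => F x 0 j).
Proof.
move=> Uo; split=> [/class_on_mxP H j|H]; first exact: H.
by apply/class_on_mxP => // i j; rewrite ord1.
Qed.

Lemma class_on_ext r U f g : open U -> (forall x, U x -> f x = g x) ->
  class_on r b U f -> class_on r b U g.
Proof.
move=> Uo fg; case: r => [k||] /=; first exact: class_fin_ext.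
  by move=> H k; exact: class_fin_ext (H k).
by move=> /(analyticP _ Uo) H; apply/analyticP => //; exact: gevrey_ext H.
Qed.

Lemma class_on_sub r U V f : open U -> open V -> V `<=` U ->
  class_on r b U f -> class_on r b V f.
Proof.
move=> Uo Vo VU; case: r => [k||] /=; first exact: class_fin_sub.
  by move=> H k; exact: class_fin_sub (H k).
by move=> H a /VU/H.
Qed.

Lemma class_on_local r U f : (forall a, U a -> exists2 V, V a & class_on r b V f) ->
  class_on r b U f.
Proof.
case: r => [k||] /= H; first exact: class_fin_local.
  by move=> k; apply: class_fin_local => a /H[V Va Vk]; exists V.
by move=> a /H[V Va]; exact.
Qed.

Lemma class_on_cst r U (c : R) : open U -> class_on r b U (fun=> c).
Proof.
move=> Uo; case: r => [k||] /=; first exact: class_fin_cst.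
  by move=> k; exact: class_fin_cst.
by apply/analyticP => //; exact: gevrey_cst.
Qed.

Lemma class_on_add r U f g : open U ->
  class_on r b U f -> class_on r b U g -> class_on r b U (fun x => f x + g x).
Proof.
move=> Uo; case: r => [k||] /=; first exact: class_fin_add.
  by move=> F G k; exact: class_fin_add.
move=> /(analyticP _ Uo) F /(analyticP _ Uo) G; apply/analyticP => //.
exact: gevrey_add.
Qed.

Lemma class_on_mul r U f g : open U ->
  class_on r b U f -> class_on r b U g -> class_on r b U (fun x => f x * g x).
Proof.
move=> Uo; case: r => [k||] /=; first exact: class_fin_mul.
  by move=> F G k; exact: class_fin_mul.
move=> /(analyticP _ Uo) F /(analyticP _ Uo) G; apply/analyticP => //.
exact: gevrey_mul.
Qed.

Lemma class_on_inv r U f : open U -> (forall x, U x -> f x != 0) ->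
  class_on r b U f -> class_on r b U (fun x => (f x)^-1).
Proof.
move=> Uo f0; case: r => [k||] /=; first exact: class_fin_inv.
  by move=> F k; exact: class_fin_inv.
by move=> /(analyticP _ Uo) F; apply/analyticP => //; exact: gevrey_inv.
Qed.

Lemma class_on_opp r U f : open U -> class_on r b U f -> class_on r b U (fun x => - f x).
Proof.
move=> Uo F; apply: class_on_ext (class_on_mul Uo (class_on_cst r (-1) Uo) F) => // x _.
by rewrite mulN1r.
Qed.

Lemma class_on_sum (I : finType) r U (F : I -> E -> R) : open U ->
  (forall i, class_on r b U (F i)) -> class_on r b U (fun x => \sum_i F i x).
Proof.
move=> Uo H; suff : forall s : seq I, class_on r b U (fun x => \sum_(i <- s) F i x) by exact.
elim=> [|i s IH].
  by apply: class_on_ext (class_on_cst r 0 Uo) => // x _; rewrite big_nil.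
by apply: class_on_ext (class_on_add Uo (H i) IH) => // x _; rewrite big_cons.
Qed.

Lemma class_on_prod (I : finType) r U (F : I -> E -> R) : open U ->
  (forall i, class_on r b U (F i)) -> class_on r b U (fun x => \prod_i F i x).
Proof.
move=> Uo H; suff : forall s : seq I, class_on r b U (fun x => \prod_(i <- s) F i x) by exact.
elim=> [|i s IH].
  by apply: class_on_ext (class_on_cst r 1 Uo) => // x _; rewrite big_nil.
by apply: class_on_ext (class_on_mul Uo (H i) IH) => // x _; rewrite big_cons.
Qed.

Lemma class_on_le1 r U f : open U -> class_on (shift_class r 1) b U f -> class_on r b U f.
Proof.
by move=> Uo; case: r => [k||] //=; rewrite addn1; exact: class_fin_le1.
Qed.

Lemma class_on_le r k l U f : open U -> (k <= l)%N ->
  class_on (shift_class r l) b U f -> class_on (shift_class r k) b U f.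
Proof.
move=> Uo kl; case: r => [n||] //=; apply: class_fin_le => //.
by rewrite leq_add2l.
Qed.

Lemma class_on_pd r U f i : open U ->
  class_on (shift_class r 1) b U f -> class_on r b U (pd i f).
Proof.
move=> Uo; case: r => [k||] /=; first by rewrite addn1 => -[_ /(_ i)[]].
  by move=> H; exact: smooth_pd.
by move=> /(analyticP _ Uo) F; apply/analyticP => //; exact: gevrey_pd.
Qed.

Lemma class_on_fin r k U f : open U ->
  class_on (shift_class r k) b U f -> class_fin 0 k U f.
Proof.
move=> Uo; case: r => [n||] H.
- exact: class_fin_zero (class_fin_le b1 Uo (leq_addl n k) H).
- exact: (H k).
- by have [Hs _] := (analyticP _ Uo).1 H; exact: (Hs k).
Qed.

Lemma class_on_cont r U f : open U -> class_on r b U f -> continuous_on U f.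
Proof.
move=> Uo; case: r => [k||] /=; first exact: class_fin_cont.
  by move=> /(_ 0%N)/class_fin_cont.
by move=> /(analyticP _ Uo)[/(_ 0%N)/class_fin_cont].
Qed.

Lemma class_on_structure r k U f : open U ->
  class_on (structure_class r) 0 U f -> class_on (shift_class r k) b U f.
Proof.
move=> Uo; case: r => [n||] //= H.
by apply: class_fin_smooth => //; exact: H.
Qed.

Lemma class_on_det n r U (F : E -> 'M[R]_n) : open U ->
  (forall i j, class_on r b U (fun x => F x i j)) ->
  class_on r b U (fun x => \det (F x)).
Proof.
move=> Uo H; apply: class_on_sum => // s; apply: class_on_mul => //.
  exact: class_on_cst.
by apply: class_on_prod.
Qed.

(** Cramer's rule: an entry of the inverse is a cofactor times one scalar inverse. *)
Lemma class_on_invmx n r U (F : E -> 'M[R]_n) i j : open U ->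
  (forall i j, class_on r b U (fun x => F x i j)) ->
  (forall x, U x -> F x \in unitmx) ->
  class_on r b U (fun x => invmx (F x) i j).
Proof.
move=> Uo H Fu.
have D : class_on r b U (fun x => (\det (F x))^-1 * ((-1) ^+ (j + i) * \det (row' j (col' i (F x))))).
  apply: class_on_mul => //.
    apply: class_on_inv (class_on_det Uo H) => // x Ux.
    by have := Fu x Ux; rewrite unitmxE unitfE.
  apply: class_on_mul (class_on_cst _ _ Uo) (class_on_det Uo _) => // k l.
  by apply: class_on_ext (H (lift j k) (lift i l)) => // x _; rewrite !mxE.
apply: class_on_ext D => // x Ux.
by rewrite /invmx Fu // !mxE.
Qed.

End ClassOn.

Lemma class_on_comp {R : realType} {p m : nat} (b : R) r (U : set 'rV[R]_p)
    (V : set 'rV[R]_m) (g : 'rV[R]_m -> R) (phi : 'rV[R]_p -> 'rV[R]_m) : b <= 1 ->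
  open U -> open V -> (forall x, U x -> V (phi x)) -> class_on r b V g ->
  (forall i, class_on (shift_class r 1) b U (fun z => phi z 0 i)) ->
  class_on r b U (fun z => g (phi z)).
Proof.
move=> b1 Uo Vo UV; case: r => [k||] /= G P.
- by apply: class_fin_comp UV G _ => // i; rewrite -addn1; exact: P.
- exact: smooth_comp Uo Vo UV G P.
- apply/analyticP => //; apply: gevrey_comp UV _ _ => //; first exact/analyticP.
  by move=> i; apply/analyticP => //; exact: P.
Qed.

(** * Christoffel symbols and the covariant derivative *)

Section MatrixDerive.
Context {R : realType} {V : normedModType R}.

Lemma is_derive_mulmx {p q s} (A : V -> 'M[R]_(p, q)) (B : V -> 'M[R]_(q, s)) x v dA dB :
  is_derive x v A dA -> is_derive x v B dB ->
  is_derive x v (fun z => A z *m B z) (dA *m B x + A x *m dB).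
Proof.
move=> /is_derive_mxP HA /is_derive_mxP HB; apply/is_derive_mxP => i j.
rewrite (_ : (fun z => _) = \sum_k ((fun z => A z i k) * (fun z => B z k j))); last first.
  by rewrite funeqE => z; rewrite mxE fct_sumE.
apply: is_derive_eq (is_derive_sum (fun k => is_deriveM (HA i k) (HB k j))) _.
rewrite !mxE -big_split /=; apply: eq_bigr => k _.
by rewrite /GRing.scale /=; ring.
Qed.

Lemma is_derive_trmx {p q} (A : V -> 'M[R]_(p, q)) x v dA :
  is_derive x v A dA -> is_derive x v (fun z => (A z)^T) dA^T.
Proof.
move=> /is_derive_mxP HA; apply/is_derive_mxP => i j; rewrite mxE.
by rewrite (_ : (fun z => _) = (fun z => A z j i)) // funeqE => z; rewrite mxE.
Qed.

Lemma is_derive_inner {n} (G : V -> 'M[R]_n) (a c : V -> 'rV[R]_n) x v dG da dc :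
  is_derive x v G dG -> is_derive x v a da -> is_derive x v c dc ->
  is_derive x v (fun z => inner (G z) (a z) (c z))
   (inner dG (a x) (c x) + inner (G x) da (c x) + inner (G x) (a x) dc).
Proof.
move=> HG Ha Hc.
have /is_derive_mxP/(_ 0 0) H := is_derive_mulmx (is_derive_mulmx Ha HG) (is_derive_trmx Hc).
apply: is_derive_eq H _.
have E3 (A B C : 'M[R]_1) : (A + B + C) 0 0 = A 0 0 + B 0 0 + C 0 0 by rewrite !mxE.
by rewrite mulmxDl E3 /inner; ring.
Qed.

Lemma differentiable_mx {p q} (F : V -> 'M[R]_(p, q)) x :
  (forall i j, differentiable (fun z => F z i j) x) -> differentiable F x.
Proof.
move=> H; have -> : F = \sum_i \sum_j (fun z => F z i j *: (delta_mx i j : 'M[R]_(p, q))).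
  rewrite funeqE => z; rewrite [LHS]matrix_sum_delta.
  by rewrite fct_sumE; apply: eq_bigr => i _; rewrite fct_sumE.
apply: differentiable_sum => i; apply: differentiable_sum => j.
exact: differentiableZl.
Qed.

End MatrixDerive.

Section Inner.
Context {R : realType} {n : nat}.
Implicit Types (G : 'M[R]_n) (u v w : 'rV[R]_n).

Lemma innerE G u w : inner G u w = \sum_i \sum_j u 0 i * G i j * w 0 j.
Proof.
rewrite /inner mxE exchange_big /=; apply: eq_bigr => j _.
by rewrite !mxE mulr_suml.
Qed.

Lemma innerDl G u v w : inner G (u + v) w = inner G u w + inner G v w.
Proof. by rewrite /inner !mulmxDl mxE. Qed.

Lemma innerDr G u v w : inner G w (u + v) = inner G w u + inner G w v.
Proof. by rewrite /inner linearD /= mulmxDr mxE. Qed.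

Lemma innerBl G u v w : inner G (u - v) w = inner G u w - inner G v w.
Proof. by rewrite /inner !mulmxBl !mxE. Qed.

Lemma innerZl G (c : R) u w : inner G (c *: u) w = c * inner G u w.
Proof. by rewrite /inner -!scalemxAl mxE. Qed.

Lemma innerZr G (c : R) u w : inner G u (c *: w) = c * inner G u w.
Proof. by rewrite /inner linearZ /= -scalemxAr mxE. Qed.

Lemma innerC G u w : G^T = G -> inner G u w = inner G w u.
Proof.
move=> Gs; rewrite /inner -[in RHS]Gs -[w]trmxK -!trmx_mul trmxK mulmxA.
by rewrite [RHS]mxE.
Qed.

End Inner.

Section DirectionalDerivative.
Context {R : realType} {V W : normedModType R}.

Lemma deriveDv (f : V -> W) x (u v : V) : differentiable f x ->
  'D_(u + v) f x = 'D_u f x + 'D_v f x.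
Proof. by move=> fd; rewrite !deriveE // linearD. Qed.

Lemma deriveZv (f : V -> W) x (c : R) (v : V) : differentiable f x ->
  'D_(c *: v) f x = c *: 'D_v f x.
Proof. by move=> fd; rewrite !deriveE // linearZ. Qed.

End DirectionalDerivative.

Section Koszul.
Context {R : realType} {n : nat}.
Implicit Types (G : 'rV[R]_n -> 'M[R]_n) (u v w p : 'rV[R]_n).

Lemma derive_basis_sum {W : normedModType R} m (f : 'rV[R]_m -> W) (x v : 'rV[R]_m) :
  differentiable f x -> 'D_v f x = \sum_i v 0 i *: pd i f x.
Proof.
move=> fd; rewrite deriveE // [v in LHS]row_sum_delta linear_sum.
by apply: eq_bigr => i _; rewrite linearZ /= deriveE.
Qed.

Definition christoffel_form G p u w : 'rV[R]_n :=
  \row_k \sum_a \sum_b christoffel G p k a b * u 0 a * w 0 b.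

Lemma inner_derive G p u v w : differentiable G p ->
  inner ('D_u G p) w v
  = \sum_a \sum_b \sum_l u 0 a * w 0 b * v 0 l * pd a (fun z => G z b l) p.
Proof.
move=> Gd; rewrite innerE exchange_big /=.
under eq_bigr do under eq_bigr do rewrite derive_basis_sum // summxE.
transitivity (\sum_l \sum_b \sum_a u 0 a * w 0 b * v 0 l * pd a (fun z => G z b l) p).
  apply: eq_bigr => l _; apply: eq_bigr => b _; rewrite mulr_sumr mulr_suml.
  apply: eq_bigr => a _; rewrite mxE derive_mx; last exact: diff_derivable.
  by rewrite mxE; ring.
rewrite exchange_big /=.
transitivity (\sum_b \sum_a \sum_l u 0 a * w 0 b * v 0 l * pd a (fun z => G z b l) p).
  by apply: eq_bigr => b _; exact: exchange_big.
exact: exchange_big.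
Qed.

(** Koszul's formula for constant fields: pairing with [v] cancels the inverse matrix in the
    Christoffel symbols. Their symmetry, the compatibility with the metric and the law for changes
    of coordinates are all read off from it. *)
Lemma koszul G p u v w : differentiable G p -> (G p)^T = G p -> G p \in unitmx ->
  inner (G p) (christoffel_form G p u w) v
  = 2^-1 * (inner ('D_u G p) w v + inner ('D_w G p) u v - inner ('D_v G p) u w).
Proof.
move=> Gd Gs Gu.
(* The Christoffel form with its upper index lowered. *)
pose c : 'rV[R]_n := \row_l \sum_a \sum_b 2^-1 * (u 0 a * w 0 b *
  (pd a (fun z => G z b l) p + pd b (fun z => G z a l) p - pd l (fun z => G z a b) p)).
have -> : christoffel_form G p u w = c *m invmx (G p).
  apply/rowP => k; rewrite !mxE.
  rewrite [RHS](eq_bigr (fun l => \sum_a \sum_b invmx (G p) k l * 2^-1 * (u 0 a * w 0 b *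
    (pd a (fun z => G z b l) p + pd b (fun z => G z a l) p - pd l (fun z => G z a b) p)))); last first.
    move=> l _; rewrite mxE mulr_suml; apply: eq_bigr => a _; rewrite mulr_suml.
    apply: eq_bigr => b _; rewrite -[in invmx _ l k]Gs -trmx_inv mxE; ring.
  rewrite [RHS]exchange_big /=; apply: eq_bigr => a _.
  rewrite [RHS]exchange_big /=; apply: eq_bigr => b _.
  rewrite /christoffel mulr_sumr -mulrA mulr_suml; apply: eq_bigr => l _; ring.
have -> : inner (G p) (c *m invmx (G p)) v = \sum_l c 0 l * v 0 l.
  rewrite /inner mulmxKV // mxE; apply: eq_bigr => l _; by rewrite [v^T _ _]mxE.
rewrite !inner_derive // [\sum_a \sum_b \sum_l w _ _ * _ * _ * _]exchange_big /=.
rewrite [X in _ - X](_ : _ = \sum_a \sum_b \sum_l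
   u 0 a * w 0 b * v 0 l * pd l (fun z => G z a b) p); last first.
  rewrite exchange_big /=; apply: eq_bigr => a _; rewrite exchange_big /=.
  by apply: eq_bigr => b _; apply: eq_bigr => l _; ring.
rewrite -big_split /= -sumrB mulr_sumr.
rewrite (eq_bigr (fun l => \sum_a \sum_b 2^-1 * (u 0 a * w 0 b * (pd a (fun z => G z b l) p
  + pd b (fun z => G z a l) p - pd l (fun z => G z a b) p)) * v 0 l)); last first.
  by move=> l _; rewrite mxE mulr_suml; apply: eq_bigr => a _; rewrite mulr_suml.
rewrite [LHS]exchange_big /=; apply: eq_bigr => a _.
rewrite [LHS]exchange_big /= -big_split /= -sumrB mulr_sumr; apply: eq_bigr => b _.
rewrite -big_split /= -sumrB mulr_sumr; apply: eq_bigr => l _; ring.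
Qed.

End Koszul.

Section CompDerive.
Context {R : realType} {V W Z : normedModType R}.

Lemma is_derive_comp_diff (phi : V -> W) (H : W -> Z) z X :
  differentiable phi z -> differentiable H (phi z) ->
  is_derive z X (fun w => H (phi w)) ('D_('D_X phi z) H (phi z)).
Proof.
move=> phid Hd; split; first by apply: diff_derivable; exact: (differentiable_comp phid Hd).
rewrite deriveE; last exact: (differentiable_comp phid Hd).
by rewrite (diff_comp phid Hd) /= !deriveE.
Qed.

End CompDerive.

Section VectorRegularity.
Context {R : realType} {m n : nat}.
Implicit Types (U : set 'rV[R]_m) (F : 'rV[R]_m -> 'rV[R]_n).

Definition class_rV k U F := forall j, class_fin 0 k U (fun x => F x 0 j).

Definition jacm F x : 'M[R]_(m, n) := \matrix_(i, k) ('D_(basis_vec i) F x) 0 k.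

Lemma class_rV_le k l U F : open U -> (k <= l)%N -> class_rV l U F -> class_rV k U F.
Proof. by move=> Uo kl H j; exact: class_fin_le Uo kl (H j). Qed.

Lemma class_rV_differentiable k U F x :
  open U -> class_rV k.+1 U F -> U x -> differentiable F x.
Proof.
move=> Uo H Ux; apply: differentiable_rV => j.
exact: class_fin_differentiable Uo Ux (H j).
Qed.

Lemma mul_jacm F x u : differentiable F x -> u *m jacm F x = 'D_u F x.
Proof.
move=> Fd; rewrite derive_basis_sum //; apply/rowP => k.
by rewrite mxE summxE; apply: eq_bigr => i _; rewrite !mxE.
Qed.

Lemma derive_coord F x u j : differentiable F x ->
  'D_u F x 0 j = 'D_u (fun z => F z 0 j) x.
Proof. by move=> Fd; rewrite derive_mx ?mxE //; exact: diff_derivable. Qed.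

Lemma class_rV_derive k U F u : open U -> class_rV k.+1 U F ->
  class_rV k U (fun x => 'D_u F x).
Proof.
move=> Uo H j.
have S : class_fin 0 k U (fun x => \sum_i u 0 i * pd i (fun z => F z 0 j) x).
  apply: class_fin_sum => // i; apply: class_fin_mul => //; first exact: class_fin_cst.
  by have [_ /(_ i)[]] := H j.
apply: class_fin_ext S => // x Ux.
have Fd := class_rV_differentiable Uo H Ux.
rewrite derive_coord // derive_basis_sum //; exact: class_fin_differentiable Uo Ux (H j).
Qed.

Lemma jacm_differentiable U F x : open U -> class_rV 2 U F -> U x ->
  differentiable (jacm F) x.
Proof.
move=> Uo H Ux; apply: differentiable_mx => i k.
rewrite (_ : (fun z => _) = (fun z => 'D_(basis_vec i) F z 0 k)); last first.
  by rewrite funeqE => z; rewrite mxE.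
exact: class_fin_differentiable Uo Ux (class_rV_derive _ Uo H k).
Qed.

Lemma derive_schwarz U F x u v : open U -> class_rV 2 U F -> U x ->
  'D_u (fun w => 'D_v F w) x = 'D_v (fun w => 'D_u F w) x.
Proof.
move=> Uo H Ux.
have dE (a c : 'rV[R]_m) j : ('D_a (fun w => 'D_c F w) x) 0 j
   = \sum_i \sum_k a 0 i * c 0 k * pd i (pd k (fun z => F z 0 j)) x.
  have dd := class_rV_differentiable Uo (class_rV_derive c Uo H) Ux.
  rewrite derive_coord //.
  rewrite (@near_eq_derive _ _ _ _ (fun w => \sum_k c 0 k * pd k (fun z => F z 0 j) w)).
    have D k : differentiable (fun w => c 0 k * pd k (fun z => F z 0 j) w) x.
      have H1 : class_fin 0 1 U (fun w => c 0 k * pd k (fun z => F z 0 j) w).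
        apply: class_fin_mul => //; first exact: class_fin_cst.
        by have [_ /(_ k)[]] := H j.
      exact: class_fin_differentiable Uo Ux H1.
    have D' k : differentiable (pd k (fun z => F z 0 j)) x.
      have H1 : class_fin 0 1 U (pd k (fun z => F z 0 j)) by have [_ /(_ k)[]] := H j.
      exact: class_fin_differentiable Uo Ux H1.
    rewrite (_ : (fun w => _) = \sum_k (fun w => c 0 k * pd k (fun z => F z 0 j) w)); last first.
      by rewrite funeqE => w; rewrite fct_sumE.
    rewrite derive_sum; last by move=> k; exact: diff_derivable.
    rewrite exchange_big /=; apply: eq_bigr => k _.
    have -> : 'D_a (fun w => c 0 k * pd k (fun z => F z 0 j) w) x = c 0 k * 'D_a (pd k (fun z => F z 0 j)) x.
      by apply: deriveZ; exact: diff_derivable.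
    rewrite derive_basis_sum // mulr_sumr; apply: eq_bigr => i _.
    by rewrite /GRing.scale /=; ring.
  apply: (near_open Uo Ux) => w Uw.
  have Fd := class_rV_differentiable Uo H Uw.
  rewrite derive_coord // derive_basis_sum //; exact: class_fin_differentiable Uo Uw (H j).
apply/rowP => j; apply: etrans (dE u v j) (etrans _ (esym (dE v u j))).
rewrite exchange_big /=.
apply: eq_bigr => i _; apply: eq_bigr => k _.
have E : pd k (pd i (fun z => F z 0 j)) x = pd i (pd k (fun z => F z 0 j)) x.
  apply: (schwarz _ _ Uo Ux) => [y l Uy|y l l' Uy|l l'].
  - by have [_ /(_ l)[+ _]] := H j; apply.
  - by have [_ /(_ l)[_ [_ /(_ l')[+ _]]]] := H j; apply.
  - by have [_ /(_ l)[_ [_ /(_ l')[_ [cc _]]]]] := H j; exact: cc.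
by apply: etrans (congr1 (fun s => u 0 k * v 0 i * s) E) _; rewrite [u 0 k * _]mulrC.
Qed.

End VectorRegularity.

Section Composite.
Context {R : realType} {p m n : nat}.
Variables (U : set 'rV[R]_p) (V : set 'rV[R]_m).
Variables (phi : 'rV[R]_p -> 'rV[R]_m) (T : 'rV[R]_m -> 'rV[R]_n).
Hypotheses (Uo : open U) (Vo : open V) (UV : forall x, U x -> V (phi x)).

Lemma derive_comp z v : class_rV 1 U phi -> class_rV 1 V T -> U z ->
  'D_v (T \o phi) z = 'D_('D_v phi z) T (phi z).
Proof.
move=> Hp HT Uz.
have [_ <- //] := @is_derive_comp_diff _ _ _ _ phi T z v (class_rV_differentiable Uo Hp Uz)
  (class_rV_differentiable Vo HT (UV Uz)).
Qed.

Lemma class_rV_comp k : class_rV k.+1 U phi -> class_rV k V T -> class_rV k U (T \o phi).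
Proof. by move=> Hp HT j; apply: (class_fin_comp ler01 Uo Vo UV (HT j)). Qed.

Lemma derive2_comp z X Y : class_rV 2 U phi -> class_rV 2 V T -> U z ->
  'D_X (fun w => 'D_Y (T \o phi) w) z
  = 'D_('D_X (fun w => 'D_Y phi w) z) T (phi z)
    + 'D_('D_X phi z) (fun q => 'D_('D_Y phi z) T q) (phi z).
Proof.
move=> Hp HT Uz.
have Hp1 := class_rV_le Uo (leqnSn 1) Hp; have HT1 := class_rV_le Vo (leqnSn 1) HT.
have Td := class_rV_differentiable Vo HT (UV Uz).
have phid := class_rV_differentiable Uo Hp Uz.
have Jd := jacm_differentiable Vo HT (UV Uz).
(* Written as a matrix product, the first derivative can be differentiated by the product rule; the
   second summand becomes the Hessian of T. *)
rewrite (@near_eq_derive _ _ _ _ (fun w => 'D_Y phi w *m jacm T (phi w))); last first.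
  apply: (near_open Uo Uz) => w Uw; rewrite derive_comp // mul_jacm //.
  exact: class_rV_differentiable HT (UV Uw).
have d1 : is_derive z X (fun w => 'D_Y phi w) ('D_X (fun w => 'D_Y phi w) z).
  apply: derivableP; apply: diff_derivable.
  exact: class_rV_differentiable Uo (class_rV_derive Y Uo Hp) Uz.
have [_ ->] := is_derive_mulmx d1 (is_derive_comp_diff X phid Jd).
rewrite mul_jacm //; congr (_ + _).
rewrite [RHS](@near_eq_derive _ _ _ _ (fun q => 'D_Y phi z *m jacm T q)); last first.
  apply: (near_open Vo (UV Uz)) => q Vq; rewrite mul_jacm //.
  exact: class_rV_differentiable HT Vq.
have d2 : is_derive (phi z) ('D_X phi z) (jacm T) ('D_('D_X phi z) (jacm T) (phi z)).
  by apply: derivableP; exact: diff_derivable.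
have [_ ->] := is_derive_mulmx (is_derive_cst ('D_Y phi z) (phi z) ('D_X phi z)) d2.
by rewrite mul0mx add0r.
Qed.

End Composite.

Section PositiveDefinite.
Context {R : realType} {n : nat}.
Implicit Types (G : 'M[R]_n).

Lemma posdef_unitmx G : (forall u, u != 0 -> 0 < inner G u u) -> G \in unitmx.
Proof.
move=> Gp; rewrite unitmxE unitfE; apply/negP => /det0P[v v0 vG].
by have := Gp v v0; rewrite /inner vG mul0mx mxE ltxx.
Qed.

Lemma posdef_inner_eq0 G u : (forall u, u != 0 -> 0 < inner G u u) ->
  inner G u u = 0 -> u = 0.
Proof. by move=> Gp Gu; apply/eqP/negPn/negP => /Gp; rewrite Gu ltxx. Qed.

End PositiveDefinite.

(* Inner products of derivatives are made opaque before calling an arithmetic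
   tactic, which would otherwise compare them by unfolding limits. *)
Ltac generalize_inner :=
  repeat match goal with |- context [inner ?A ?B ?C] => generalize (inner A B C); intro end.

Section MetricOn.
Context {R : realType} {n : nat}.

Record metric_on (V : set 'rV[R]_n) (G : 'rV[R]_n -> 'M[R]_n) : Prop := MetricOn {
  metric_open : open V;
  metric_diff : forall p, V p -> differentiable G p;
  metric_sym : forall p, V p -> (G p)^T = G p;
  metric_pos : forall p, V p -> forall u, u != 0 -> 0 < inner (G p) u u }.

Lemma metric_on_derive_sym V G p u : metric_on V G -> V p -> ('D_u G p)^T = 'D_u G p.
Proof.
move=> [Vo Gd Gs _] Vp.
have d1 : is_derive p u G ('D_u G p) by apply: derivableP; exact/diff_derivable/Gd.
have [_ <-] := is_derive_trmx d1; apply: near_eq_derive.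
by apply: (near_open Vo Vp) => q /Gs.
Qed.

Lemma metric_on_unitmx V G p : metric_on V G -> V p -> G p \in unitmx.
Proof. by move=> [_ _ _ Gp] /Gp; exact: posdef_unitmx. Qed.

Lemma christoffel_formC V G p u w : metric_on V G -> V p ->
  christoffel_form G p u w = christoffel_form G p w u.
Proof.
move=> HG Vp; have [_ Gd Gs Gp] := HG.
have H v : inner (G p) (christoffel_form G p u w) v = inner (G p) (christoffel_form G p w u) v.
  have K1 := koszul u v w (Gd p Vp) (Gs p Vp) (metric_on_unitmx HG Vp).
  have K2 := koszul w v u (Gd p Vp) (Gs p Vp) (metric_on_unitmx HG Vp).
  have := innerC u w (metric_on_derive_sym v HG Vp); move: K1 K2; generalize_inner.
  by move=> H1 H2 H3; lra.
apply/eqP; rewrite -subr_eq0; apply/eqP/(posdef_inner_eq0 (Gp p Vp)).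
by rewrite innerBl H subrr.
Qed.

Lemma christoffel_form_linear (G : 'rV[R]_n -> 'M[R]_n) p (c : R) u u' w :
  christoffel_form G p (c *: u + u') w
  = c *: christoffel_form G p u w + christoffel_form G p u' w.
Proof.
apply/rowP => k; rewrite !mxE mulr_sumr -big_split /=.
apply: eq_bigr => a _; rewrite mulr_sumr -big_split /=; apply: eq_bigr => d _.
by rewrite !mxE; ring.
Qed.

End MetricOn.

(* Algebraic core of the transformation law: g and g' stand for the metrics at a
   point, dg and dg' for their derivatives, t for the differential of the change
   of coordinates and h for its Hessian. *)
Lemma koszul_change_algebra {R : realType} {n : nat} (g' : 'M[R]_n)
    (dg dg' : 'rV[R]_n -> 'M[R]_n) (t : 'rV[R]_n -> 'rV[R]_n)
    (h : 'rV[R]_n -> 'rV[R]_n -> 'rV[R]_n) (u w v : 'rV[R]_n) :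
  g'^T = g' -> (forall a c, h a c = h c a) ->
  (forall a c e, inner (dg a) c e
    = inner (dg' a) (t c) (t e) + inner g' (h a c) (t e) + inner g' (t c) (h a e)) ->
  2^-1 * (inner (dg u) w v + inner (dg w) u v - inner (dg v) u w)
  = 2^-1 * (inner (dg' u) (t w) (t v) + inner (dg' w) (t u) (t v)
            - inner (dg' v) (t u) (t w)) + inner g' (h u w) (t v).
Proof.
move=> gs hC H; rewrite !H (hC w u) (hC v u) (hC v w).
rewrite (innerC (h u v) (t w) gs); by field.
Qed.

Section ChristoffelChange.
Context {R : realType} {n : nat}.
Variables (V V' : set 'rV[R]_n) (G G' : 'rV[R]_n -> 'M[R]_n) (T : 'rV[R]_n -> 'rV[R]_n).
Hypotheses (HG : metric_on V G) (HG' : metric_on V' G') (HT : class_rV 2 V T).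
Hypothesis VV' : forall p, V p -> V' (T p).
Hypothesis GT : forall p, V p -> forall u w,
  inner (G p) u w = inner (G' (T p)) ('D_u T p) ('D_w T p).

Let Vo := metric_open HG.

Let Td p : V p -> differentiable T p.
Proof. exact: class_rV_differentiable HT. Qed.

(** By [GT], a vector killed by the Jacobian would have length 0 for [G]. *)
Lemma change_jacm_unit p : V p -> jacm T p \in unitmx.
Proof.
move=> Vp; rewrite unitmxE unitfE; apply/negP => /det0P[v v0 vJ].
have := metric_pos HG Vp v0; rewrite GT // -(mul_jacm _ (Td Vp)) vJ.
by rewrite /inner !mul0mx mxE ltxx.
Qed.

Lemma inner_derive_change p u w v : V p ->
  inner ('D_u G p) w v
  = inner ('D_('D_u T p) G' (T p)) ('D_w T p) ('D_v T p)
    + inner (G' (T p)) ('D_u (fun q => 'D_w T q) p) ('D_v T p)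
    + inner (G' (T p)) ('D_w T p) ('D_u (fun q => 'D_v T q) p).
Proof.
move=> Vp.
have dG : is_derive p u G ('D_u G p).
  by apply: derivableP; exact/diff_derivable/(metric_diff HG).
have H1 := is_derive_inner dG (is_derive_cst w p u) (is_derive_cst v p u).
have dT a : is_derive p u (fun q => 'D_a T q) ('D_u (fun q => 'D_a T q) p).
  apply/derivableP/diff_derivable.
  exact: class_rV_differentiable Vo (class_rV_derive a Vo HT) Vp.
have H2 := is_derive_inner
  (is_derive_comp_diff u (Td Vp) (metric_diff HG' (VV' Vp))) (dT w) (dT v).
case: H1 => _ H1; case: H2 => _ <-.
transitivity ('D_u (fun q => inner (G q) (cst w q) (cst v q)) p).
  rewrite H1 /cst; rewrite /inner !mul0mx linear0 mulmx0.
  by rewrite [X in _ = _ + X]mxE [X in _ = _ + X + _]mxE !addr0.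
by apply: near_eq_derive; apply: (near_open Vo Vp) => q Vq; rewrite /cst GT.
Qed.

Lemma christoffel_change p u w : V p ->
  'D_(christoffel_form G p u w) T p
  = christoffel_form G' (T p) ('D_u T p) ('D_w T p) + 'D_u (fun q => 'D_w T q) p.
Proof.
move=> Vp; apply/eqP; rewrite -subr_eq0; set d := _ - _.
have V'p := VV' Vp.
(* [d] is to be shown orthogonal to itself. Writing its second copy as an image under the
   differential of T makes Koszul's formulas in the two charts comparable. *)
have dJ : d = 'D_(d *m invmx (jacm T p)) T p.
  by rewrite -mul_jacm ?mulmxKV ?change_jacm_unit //; exact: Td.
apply/eqP/(posdef_inner_eq0 (metric_pos HG' V'p)); rewrite {2}dJ.
move: (d *m _) => v.
have K := koszul u v w (metric_diff HG Vp) (metric_sym HG Vp) (metric_on_unitmx HG Vp).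
have K' := koszul ('D_u T p) ('D_v T p) ('D_w T p) (metric_diff HG' V'p) (metric_sym HG' V'p)
  (metric_on_unitmx HG' V'p).
have A := @koszul_change_algebra R n (G' (T p)) (fun a => 'D_a G p)
  (fun a => 'D_('D_a T p) G' (T p)) (fun a => 'D_a T p)
  (fun a c => 'D_a (fun q => 'D_c T q) p) u w v (metric_sym HG' V'p)
  (fun a c => derive_schwarz a c Vo HT Vp) (fun a c e => inner_derive_change a c e Vp).
rewrite /d innerBl innerDl; apply/eqP; rewrite subr_eq0; apply/eqP.
exact: (etrans (esym (GT Vp _ _)) (etrans K (etrans A (congr1 (fun s => s + _) (esym K'))))).
Qed.

End ChristoffelChange.

Section CovariantDerivative.
Context {R : realType} {n : nat}.

Lemma cov_derivE (G : 'rV[R]_n -> 'M[R]_n) phi X W z :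
  cov_deriv G phi X W z = 'D_X W z + christoffel_form G (phi z) ('D_X phi z) (W z).
Proof. by []. Qed.

Variables (U : set 'rV[R]_2) (V : set 'rV[R]_n).
Variables (phi : 'rV[R]_2 -> 'rV[R]_n) (G : 'rV[R]_n -> 'M[R]_n).
Hypotheses (Uo : open U) (HG : metric_on V G) (Hphi : class_rV 2 U phi).
Hypothesis UV : forall z, U z -> V (phi z).

Let phid z : U z -> differentiable phi z.
Proof. exact: class_rV_differentiable Hphi. Qed.

Lemma cov_deriv_torsion_free X Y z : U z ->
  cov_deriv G phi X (fun w => 'D_Y phi w) z = cov_deriv G phi Y (fun w => 'D_X phi w) z.
Proof.
move=> Uz; rewrite !cov_derivE (derive_schwarz X Y Uo Hphi Uz).
by rewrite (christoffel_formC _ _ HG (UV Uz)).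
Qed.

Lemma cov_deriv_metric X (W1 W2 : 'rV[R]_2 -> 'rV[R]_n) z : U z ->
  differentiable W1 z -> differentiable W2 z ->
  'D_X (fun w => inner (G (phi w)) (W1 w) (W2 w)) z
  = inner (G (phi z)) (cov_deriv G phi X W1 z) (W2 z)
    + inner (G (phi z)) (W1 z) (cov_deriv G phi X W2 z).
Proof.
move=> Uz d1 d2; have Vz := UV Uz.
have D1 : is_derive z X W1 ('D_X W1 z) by exact/derivableP/diff_derivable.
have D2 : is_derive z X W2 ('D_X W2 z) by exact/derivableP/diff_derivable.
have [_ ->] := is_derive_inner
  (is_derive_comp_diff X (phid Uz) (metric_diff HG Vz)) D1 D2.
have K1 := koszul ('D_X phi z) (W2 z) (W1 z) (metric_diff HG Vz) (metric_sym HG Vz)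
  (metric_on_unitmx HG Vz).
have K2 := koszul ('D_X phi z) (W1 z) (W2 z) (metric_diff HG Vz) (metric_sym HG Vz)
  (metric_on_unitmx HG Vz).
have S := innerC (W2 z) (W1 z) (metric_on_derive_sym ('D_X phi z) HG Vz).
have S' := innerC (W1 z) (christoffel_form G (phi z) ('D_X phi z) (W2 z)) (metric_sym HG Vz).
rewrite !cov_derivE innerDl innerDr; move: K1 K2 S S'.
generalize_inner.
by move=> H1 H2 H3 H4; lra.
Qed.

End CovariantDerivative.

(** * The mean curvature vector under changes of coordinates *)

Section NormalProjection.
Context {F : fieldType} {n : nat}.
Implicit Types (g : 'M[F]_n) (J : 'M[F]_(2, n)) (w : 'rV[F]_n).

Definition normal_projection g J w :=
  w - w *m g *m J^T *m invmx (J *m g *m J^T) *m J.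

(** The projection depends only on the span of the rows of J: the factors A cancel against the
    inverse of the Gram matrix. *)
Lemma normal_projection_frame g J w (A : 'M[F]_2) :
  A \in unitmx -> J *m g *m J^T \in unitmx ->
  normal_projection g (A *m J) w = normal_projection g J w.
Proof.
move=> Au Iu; rewrite /normal_projection trmx_mul; congr (_ - _).
rewrite (_ : A *m J *m g *m (J^T *m A^T) = A *m (J *m g *m J^T) *m A^T); last first.
  by rewrite !mulmxA.
move: (J *m g *m J^T) Iu => I Iu.
have ATu : A^T \in unitmx by rewrite unitmx_tr.
have -> : invmx (A *m I *m A^T) = invmx A^T *m invmx I *m invmx A.
  have AIu : A *m I *m A^T \in unitmx by rewrite !unitmx_mul Au Iu ATu.
  apply: (can_inj (mulmxK AIu)).
  rewrite mulVmx // !mulmxA -(mulmxA _ (invmx A)) mulVmx // mulmx1.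
  by rewrite -(mulmxA _ (invmx I)) mulVmx // mulmx1 mulVmx.
rewrite !mulmxA -(mulmxA _ A^T) mulmxV // mulmx1.
by rewrite -(mulmxA _ (invmx A)) mulVmx // mulmx1.
Qed.

End NormalProjection.

Section NormalPart.
Context {R : realType} {n : nat}.
Implicit Types (G : 'rV[R]_n -> 'M[R]_n) (phi : 'rV[R]_2 -> 'rV[R]_n).

Lemma inner_ext (A B : 'M[R]_n) : (forall u w, inner A u w = inner B u w) -> A = B.
Proof.
move=> H; apply/matrixP => i j; have := H (delta_mx 0 i) (delta_mx 0 j).
by rewrite /inner !trmx_delta -!rowE -!colE !mxE.
Qed.

Lemma normal_partD G phi z v w :
  normal_part G phi z (v + w) = normal_part G phi z v + normal_part G phi z w.
Proof. by rewrite /normal_part !mulmxDl opprD addrACA. Qed.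

Lemma normal_partZ G phi z (c : R) w :
  normal_part G phi z (c *: w) = c *: normal_part G phi z w.
Proof. by rewrite /normal_part scalerBr -!scalemxAl. Qed.

Lemma mul_jacobian_rows phi z v : differentiable phi z ->
  v *m jacobian_rows phi z = 'D_v phi z.
Proof. exact: mul_jacm. Qed.

Lemma normal_part_tangent G phi z v : differentiable phi z ->
  induced_gram G phi z \in unitmx -> normal_part G phi z ('D_v phi z) = 0.
Proof.
move=> phid iu; rewrite /normal_part -mul_jacobian_rows //.
rewrite (_ : v *m _ *m G (phi z) *m _ = v *m induced_gram G phi z); last first.
  by rewrite /induced_gram !mulmxA.
by rewrite mulmxK // subrr.
Qed.

Lemma jacobian_rows_ext (phi psi : 'rV[R]_2 -> 'rV[R]_n) z :
  (\forall w \near z, phi w = psi w) -> jacobian_rows phi z = jacobian_rows psi z.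
Proof.
by move=> H; apply/matrixP => i k; rewrite !mxE (near_eq_derive _ H).
Qed.

Lemma second_fundamental_form_ext G (phi psi : 'rV[R]_2 -> 'rV[R]_n) (U : set 'rV[R]_2) X Y z :
  open U -> U z -> (forall w, U w -> phi w = psi w) ->
  second_fundamental_form G phi X Y z = second_fundamental_form G psi X Y z.
Proof.
move=> Uo Uz H; have near_eq w : U w -> \forall t \near w, phi t = psi t.
  by move=> Uw; exact: near_open H.
have D v w : U w -> 'D_v phi w = 'D_v psi w.
  by move=> /near_eq; exact: near_eq_derive.
have DD : 'D_X (fun w => 'D_Y phi w) z = 'D_X (fun w => 'D_Y psi w) z.
  by apply: near_eq_derive; apply: (near_open Uo Uz) => w /D.
rewrite /second_fundamental_form /normal_part /induced_gram (jacobian_rows_ext (near_eq z Uz)).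
by rewrite !cov_derivE DD (H z Uz) !(D _ z Uz).
Qed.

End NormalPart.

Section TargetChange.
Context {R : realType} {n : nat}.
Variables (V V' : set 'rV[R]_n) (G G' : 'rV[R]_n -> 'M[R]_n) (T : 'rV[R]_n -> 'rV[R]_n).
Hypotheses (HG : metric_on V G) (HG' : metric_on V' G') (HT : class_rV 2 V T).
Hypothesis VV' : forall p, V p -> V' (T p).
Hypothesis GT : forall p, V p -> forall u w,
  inner (G p) u w = inner (G' (T p)) ('D_u T p) ('D_w T p).
Variables (U : set 'rV[R]_2) (phi : 'rV[R]_2 -> 'rV[R]_n).
Hypotheses (Uo : open U) (Hphi : class_rV 2 U phi) (UV : forall z, U z -> V (phi z)).

Let Vo := metric_open HG.
Let HT1 := class_rV_le Vo (leqnSn 1) HT.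
Let Hphi1 := class_rV_le Uo (leqnSn 1) Hphi.

Let Td p : V p -> differentiable T p.
Proof. exact: class_rV_differentiable HT. Qed.

Lemma gram_change_mx p : V p -> G p = jacm T p *m G' (T p) *m (jacm T p)^T.
Proof.
move=> Vp; apply: inner_ext => u w; rewrite GT // -!mul_jacm; try exact: Td.
by rewrite /inner trmx_mul !mulmxA.
Qed.

Lemma jacobian_rows_target z : U z ->
  jacobian_rows (T \o phi) z = jacobian_rows phi z *m jacm T (phi z).
Proof.
move=> Uz; apply/row_matrixP => i; rewrite row_mul.
have -> : row i (jacobian_rows phi z) = 'D_(basis_vec i) phi z.
  by apply/rowP => k; rewrite !mxE.
rewrite mul_jacm; last exact/Td/UV.
rewrite -(derive_comp Uo Vo UV _ Hphi1 HT1 Uz).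
by apply/rowP => k; rewrite !mxE.
Qed.

Lemma induced_gram_target z : U z ->
  induced_gram G' (T \o phi) z = induced_gram G phi z.
Proof.
move=> Uz; rewrite /induced_gram jacobian_rows_target // (gram_change_mx (UV Uz)).
by rewrite trmx_mul !mulmxA.
Qed.

(** The Hessian of T in the second derivative of [T \o phi] is the one in [christoffel_change], so
    the covariant derivative transforms as a vector; the projection does because T preserves the
    metric. *)
Lemma second_fundamental_form_target X Y z : U z ->
  second_fundamental_form G' (T \o phi) X Y z
  = 'D_(second_fundamental_form G phi X Y z) T (phi z).
Proof.
move=> Uz; have Vz := UV Uz.
have -> : second_fundamental_form G' (T \o phi) X Y z
  = normal_part G' (T \o phi) z ('D_(cov_deriv G phi X (fun w => 'D_Y phi w) z) T (phi z)).
  rewrite /second_fundamental_form; congr normal_part; rewrite !cov_derivE.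
  rewrite (derive2_comp Uo Vo UV X Y Hphi HT Uz).
  rewrite (derive_comp Uo Vo UV X Hphi1 HT1 Uz) (derive_comp Uo Vo UV Y Hphi1 HT1 Uz).
  rewrite deriveDv; last exact: Td.
  by rewrite (christoffel_change HG HG' HT VV' GT _ _ Vz) -addrA [X in _ + X = _]addrC.
rewrite -!mul_jacm; try exact: Td.
rewrite /second_fundamental_form; set w := cov_deriv _ _ _ _ _.
rewrite /normal_part induced_gram_target // jacobian_rows_target // mulmxBl.
by rewrite (gram_change_mx Vz) trmx_mul !mulmxA.
Qed.

End TargetChange.

Section SourceChange.
Context {R : realType} {n : nat}.
Variables (G : 'rV[R]_n -> 'M[R]_n).
Variables (U U' : set 'rV[R]_2) (phi : 'rV[R]_2 -> 'rV[R]_n) (tau : 'rV[R]_2 -> 'rV[R]_2).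
Hypotheses (Uo : open U) (U'o : open U').
Hypotheses (Hphi : class_rV 2 U phi) (Htau : class_rV 2 U' tau).
Hypothesis UU : forall z, U' z -> U (tau z).

Let Hphi1 := class_rV_le Uo (leqnSn 1) Hphi.
Let Htau1 := class_rV_le U'o (leqnSn 1) Htau.

Let phid z : U z -> differentiable phi z.
Proof. exact: class_rV_differentiable Hphi. Qed.

Lemma jacobian_rows_source z : U' z ->
  jacobian_rows (phi \o tau) z = jacm tau z *m jacobian_rows phi (tau z).
Proof.
move=> Uz; apply/row_matrixP => i; rewrite row_mul.
have -> : row i (jacm tau z) = 'D_(basis_vec i) tau z.
  by apply/rowP => k; rewrite !mxE.
rewrite mul_jacobian_rows; last exact/phid/UU.
rewrite -(derive_comp U'o Uo UU _ Htau1 Hphi1 Uz).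
by apply/rowP => k; rewrite !mxE.
Qed.

Lemma induced_gram_source z : U' z -> induced_gram G (phi \o tau) z
  = jacm tau z *m induced_gram G phi (tau z) *m (jacm tau z)^T.
Proof.
by move=> Uz; rewrite /induced_gram jacobian_rows_source // trmx_mul !mulmxA.
Qed.

(** The second derivative of [tau] contributes a vector tangent to the surface, which the normal
    projection removes. *)
Lemma second_fundamental_form_source X Y z : U' z ->
  induced_gram G (phi \o tau) z \in unitmx ->
  second_fundamental_form G (phi \o tau) X Y z
  = second_fundamental_form G phi ('D_X tau z) ('D_Y tau z) (tau z).
Proof.
move=> Uz iu.
(* Invertibility of this product yields that of the Jacobian of [tau] and of the induced metric at
   [tau z]. *)
have : jacm tau z *m induced_gram G phi (tau z) *m (jacm tau z)^T \in unitmx.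
  by rewrite -induced_gram_source.
rewrite !unitmx_mul => /andP[/andP[Au indu] ATu].
have np w : normal_part G (phi \o tau) z w = normal_part G phi (tau z) w.
  apply: etrans (congr1 (fun J => normal_projection (G (phi (tau z))) J w)
    (jacobian_rows_source Uz)) _.
  exact: normal_projection_frame.
have -> : second_fundamental_form G (phi \o tau) X Y z
  = normal_part G (phi \o tau) z ('D_('D_X (fun w => 'D_Y tau w) z) phi (tau z)
    + cov_deriv G phi ('D_X tau z) (fun w => 'D_('D_Y tau z) phi w) (tau z)).
  rewrite /second_fundamental_form; congr normal_part; rewrite !cov_derivE.
  rewrite (derive2_comp U'o Uo UU X Y Htau Hphi Uz) -addrA.
  by rewrite (derive_comp U'o Uo UU X Htau1 Hphi1 Uz) (derive_comp U'o Uo UU Y Htau1 Hphi1 Uz).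
rewrite np normal_partD normal_part_tangent ?add0r //.
exact/phid/UU.
Qed.

End SourceChange.

(** The tension field of [phi] for the flat metric of the parameter plane. *)
Definition mean_field {R : realType} {n : nat} (G : 'rV[R]_n -> 'M[R]_n)
    (phi : 'rV[R]_2 -> 'rV[R]_n) (z : 'rV[R]_2) : 'rV[R]_n :=
  cov_deriv G phi (basis_vec 0) (fun w => 'D_(basis_vec 0) phi w) z
  + cov_deriv G phi (basis_vec 1) (fun w => 'D_(basis_vec 1) phi w) z.

Definition energy {R : realType} {n : nat} (G : 'rV[R]_n -> 'M[R]_n)
    (phi : 'rV[R]_2 -> 'rV[R]_n) (z : 'rV[R]_2) : R :=
  inner (G (phi z)) ('D_(basis_vec 0) phi z) ('D_(basis_vec 0) phi z).

Definition conformal_on {R : realType} {n : nat} (U : set 'rV[R]_2)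
    (G : 'rV[R]_n -> 'M[R]_n) (phi : 'rV[R]_2 -> 'rV[R]_n) : Prop :=
  forall z, U z ->
    inner (G (phi z)) ('D_(basis_vec 0) phi z) ('D_(basis_vec 0) phi z)
      = inner (G (phi z)) ('D_(basis_vec 1) phi z) ('D_(basis_vec 1) phi z)
    /\ inner (G (phi z)) ('D_(basis_vec 0) phi z) ('D_(basis_vec 1) phi z) = 0.

Lemma ord2 (k : 'I_2) : k = 0 \/ k = 1.
Proof. by case: k => -[|[|//]] lk; [left|right]; exact/val_inj. Qed.

(** Here c_ij stands for D_i d_j phi, and the four relations are the derivatives of the conformality
    conditions. They give <c00, d0> = <c01, d1> = <c10, d1> = -<c11, d0>, and the same with the
    indices exchanged. *)
Lemma conformal_algebra {R : realType} {n : nat} (g : 'M[R]_n) (c00 c01 c10 c11 d0 d1 : 'rV[R]_n) :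
  g^T = g -> c01 = c10 ->
  inner g c00 d0 + inner g d0 c00 = inner g c01 d1 + inner g d1 c01 ->
  inner g c10 d0 + inner g d0 c10 = inner g c11 d1 + inner g d1 c11 ->
  inner g c00 d1 + inner g d0 c01 = 0 -> inner g c10 d1 + inner g d0 c11 = 0 ->
  inner g (c00 + c11) d0 = 0 /\ inner g (c00 + c11) d1 = 0.
Proof.
move=> gs <-; rewrite !innerDl !(innerC d0 _ gs) !(innerC d1 _ gs); generalize_inner.
by move=> ? ? ? ?; split; lra.
Qed.

Section Conformal.
Context {R : realType} {n : nat}.
Variables (V : set 'rV[R]_n) (G : 'rV[R]_n -> 'M[R]_n).
Variables (U : set 'rV[R]_2) (phi : 'rV[R]_2 -> 'rV[R]_n).
Hypotheses (HG : metric_on V G) (Uo : open U) (Hphi : class_rV 2 U phi).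
Hypotheses (UV : forall z, U z -> V (phi z)) (Hconf : conformal_on U G phi).

Let Dd v z : U z -> differentiable (fun w => 'D_v phi w) z.
Proof. exact: class_rV_differentiable Uo (class_rV_derive v Uo Hphi). Qed.

Lemma rV2_decomp (X : 'rV[R]_2) : X = X 0 0 *: basis_vec 0 + X 0 1 *: basis_vec 1.
Proof.
apply/rowP => j; rewrite !mxE; case: (ord2 j) => -> /=.
  by rewrite mulr1 mulr0 addr0.
by rewrite mulr1 mulr0 add0r.
Qed.

Lemma inner_jacobian z i j :
  inner (G (phi z)) ('D_(basis_vec i) phi z) ('D_(basis_vec j) phi z)
  = induced_gram G phi z i j.
Proof.
have rE k : 'D_(basis_vec k) phi z = row k (jacobian_rows phi z).
  by apply/rowP => l; rewrite !mxE.
by rewrite !rE /inner /induced_gram tr_row -!row_mul colE mulmxA -colE !mxE.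
Qed.

Lemma conformal_induced_gram z : U z -> induced_gram G phi z = (energy G phi z)%:M.
Proof.
move=> Uz; have [E01 E0] := Hconf Uz.
have Gs := metric_sym HG (UV Uz).
have E10 := etrans (innerC ('D_(basis_vec 1) phi z) ('D_(basis_vec 0) phi z) Gs) E0.
have n01 : ((0 : 'I_2) == 1) = false by [].
have n10 : ((1 : 'I_2) == 0) = false by [].
apply/matrixP => i j; rewrite -inner_jacobian mxE.
case: (ord2 i) => ->; case: (ord2 j) => ->; rewrite ?eqxx ?n01 ?n10 ?mulr1n ?mulr0n.
- exact: (erefl (energy G phi z)).
- exact: E0.
- exact: E10.
- exact: esym E01.
Qed.

(* Differentiate the conformality relations with a metric, torsion-free
   connection. *)
Lemma mean_field_normal z (i : 'I_2) : U z ->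
  inner (G (phi z)) (mean_field G phi z) ('D_(basis_vec i) phi z) = 0.
Proof.
move=> Uz; have Vz := UV Uz; have Gs := metric_sym HG Vz.
have c01 := cov_deriv_torsion_free Uo HG Hphi UV (basis_vec 0) (basis_vec 1) Uz.
pose e (k : 'I_2) : 'rV[R]_2 := basis_vec k.
have M X (k l : 'I_2) := cov_deriv_metric Uo HG Hphi UV X Uz (Dd (e k) Uz) (Dd (e l) Uz).
have eqD X (f g : 'rV[R]_2 -> R) : (forall w, U w -> f w = g w) -> 'D_X f z = 'D_X g z.
  by move=> fg; apply: near_eq_derive; exact: near_open fg.
have D1 X : 'D_X (fun w => inner (G (phi w)) ('D_(e 0) phi w) ('D_(e 0) phi w)) z
   = 'D_X (fun w => inner (G (phi w)) ('D_(e 1) phi w) ('D_(e 1) phi w)) z.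
  by apply: eqD => w /Hconf[].
have D2 X : 'D_X (fun w => inner (G (phi w)) ('D_(e 0) phi w) ('D_(e 1) phi w)) z = 0.
  rewrite (eqD _ _ (fun=> 0)); first exact: derive_cst.
  by move=> w /Hconf[].
have [H0 H1] := conformal_algebra Gs c01
  (etrans (esym (M (e 0) 0 0)) (etrans (D1 (e 0)) (M (e 0) 1 1)))
  (etrans (esym (M (e 1) 0 0)) (etrans (D1 (e 1)) (M (e 1) 1 1)))
  (etrans (esym (M (e 0) 0 1)) (D2 (e 0))) (etrans (esym (M (e 1) 0 1)) (D2 (e 1))).
by case: (ord2 i) => ->; [exact: H0 | exact: H1].
Qed.

End Conformal.

Section OrthonormalPairs.
Context {R : realType}.

Definition orthonormal_in (g : 'M[R]_2) (X1 X2 : 'rV[R]_2) : Prop :=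
  [/\ inner g X1 X1 = 1, inner g X2 X2 = 1 & inner g X1 X2 = 0].

Definition frame_mx (X1 X2 : 'rV[R]_2) : 'M[R]_2 :=
  \matrix_(i, k) (if i == 0 then X1 0 k else X2 0 k).

Lemma frame_mx_row (X1 X2 : 'rV[R]_2) i :
  row i (frame_mx X1 X2) = if i == 0 then X1 else X2.
Proof. by apply/rowP => k; rewrite !mxE; case: ifP. Qed.

Lemma frame_gram (g : 'M[R]_2) X1 X2 : g^T = g -> orthonormal_in g X1 X2 ->
  frame_mx X1 X2 *m g *m (frame_mx X1 X2)^T = 1%:M.
Proof.
move=> gs [H1 H2 H12]; apply/matrixP => i j.
have -> : (frame_mx X1 X2 *m g *m (frame_mx X1 X2)^T) i j
  = inner g (row i (frame_mx X1 X2)) (row j (frame_mx X1 X2)).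
  by rewrite /inner tr_row -!row_mul colE mulmxA -colE !mxE.
have H21 := etrans (innerC X2 X1 gs) H12.
have n01 : ((0 : 'I_2) == 1) = false by [].
have n10 : ((1 : 'I_2) == 0) = false by [].
by rewrite !frame_mx_row mxE; case: (ord2 i) => ->; case: (ord2 j) => ->;
  rewrite ?eqxx ?n01 ?n10.
Qed.

Lemma orthonormal_unitmx (g : 'M[R]_2) X1 X2 : g^T = g -> orthonormal_in g X1 X2 ->
  g \in unitmx.
Proof.
move=> gs H; have := unitmx1 R 2; rewrite -(frame_gram gs H) !unitmx_mul.
by move=> /andP[/andP[]].
Qed.

(** Orthonormality concerns the rows of the frame matrix, the trace its columns; a right inverse of
    a square matrix is also a left inverse. *)
Lemma orthonormal_scalar (E : R) X1 X2 : orthonormal_in E%:M X1 X2 ->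
  E != 0 /\ forall k l, X1 0 k * X1 0 l + X2 0 k * X2 0 l = E^-1 * (k == l)%:R.
Proof.
move=> H; have gs : (E%:M)^T = E%:M :> 'M[R]_2 by rewrite tr_scalar_mx.
have F := frame_gram gs H; set M := frame_mx X1 X2 in F.
have E0 : E != 0.
  have := orthonormal_unitmx gs H; rewrite unitmxE det_scalar unitfE expf_eq0 /=.
  by [].
split=> // k l; rewrite -mulmxA in F; have /matrixP/(_ k l) := mulmx1C F.
rewrite mul_scalar_mx -scalemxAl !mxE => H1.
apply: (mulfI E0); rewrite mulrA mulfV // mul1r -H1; congr (_ * _).
by rewrite !big_ord_recl big_ord0 addr0 !mxE.
Qed.

End OrthonormalPairs.

Lemma bilinear_diag_rV2 {R : realType} {W : lmodType R} (B : 'rV[R]_2 -> 'rV[R]_2 -> W) X :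
  (forall c Y Y' Z, B (c *: Y + Y') Z = c *: B Y Z + B Y' Z) ->
  (forall Y Z, B Y Z = B Z Y) ->
  B X X = \sum_(k < 2) \sum_(l < 2) (X 0 k * X 0 l) *: B (basis_vec k) (basis_vec l).
Proof.
move=> Blin BC.
have B0 Z : B 0 Z = 0.
  have := Blin 1 0 0 Z; rewrite scaler0 addr0 scale1r.
  by move/eqP; rewrite -subr_eq subrr => /eqP.
have lin Y Z : B Y Z = \sum_(k < 2) Y 0 k *: B (basis_vec k) Z.
  have e1 : B (Y 0 1 *: basis_vec 1) Z = Y 0 1 *: B (basis_vec 1) Z.
    by rewrite -[Y 0 1 *: _ in LHS]addr0 Blin B0 addr0.
  rewrite {1}(rV2_decomp Y) Blin e1.
  rewrite !big_ord_recl big_ord0 addr0; congr (_ + _).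
  by rewrite (_ : lift ord0 ord0 = 1) //; exact/val_inj.
rewrite lin; apply: eq_bigr => k _.
rewrite BC lin scaler_sumr; apply: eq_bigr => l _.
by rewrite scalerA BC.
Qed.

Lemma trace_orthonormal {R : realType} {W : lmodType R} (S : 'I_2 -> 'I_2 -> W)
    (X1 X2 : 'rV[R]_2) (e : R) :
  (forall k l, X1 0 k * X1 0 l + X2 0 k * X2 0 l = e * (k == l)%:R) ->
  \sum_(k < 2) \sum_(l < 2) (X1 0 k * X1 0 l) *: S k l
  + \sum_(k < 2) \sum_(l < 2) (X2 0 k * X2 0 l) *: S k l
  = e *: (S 0 0 + S 1 1).
Proof.
move=> XE; rewrite -big_split /=.
under eq_bigr => k _.
  rewrite -big_split /=; under eq_bigr => l _ do rewrite -scalerDl XE.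
  rewrite (bigD1 k) //= eqxx mulr1 big1 ?addr0; last first.
    by move=> l lk; rewrite eq_sym (negbTE lk) mulr0 scale0r.
  over.
rewrite -scaler_sumr !big_ord_recl big_ord0 addr0.
by rewrite (_ : lift ord0 ord0 = 1) //; exact/val_inj.
Qed.

Section Trace.
Context {R : realType} {n : nat}.
Variables (V : set 'rV[R]_n) (G : 'rV[R]_n -> 'M[R]_n).
Variables (U : set 'rV[R]_2) (phi : 'rV[R]_2 -> 'rV[R]_n).
Hypotheses (HG : metric_on V G) (Uo : open U) (Hphi : class_rV 2 U phi).
Hypotheses (UV : forall z, U z -> V (phi z)).

Let phid z : U z -> differentiable phi z.
Proof. exact: class_rV_differentiable Hphi. Qed.

Lemma second_fundamental_form_linear (c : R) X X' Y z : U z ->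
  second_fundamental_form G phi (c *: X + X') Y z
  = c *: second_fundamental_form G phi X Y z + second_fundamental_form G phi X' Y z.
Proof.
move=> Uz; have Yd := class_rV_differentiable Uo (class_rV_derive Y Uo Hphi) Uz.
rewrite /second_fundamental_form -normal_partZ -normal_partD; congr normal_part.
rewrite !cov_derivE (deriveDv _ _ Yd) (deriveZv _ _ Yd).
rewrite (deriveDv _ _ (phid Uz)) (deriveZv _ _ (phid Uz)).
rewrite christoffel_form_linear scalerDr; exact: addrACA.
Qed.

Lemma second_fundamental_formC X Y z : U z ->
  second_fundamental_form G phi X Y z = second_fundamental_form G phi Y X z.
Proof.
by move=> Uz; rewrite /second_fundamental_form (cov_deriv_torsion_free Uo HG Hphi UV).
Qed.

Lemma second_fundamental_form_diag X z : U z ->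
  second_fundamental_form G phi X X z
  = \sum_(k < 2) \sum_(l < 2) (X 0 k * X 0 l) *:
      second_fundamental_form G phi (basis_vec k) (basis_vec l) z.
Proof.
move=> Uz.
apply: (bilinear_diag_rV2 (B := fun Y Z => second_fundamental_form G phi Y Z z)).
  by move=> c Y Y' Z; exact: second_fundamental_form_linear.
by move=> Y Z; exact: second_fundamental_formC.
Qed.

Hypothesis Hconf : conformal_on U G phi.

Lemma normal_part_mean_field z : U z ->
  normal_part G phi z (mean_field G phi z) = mean_field G phi z.
Proof.
move=> Uz; rewrite /normal_part (_ : _ *m _ *m (jacobian_rows phi z)^T = 0); last first.
  apply/matrixP => i j; rewrite ord1 [RHS]mxE.
  rewrite -(mean_field_normal HG Uo Hphi UV Hconf j Uz) /inner.
  rewrite [LHS]mxE [RHS]mxE; apply: eq_bigr => k _; congr (_ * _).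
  by rewrite !mxE.
by rewrite !mul0mx subr0.
Qed.

Lemma mean_curvature_conformal X1 X2 z : U z -> orthonormal_pair G phi X1 X2 z ->
  second_fundamental_form G phi X1 X1 z + second_fundamental_form G phi X2 X2 z
  = (energy G phi z)^-1 *: mean_field G phi z.
Proof.
move=> Uz; rewrite /orthonormal_pair (conformal_induced_gram HG UV Hconf Uz).
move=> /orthonormal_scalar[E0 XE].
apply: etrans (congr2 +%R (second_fundamental_form_diag X1 Uz)
  (second_fundamental_form_diag X2 Uz)) _.
apply: etrans (trace_orthonormal
  (fun k l => second_fundamental_form G phi (basis_vec k) (basis_vec l) z) XE) _.
apply: congr1; apply: etrans (esym (normal_partD _ _ _ _ _)) _.
exact: normal_part_mean_field.
Qed.

End Trace.

Lemma inner_congruence {R : realType} {m n : nat} (A : 'M[R]_(m, n)) (g : 'M[R]_n) u w :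
  inner (A *m g *m A^T) u w = inner g (u *m A) (w *m A).
Proof. by rewrite /inner trmx_mul !mulmxA. Qed.

Lemma induced_gram_sym {R : realType} {n : nat} (G : 'rV[R]_n -> 'M[R]_n) phi z :
  (G (phi z))^T = G (phi z) -> (induced_gram G phi z)^T = induced_gram G phi z.
Proof. by move=> Gs; rewrite /induced_gram !trmx_mul trmxK Gs mulmxA. Qed.

Section Invariance.
Context {R : realType} {n : nat}.
Variables (V V' : set 'rV[R]_n) (G G' : 'rV[R]_n -> 'M[R]_n) (T : 'rV[R]_n -> 'rV[R]_n).
Hypotheses (HG : metric_on V G) (HG' : metric_on V' G') (HT : class_rV 2 V T).
Hypothesis VV' : forall p, V p -> V' (T p).
Hypothesis GT : forall p, V p -> forall u w,
  inner (G p) u w = inner (G' (T p)) ('D_u T p) ('D_w T p).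
Variables (U U' : set 'rV[R]_2) (phi phi' : 'rV[R]_2 -> 'rV[R]_n) (tau : 'rV[R]_2 -> 'rV[R]_2).
Hypotheses (Uo : open U) (U'o : open U') (Hphi : class_rV 2 U phi) (Htau : class_rV 3 U' tau).
Hypotheses (UV : forall z, U z -> V (phi z)) (UU : forall z, U' z -> U (tau z)).
Hypothesis Hconf : conformal_on U G phi.
Hypothesis phi'E : forall z, U' z -> phi' z = T (phi (tau z)).

(** Conformality is known for [phi], while [phi'] is the same map in arbitrary coordinates. [tau]
    has class 3 because [class_rV_comp] asks one order more of the inner map. *)
Lemma mean_curvature_invariant X1 X2 z : U' z -> orthonormal_pair G' phi' X1 X2 z ->
  2^-1 *: (second_fundamental_form G' phi' X1 X1 z
           + second_fundamental_form G' phi' X2 X2 z)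
  = 'D_((2 * energy G phi (tau z))^-1 *: mean_field G phi (tau z)) T (phi (tau z)).
Proof.
move=> Uz ort.
pose psi := phi \o tau.
have Htau2 := class_rV_le U'o (leqnSn 2) Htau.
have Htau1 := class_rV_le U'o (leqnSn 1) Htau2.
have Hpsi : class_rV 2 U' psi := class_rV_comp U'o Uo UU Htau Hphi.
have UpV y : U' y -> V (psi y) by move=> /UU/UV.
have Uo' := metric_open HG.
have phi'E' y : U' y -> phi' y = (T \o psi) y by exact: phi'E.
have Td : differentiable T (psi z) := class_rV_differentiable Uo' HT (UpV z Uz).
have taud : differentiable tau z := class_rV_differentiable U'o Htau Uz.
have IE : induced_gram G' phi' z = induced_gram G psi z.
  rewrite -(induced_gram_target HG HT GT U'o Hpsi UpV Uz) /induced_gram.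
  rewrite (jacobian_rows_ext (near_open U'o Uz phi'E')).
  by rewrite (phi'E' z Uz).
have Gs : (G (psi z))^T = G (psi z) := metric_sym HG (UpV z Uz).
have ort' : orthonormal_in (induced_gram G psi z) X1 X2 by rewrite -IE.
(* An orthonormal pair exists only for a nondegenerate form, which gives regularity at z. *)
have iu := orthonormal_unitmx (induced_gram_sym Gs) ort'.
have ort2 : orthonormal_pair G phi ('D_X1 tau z) ('D_X2 tau z) (tau z).
  rewrite /orthonormal_pair -!(mul_jacm _ taud) -!inner_congruence.
  by rewrite -(induced_gram_source G Uo U'o Hphi Htau2 UU Uz).
have II X : second_fundamental_form G' phi' X X z
  = 'D_(second_fundamental_form G phi ('D_X tau z) ('D_X tau z) (tau z)) T (psi z).
  apply: etrans (second_fundamental_form_ext G' X X U'o Uz phi'E') _.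
  apply: etrans (second_fundamental_form_target HG HG' HT VV' GT U'o Hpsi UpV X X Uz) _.
  apply: (congr1 (fun s => 'D_s T (psi z))).
  exact: (second_fundamental_form_source Uo U'o Hphi Htau2 UU).
have mc := mean_curvature_conformal HG Uo Hphi UV Hconf (UU Uz) ort2.
rewrite (II X1) (II X2) -(deriveDv _ _ Td) -(deriveZv _ _ Td).
apply: (congr1 (fun s => 'D_s T (psi z))).
by apply: etrans (congr1 _ mc) _; rewrite scalerA invfM.
Qed.

End Invariance.

(** * Charts and transition maps *)

Section Charts.
Context {R : realType} {M : topologicalType} {n : nat}.
Implicit Types (x y : chart R M n) (W : set M).

Lemma chart_image_open x W : open W -> open (cmap x @` (cdom x `&` W)).
Proof.
move=> Wo; rewrite openE => _ [p [xp Wp] <-].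
have zi : cimg x (cmap x p) by exists p.
have cc := cinv_cont zi.
have N1 : nbhs (cmap x p) (cimg x) by apply: open_nbhs_nbhs; split=> //; exact: cimg_open.
have N2 : nbhs (cmap x p) (cinv x @^-1` W).
  by apply: cc; rewrite cmapK //; exact: open_nbhs_nbhs.
apply: filterS (filterI N1 N2) => _ [[q xq <-]] /=; rewrite cmapK // => Wq.
by exists q.
Qed.

Lemma chart_preimage_open x (Z : set 'rV[R]_n) : open Z ->
  open (cdom x `&` cmap x @^-1` Z).
Proof.
move=> Zo; rewrite openE => p [xp Zp]; apply: filterI.
  by apply: open_nbhs_nbhs; split=> //; exact: cdom_open.
by apply: (cmap_cont xp); exact: open_nbhs_nbhs.
Qed.

(** Serves to shrink a chart until f maps its domain into a given chart of the target. Transparent,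
    so that the domain and the maps of the restriction compute. *)
Definition restrict x W (Wo : open W) : chart R M n.
Proof.
refine (@Chart R M n (cdom x `&` W) (cmap x) (cinv x) _ (chart_image_open Wo) _ _ _).
- exact: openI (@cdom_open _ _ _ x) Wo.
- by move=> p [xp _]; exact: cmapK.
- by move=> p [xp _]; exact: cmap_cont.
- by move=> z [p [xp _] <-]; apply: cinv_cont; exists p.
Defined.

Lemma transitionE x y p : cdom x p -> transition x y (cmap x p) = cmap y p.
Proof. by move=> xp; rewrite /transition /= cmapK. Qed.

End Charts.

Section VectorClasses.
Context {R : realType} {m n : nat} (b : R).
Hypothesis b1 : b <= 1.
Implicit Types (U : set 'rV[R]_m) (F : 'rV[R]_m -> 'rV[R]_n).

Lemma class_on_rV_sub r U W F : open U -> open W -> W `<=` U ->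
  class_on r b U F -> class_on r b W F.
Proof.
move=> Uo Wo WU /(class_on_rVP b r F Uo) H; apply/(class_on_rVP b r F Wo) => j.
exact: (class_on_sub Uo Wo WU (H j)).
Qed.

Lemma class_on_rV_ext r U F F' : open U -> (forall z, U z -> F z = F' z) ->
  class_on r b U F -> class_on r b U F'.
Proof.
move=> Uo E /(class_on_rVP b r F Uo) H; apply/(class_on_rVP b r F' Uo) => j.
by apply: class_on_ext (H j) => // z Uz; rewrite E.
Qed.

Lemma class_on_rV_local r U F : open U ->
  (forall a, U a -> exists2 W, open W /\ W a & class_on r b W F) -> class_on r b U F.
Proof.
move=> Uo H; apply/(class_on_rVP b r F Uo) => j; apply: class_on_local => a /H[W [Wo Wa]].
by move=> /(class_on_rVP b r F Wo) WF; exists W.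
Qed.

Lemma class_on_rV_fin r k U F : open U -> class_on (shift_class r k) b U F ->
  class_rV k U F.
Proof.
move=> Uo /(class_on_rVP b _ F Uo) H j; exact: (class_on_fin b1 Uo (H j)).
Qed.

Lemma class_on_rV_le r k l U F : open U -> (k <= l)%N ->
  class_on (shift_class r l) b U F -> class_on (shift_class r k) b U F.
Proof.
move=> Uo kl /(class_on_rVP b _ F Uo) H; apply/(class_on_rVP b _ F Uo) => j.
exact: (class_on_le b1 Uo kl (H j)).
Qed.

Lemma class_on_rV_structure r k U F : open U -> class_on (structure_class r) 0 U F ->
  class_on (shift_class r k) b U F.
Proof.
move=> Uo /(class_on_rVP 0 _ F Uo) H; apply/(class_on_rVP b _ F Uo) => j.
exact: (class_on_structure b1 k Uo (H j)).
Qed.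

End VectorClasses.

Lemma class_on_rV_comp {R : realType} {p m n : nat} (b : R) r (U : set 'rV[R]_p)
    (V : set 'rV[R]_m) (F : 'rV[R]_m -> 'rV[R]_n) (phi : 'rV[R]_p -> 'rV[R]_m) : b <= 1 ->
  open U -> open V -> (forall x, U x -> V (phi x)) -> class_on r b V F ->
  class_on (shift_class r 1) b U phi -> class_on r b U (F \o phi).
Proof.
move=> b1 Uo Vo UV /(class_on_rVP b _ F Vo) HF /(class_on_rVP b _ phi Uo) Hp.
apply/(class_on_rVP b _ _ Uo) => j; exact: (class_on_comp b1 Uo Vo UV (HF j) Hp).
Qed.

Section Transitions.
Context {R : realType} {n : nat} {r : diff_class}.
Let q := structure_class r.

Lemma holomorphic_class (U : set 'rV[R]_2) T : open U -> holomorphic_on U T ->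
  of_class q U T.
Proof.
move=> Uo [/analytic_mxP aT _]; apply/(class_on_rVP 0 _ T Uo) => j.
have [gs _] := analytic_gevrey (aT 0 j).
by rewrite /q; case: (r) => [k||] //=; exact: aT.
Qed.

Lemma complex_chart_restrict (M : riemann_surface R) (x : chart R M 2) W (Wo : open W) :
  complex_chart x -> complex_chart (restrict x Wo).
Proof.
move=> Hx a aa; have [[H1 C1] [H2 C2]] := Hx a aa.
split; split.
- by move=> _ [p [ap [xp _]] <-]; apply: H1; exists p.
- by move=> _ [p [ap [xp _]] <-]; apply: C1; exists p.
- by move=> _ [p [ap [xp _]] <-]; apply: H2; exists p.
- by move=> _ [p [ap [xp _]] <-]; apply: C2; exists p.
Qed.

Lemma complex_chart_coord (M : riemann_surface R) (x : chart R M 2) :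
  complex_chart x -> coordinate_system (@of_class R q 2) x.
Proof.
move=> Hx a aa; have [H1 H2] := Hx a aa; split; apply: holomorphic_class => //.
  by apply: chart_image_open; exact: cdom_open.
by rewrite setIC; apply: chart_image_open; exact: cdom_open.
Qed.

Lemma atlas_coordinate_system (P : transition_class n) (N : manifold P) (y : chart R N n) :
  atlas y -> coordinate_system P y.
Proof. by move=> ya a aa; exact: atlas_compatible. Qed.

(** Coordinate systems are by definition compatible with the atlas, not with each other; near each
    point the transition factors through an atlas chart. The structure class is unchanged by a
    shift, so this composition costs no order. *)
Lemma transition_of_class (P : transition_class n) (N : manifold P) (x y : chart R N n) :
  coordinate_system (@of_class R q n) x -> coordinate_system (@of_class R q n) y ->
  of_class q (cmap x @` (cdom x `&` cdom y)) (transition x y).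
Proof.
move=> Hx Hy.
have Uo : open (cmap x @` (cdom x `&` cdom y)).
  by apply: chart_image_open; exact: cdom_open.
apply: (class_on_rV_local Uo) => _ [p [xp yp] <-].
have [a aa ap] := atlas_cover p.
have Wo : open (cmap x @` (cdom x `&` (cdom y `&` cdom a))).
  by apply: chart_image_open; apply: openI; exact: cdom_open.
exists (cmap x @` (cdom x `&` (cdom y `&` cdom a))); first by split=> //; exists p.
have [_ xa] := Hx a aa; have [ay _] := Hy a aa.
have Vo : open (cmap a @` (cdom a `&` cdom y)).
  by apply: chart_image_open; exact: cdom_open.
have xaW : class_on (shift_class q 1) 0 (cmap x @` (cdom x `&` (cdom y `&` cdom a))) (transition x a).
  rewrite /q shift_structure_class; apply: class_on_rV_sub xa => //.
    by rewrite setIC; apply: chart_image_open; exact: cdom_open.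
  by move=> _ [p' [xp' [yp' ap']] <-]; exists p'.
have UV z : (cmap x @` (cdom x `&` (cdom y `&` cdom a))) z ->
    (cmap a @` (cdom a `&` cdom y)) (transition x a z).
  by move=> [p' [xp' [yp' ap']] <-]; rewrite transitionE //; exists p'.
apply: class_on_rV_ext (class_on_rV_comp ler01 Wo Vo UV ay xaW) => //.
move=> _ [p' [xp' [yp' ap']] <-] /=.
by rewrite !transitionE.
Qed.

End Transitions.

(** * The conformal formula in pairs of charts *)

Section Surface.
Context {R : realType} {n : nat} {r : diff_class} {b : R}.
Context {M : riemann_surface R} {N : real_manifold R (structure_class r) n.+2}.
Variables (g : riemannian_metric N) (f : M -> N).
Hypotheses (b1 : b <= 1) (Hg : metric_class (shift_class r 1) b g).
Hypotheses (Hf : map_class (shift_class r 2) b f) (Hconf : conformal g f).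

Definition conformal_pair (x : chart R M 2) (y : chart R N n.+2) : Prop :=
  [/\ complex_chart x, coordN y & f @` cdom x `<=` cdom y].

Definition pair_energy (x : chart R M 2) (y : chart R N n.+2) : 'rV[R]_2 -> R :=
  energy (gram g y) (local_rep f x y).

Definition pair_mean_curvature (x : chart R M 2) (y : chart R N n.+2)
    (z : 'rV[R]_2) : 'rV[R]_n.+2 :=
  (2 * pair_energy x y z)^-1 *: mean_field (gram g y) (local_rep f x y) z.

Lemma conformal_pair_chart x y : conformal_pair x y ->
  @chart_pair R (structure_class r) n M N f x y.
Proof. by move=> [Hx Hy xy]; split=> //; exact: complex_chart_coord. Qed.

Lemma f_continuous : continuous f. Proof. by case: Hf. Qed.

Lemma preimage_open (W : set N) : open W -> open (f @^-1` W).
Proof. by move=> Wo; apply: open_comp => // p _; exact: f_continuous. Qed.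

Lemma conformal_pair_exists p (y : chart R N n.+2) : coordN y -> cdom y (f p) ->
  exists2 x, conformal_pair x y & cdom x p.
Proof.
move=> Hy yp; have [a aa ap] := atlas_cover p.
pose Wo := preimage_open (@cdom_open _ _ _ y).
exists (restrict a Wo); last by split.
split=> //; first by apply: complex_chart_restrict; exact: (atlas_coordinate_system aa).
by move=> _ [q [_ yq] <-].
Qed.

Lemma metric_on_chart y : coordN y -> metric_on (cimg y) (gram g y).
Proof.
move=> Hy; have yo : open (cimg y) := @cimg_open _ _ _ y.
split=> //; [|exact: gram_sym|exact: gram_pos].
move=> p yp; apply: differentiable_mx => i j.
have /(class_on_mxP _ _ _ yo)/(_ i j) H := Hg Hy.
exact: class_fin_differentiable yo yp (class_on_fin b1 yo H).
Qed.

Lemma metric_on_sub (V W : set 'rV[R]_n.+2) G : open W -> W `<=` V ->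
  metric_on V G -> metric_on W G.
Proof.
by move=> Wo WV [Vo d s p]; split=> // q /WV; [exact: d | exact: s | exact: p].
Qed.

Lemma local_rep_class x y : chart_pair f x y ->
  class_on (shift_class r 2) b (cimg x) (local_rep f x y).
Proof. by case: Hf => _; apply. Qed.

Lemma local_rep_C2 x y : chart_pair f x y -> class_rV 2 (cimg x) (local_rep f x y).
Proof.
by move=> H; apply: class_on_rV_fin (local_rep_class H) => //; exact: cimg_open.
Qed.

Lemma local_rep_img x y (z : 'rV[R]_2) : f @` cdom x `<=` cdom y -> cimg x z ->
  cimg y (local_rep f x y z).
Proof.
move=> xy [p xp <-]; rewrite /local_rep /= cmapK //.
by exists (f p) => //; apply: xy; exists p.
Qed.

Lemma pair_conformal_on x y : conformal_pair x y ->
  conformal_on (cimg x) (gram g y) (local_rep f x y).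
Proof. by move=> [Hx Hy xy] z xz; exact: (Hconf Hx Hy xy xz). Qed.

Lemma pair_mean_curvatureP x y x' y' p X1 X2 :
  conformal_pair x y -> cdom x p -> chart_pair_at f p x' y' ->
  orthonormal_pair (gram g y') (local_rep f x' y') X1 X2 (cmap x' p) ->
  2^-1 *: (second_fundamental_form (gram g y') (local_rep f x' y') X1 X1 (cmap x' p)
    + second_fundamental_form (gram g y') (local_rep f x' y') X2 X2 (cmap x' p))
  = 'D_(pair_mean_curvature x y (cmap x p)) (transition y y') (cmap y (f p)).
Proof.
move=> Hxy xp [Hxy' x'p] ort.
have [Hx Hy xy] := Hxy; have [Hx' Hy' xy'] := Hxy'.
have xo : open (cimg x) := @cimg_open _ _ _ x.
pose V := cmap y @` (cdom y `&` cdom y').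
pose U := cmap x @` (cdom x `&` cdom x').
pose U' := cmap x' @` (cdom x' `&` cdom x).
have Vo : open V by apply: chart_image_open; exact: cdom_open.
have Uo : open U by apply: chart_image_open; exact: cdom_open.
have U'o : open U' by apply: chart_image_open; exact: cdom_open.
have VV : V `<=` cimg y by move=> _ [q [yq _] <-]; exists q.
have UU0 : U `<=` cimg x by move=> _ [q [xq _] <-]; exists q.
have HG := metric_on_sub Vo VV (metric_on_chart Hy).
have HG' := metric_on_chart Hy'.
have T2 : class_rV 2 V (transition y y').
  apply: (@class_on_rV_fin _ _ _ 0 ler01 (structure_class r)) => //.
  by rewrite shift_structure_class; exact: transition_of_class.
have tau3 : class_rV 3 U' (transition x' x).
  apply: (@class_on_rV_fin _ _ _ 0 ler01 (structure_class r)) => //.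
  rewrite shift_structure_class; apply: transition_of_class => //.
  exact: complex_chart_coord.
have VV' q : V q -> cimg y' (transition y y' q).
  by move=> [t [yt yt'] <-]; rewrite transitionE //; exists t.
have GT q : V q -> forall u w, inner (gram g y q) u w
  = inner (gram g y' (transition y y' q)) ('D_u (transition y y') q) ('D_w (transition y y') q).
  by move=> [t [yt yt'] <-] u w; rewrite transitionE //; exact: gram_change.
have phi2 : class_rV 2 U (local_rep f x y).
  by move=> j; apply: class_fin_sub UU0 (local_rep_C2 (conformal_pair_chart Hxy) j).
have UV z : U z -> V (local_rep f x y z).
  move=> [t [xt xt'] <-]; rewrite /local_rep /= cmapK //.
  by exists (f t) => //; split; [apply: xy; exists t | apply: xy'; exists t].
have UU z : U' z -> U (transition x' x z).
  by move=> [t [xt' xt] <-]; rewrite transitionE //; exists t.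
have cU : conformal_on U (gram g y) (local_rep f x y).
  by move=> z /UU0; exact: pair_conformal_on.
have phi'E z : U' z -> local_rep f x' y' z
    = transition y y' (local_rep f x y (transition x' x z)).
  move=> [t [xt' xt] <-]; rewrite transitionE // /local_rep /= !cmapK // transitionE //.
  by apply: xy; exists t.
have U'p : U' (cmap x' p) by exists p.
have xE : transition x' x (cmap x' p) = cmap x p by exact: transitionE.
have fE : local_rep f x y (cmap x p) = cmap y (f p) by rewrite /local_rep /= cmapK.
have := mean_curvature_invariant HG HG' T2 VV' GT Uo U'o phi2 tau3 UV UU cU phi'E U'p ort.
by rewrite xE fE.
Qed.

Lemma pair_energy_gt0 x y p : conformal_pair x y -> cdom x p ->
  pair_energy x y (cmap x p) != 0 -> 0 < pair_energy x y (cmap x p).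
Proof.
move=> [Hx Hy xy] xp E0.
have Vp : cimg y (local_rep f x y (cmap x p)) by apply: local_rep_img => //; exists p.
apply: (metric_pos (metric_on_chart Hy) Vp).
by apply/eqP => D0; move/eqP: E0; apply; rewrite /pair_energy /energy D0 /inner !mul0mx mxE.
Qed.

End Surface.

Lemma inner_basis {R : realType} {n : nat} (A : 'M[R]_n) i j :
  inner A (basis_vec i) (basis_vec j) = A i j.
Proof. by rewrite /inner !trmx_delta -!rowE -!colE !mxE. Qed.

Lemma orthonormal_scaled_basis {R : realType} (E : R) : 0 < E ->
  orthonormal_in (E%:M) ((Num.sqrt E)^-1 *: basis_vec 0) ((Num.sqrt E)^-1 *: basis_vec 1).
Proof.
move=> E0; have sE : (Num.sqrt E)^-1 * ((Num.sqrt E)^-1 * E) = 1.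
  by rewrite mulrA -invfM -expr2 sqr_sqrtr ?ltW // mulVf // gt_eqF.
by split; rewrite innerZl innerZr inner_basis !mxE /= ?mulr1n ?mulr0n ?mulr0.
Qed.

Section Agreement.
Context {R : realType} {n : nat} {r : diff_class} {b : R}.
Context {M : riemann_surface R} {N : real_manifold R (structure_class r) n.+2}.
Variables (g : riemannian_metric N) (f : M -> N).
Hypotheses (b1 : b <= 1) (Hg : metric_class (shift_class r 1) b g).
Hypotheses (Hf : map_class (shift_class r 2) b f) (Hconf : conformal g f).

Notation pair := (@conformal_pair R n r M N f).

(** The energy is the squared length of the image of a tangent vector that depends on [x] alone. *)
Lemma pair_energy_change x y y' p : pair x y -> pair x y' -> cdom x p ->
  pair_energy g f x y' (cmap x p) = pair_energy g f x y (cmap x p).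
Proof.
move=> [Hx Hy xy] [_ Hy' xy'] xp.
pose V := cmap y @` (cdom y `&` cdom y').
have Vo : open V by apply: chart_image_open; exact: cdom_open.
have xo : open (cimg x) := @cimg_open _ _ _ x.
have UV z : cimg x z -> V (local_rep f x y z).
  move=> [t xt <-]; rewrite /local_rep /= cmapK //.
  by exists (f t) => //; split; [apply: xy; exists t | apply: xy'; exists t].
have T1 : class_rV 1 V (transition y y').
  apply: (@class_on_rV_fin _ _ _ 0 ler01 (structure_class r)) => //.
  by rewrite shift_structure_class; exact: transition_of_class.
have H : chart_pair f x y by split=> //; exact: complex_chart_coord.
have phi1 : class_rV 1 (cimg x) (local_rep f x y).
  exact: class_rV_le xo (leqnSn 1) (local_rep_C2 b1 Hf H).
have zx : cimg x (cmap x p) by exists p.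
have fE z : cimg x z -> local_rep f x y' z = (transition y y' \o local_rep f x y) z.
  move=> [t xt <-]; rewrite /local_rep /= cmapK // transitionE //.
  by apply: xy; exists t.
have DE : 'D_(basis_vec 0) (local_rep f x y') (cmap x p)
    = 'D_('D_(basis_vec 0) (local_rep f x y) (cmap x p)) (transition y y') (local_rep f x y (cmap x p)).
  apply: etrans (near_eq_derive _ (near_open xo zx fE)) _.
  exact: (derive_comp xo Vo UV _ phi1 T1 zx).
have fpE : local_rep f x y (cmap x p) = cmap y (f p) by rewrite /local_rep /= cmapK.
have fpE' : local_rep f x y' (cmap x p) = cmap y' (f p) by rewrite /local_rep /= cmapK.
rewrite /pair_energy /energy DE fpE fpE'; apply: esym.
by apply: gram_change => //; [apply: xy | apply: xy']; exists p.
Qed.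

(** Both sides equal the mean curvature computed in a third pair, [y] with [x1] restricted to the
    preimage of its domain. The energy there is positive, so a rescaled coordinate basis provides
    the orthonormal pair needed for the comparison. *)
Lemma pair_mean_curvature_agree x1 y1 x2 y2 y p : pair x1 y1 -> pair x2 y2 ->
  cdom x1 p -> cdom x2 p -> coordN y -> cdom y (f p) ->
  pair_energy g f x1 y1 (cmap x1 p) != 0 ->
  'D_(pair_mean_curvature g f x1 y1 (cmap x1 p)) (transition y1 y) (cmap y1 (f p))
  = 'D_(pair_mean_curvature g f x2 y2 (cmap x2 p)) (transition y2 y) (cmap y2 (f p)).
Proof.
move=> H1 H2 x1p x2p Hy yp E0.
pose Wo := preimage_open Hf (@cdom_open _ _ _ y).
pose x' := restrict x1 Wo.
have [Hx1 Hy1 xy1] := H1.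
have x'p : cdom x' p by split.
have Hx' : complex_chart x' by exact: complex_chart_restrict.
have P' : pair x' y by split=> // _ [q [_ yq] <-].
have P1 : pair x' y1 by split=> // _ [q [xq _] <-]; apply: xy1; exists q.
have CP : chart_pair_at f p x' y.
  by split=> //; split=> //; [exact: complex_chart_coord | case: P'].
have E' : 0 < pair_energy g f x' y (cmap x' p).
  apply: (pair_energy_gt0 b1 Hg P' x'p).
  by rewrite (pair_energy_change P1 P' x'p).
have o := orthonormal_scaled_basis E'.
rewrite /pair_energy -(conformal_induced_gram (metric_on_chart b1 Hg Hy) _ (pair_conformal_on Hconf P')) in o.
- apply: etrans (esym (pair_mean_curvatureP b1 Hg Hf Hconf H1 x1p CP o)) _.
  exact: (pair_mean_curvatureP b1 Hg Hf Hconf H2 x2p CP o).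
- by move=> z; apply: local_rep_img; case: P'.
- by exists p.
Qed.

Lemma regular_pair_energy x y p : pair x y -> cdom x p -> regular_point f p ->
  pair_energy g f x y (cmap x p) != 0.
Proof.
move=> P xp reg; have [Hx Hy xy] := P.
have H := conformal_pair_chart P.
have inj := reg x y (conj H xp).
have zx : cimg x (cmap x p) by exists p.
have Vp := local_rep_img xy zx.
have fd : differentiable (local_rep f x y) (cmap x p).
  exact: class_rV_differentiable (@cimg_open _ _ _ x) (local_rep_C2 b1 Hf H) zx.
apply/eqP => /(posdef_inner_eq0 (metric_pos (metric_on_chart b1 Hg Hy) Vp)).
rewrite deriveE // => D0.
have : basis_vec 0 = 0 :> 'rV[R]_2 by apply: inj; rewrite D0 linear0.
move=> /rowP/(_ 0); rewrite !mxE /= => /eqP.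
by rewrite oner_eq0.
Qed.

End Agreement.

(** * Regularity away from the branch points *)

Section SecondDerivatives.
Context {R : realType} {n : nat}.
Variables (U : set 'rV[R]_2) (phi : 'rV[R]_2 -> 'rV[R]_n).
Hypotheses (Uo : open U) (phi2 : class_rV 2 U phi).

Lemma derive_phi_coord i z j : U z -> ('D_(basis_vec i) phi z) 0 j = pd i (fun z => phi z 0 j) z.
Proof.
by move=> Uz; rewrite derive_coord //; exact: class_rV_differentiable Uo phi2 Uz.
Qed.

Lemma derive2_phi_coord i z j : U z ->
  ('D_(basis_vec i) (fun w => 'D_(basis_vec i) phi w) z) 0 j = pd i (pd i (fun z => phi z 0 j)) z.
Proof.
move=> Uz; have dd := class_rV_differentiable Uo (class_rV_derive (basis_vec i) Uo phi2) Uz.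
apply: etrans (derive_coord _ _ dd) _.
apply: near_eq_derive; apply: (near_open Uo Uz) => w Uw; exact: derive_phi_coord.
Qed.

End SecondDerivatives.

Section ClassMetric.
Context {R : realType} {n : nat} {r : diff_class} {b : R}.
Hypothesis b1 : b <= 1.
Variables (V : set 'rV[R]_n) (G : 'rV[R]_n -> 'M[R]_n).
Hypotheses (HG : metric_on V G) (Gr : class_on (shift_class r 1) b V G).

Let Vo := metric_open HG.

Lemma class_gram i j : class_on (shift_class r 1) b V (fun p => G p i j).
Proof. exact: (class_on_mxP b _ G Vo).1. Qed.

Lemma class_christoffel k a c : class_on r b V (fun p => christoffel G p k a c).
Proof.
apply: (class_on_mul b1 Vo (class_on_cst b r 2^-1 Vo)).
apply: class_on_sum Vo _ => l; apply: class_on_mul => //.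
  apply: class_on_invmx => // [i j|p Vp]; first exact: class_on_le1 (class_gram i j).
  exact: metric_on_unitmx HG Vp.
apply: class_on_add Vo _ _; last apply: class_on_opp => //.
  by apply: class_on_add Vo _ _; apply: class_on_pd => //; exact: class_gram.
by apply: class_on_pd => //; exact: class_gram.
Qed.

Variables (U : set 'rV[R]_2) (phi : 'rV[R]_2 -> 'rV[R]_n).
Hypotheses (Uo : open U) (UV : forall z, U z -> V (phi z)).
Hypothesis Hphi : class_on (shift_class r 2) b U phi.

Lemma class_phi j : class_on (shift_class r 2) b U (fun z => phi z 0 j).
Proof. exact: (class_on_rVP b _ phi Uo).1. Qed.

Lemma class_phi1 j : class_on (shift_class r 1) b U (fun z => phi z 0 j).
Proof. exact: (class_on_le b1 Uo (leqnSn 1) (class_phi j)). Qed.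

Lemma class_gram_comp i j : class_on r b U (fun z => G (phi z) i j).
Proof.
exact: (class_on_comp b1 Uo Vo UV (class_on_le1 b1 Vo (class_gram i j)) class_phi1).
Qed.

Lemma class_christoffel_comp k a c : class_on r b U (fun z => christoffel G (phi z) k a c).
Proof. exact: (class_on_comp b1 Uo Vo UV (class_christoffel k a c) class_phi1). Qed.

Lemma class_inner (u w : 'rV[R]_2 -> 'rV[R]_n) :
  (forall j, class_on r b U (fun z => u z 0 j)) ->
  (forall j, class_on r b U (fun z => w z 0 j)) ->
  class_on r b U (fun z => inner (G (phi z)) (u z) (w z)).
Proof.
move=> Hu Hw; have S : class_on r b U (fun z => \sum_i \sum_j u z 0 i * G (phi z) i j * w z 0 j).
  apply: class_on_sum Uo _ => i; apply: class_on_sum Uo _ => j.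
  by apply: class_on_mul => //; apply: class_on_mul => //; exact: class_gram_comp.
by apply: class_on_ext S => // z _; rewrite innerE.
Qed.

Lemma class_christoffel_form (u w : 'rV[R]_2 -> 'rV[R]_n) k :
  (forall j, class_on r b U (fun z => u z 0 j)) ->
  (forall j, class_on r b U (fun z => w z 0 j)) ->
  class_on r b U (fun z => christoffel_form G (phi z) (u z) (w z) 0 k).
Proof.
move=> Hu Hw; have S : class_on r b U (fun z => \sum_a \sum_c christoffel G (phi z) k a c * u z 0 a * w z 0 c).
  apply: class_on_sum Uo _ => a; apply: class_on_sum Uo _ => c.
  by apply: class_on_mul => //; apply: class_on_mul => //; exact: class_christoffel_comp.
by apply: class_on_ext S => // z _; rewrite mxE.
Qed.

Let phi2 : class_rV 2 U phi := class_on_rV_fin b1 Uo Hphi.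

Lemma class_derive_phi i j : class_on r b U (fun z => ('D_(basis_vec i) phi z) 0 j).
Proof.
have S : class_on r b U (pd i (fun z => phi z 0 j)).
  by apply: class_on_pd => //; exact: class_phi1.
by apply: class_on_ext S => // z Uz; rewrite (derive_phi_coord Uo phi2).
Qed.

Lemma class_derive2_phi i j :
  class_on r b U (fun z => ('D_(basis_vec i) (fun w => 'D_(basis_vec i) phi w) z) 0 j).
Proof.
have S : class_on r b U (pd i (pd i (fun z => phi z 0 j))).
  apply: class_on_pd => //; apply: class_on_pd => //; rewrite shift_class_add.
  exact: class_phi.
by apply: class_on_ext S => // z Uz; rewrite (derive2_phi_coord Uo phi2).
Qed.

Lemma class_energy : class_on r b U (energy G phi).
Proof. by apply: class_inner => j; exact: class_derive_phi. Qed.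

Lemma class_mean_field k : class_on r b U (fun z => mean_field G phi z 0 k).
Proof.
have S : class_on r b U (fun z =>
   (('D_(basis_vec 0) (fun w => 'D_(basis_vec 0) phi w) z) 0 k
    + christoffel_form G (phi z) ('D_(basis_vec 0) phi z) ('D_(basis_vec 0) phi z) 0 k)
   + (('D_(basis_vec 1) (fun w => 'D_(basis_vec 1) phi w) z) 0 k
    + christoffel_form G (phi z) ('D_(basis_vec 1) phi z) ('D_(basis_vec 1) phi z) 0 k)).
  apply: class_on_add Uo _ _; apply: class_on_add Uo _ _;
    try exact: class_derive2_phi; apply: class_christoffel_form => j; exact: class_derive_phi.
apply: class_on_ext S => // z _.
by rewrite /mean_field !cov_derivE; rewrite [RHS]mxE; congr (_ + _); rewrite [RHS]mxE.
Qed.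

End ClassMetric.

Section OpenNonvanishing.
Context {R : realType} {T : topologicalType}.

Lemma open_neq0 (U : set T) (f : T -> R) : open U ->
  (forall a, U a -> {for a, continuous f}) -> open (U `&` [set z | f z != 0]).
Proof.
move=> Uo fc; rewrite openE => a [Ua fa]; apply: filterI; first exact: open_nbhs_nbhs.
have e0 : 0 < `|f a| by rewrite normr_gt0.
have : \forall z \near a, `|f a - f z| < `|f a| by exact: (iffLR (cvgrPdist_lt _ _) (fc a Ua) _ e0).
apply: filterS => z; apply: contraTneq => ->.
by rewrite subr0 ltxx.
Qed.

End OpenNonvanishing.

Local Open Scope complex_scope.

(** * The extension across a branch point *)

(** The trace of B on the pair (a, e) after a multiple of an orthogonal transformation. It models
    the multiplication of d by (s + 1) z^s and is applied both to the metric and to the components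
    of the Christoffel form, which therefore acquire the same factor. *)
Lemma bilinear_rotation {R : realType} {V : lmodType R} (B : V -> V -> R) (p q : R) (a e : V) :
  (forall c u u' w, B (c *: u + u') w = c * B u w + B u' w) ->
  (forall u w, B u w = B w u) ->
  B (p *: a + q *: e) (p *: a + q *: e) + B (q *: a + (- p) *: e) (q *: a + (- p) *: e)
  = (p ^+ 2 + q ^+ 2) * (B a a + B e e).
Proof.
move=> Bl Bs; have B0 w : B 0 w = 0.
  by have := Bl 1 0 0 w; rewrite scaler0 addr0 mul1r => /eqP; rewrite -subr_eq subrr => /eqP.
have BZ c u w : B (c *: u) w = c * B u w by rewrite -[c *: u]addr0 Bl B0 addr0.
have E c c' : B (c *: a + c' *: e) (c *: a + c' *: e)
    = c * (c * B a a + c' * B e a) + c' * (c * B e a + c' * B e e).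
  by rewrite Bl BZ (Bs a) (Bs e (_ + _)) !Bl !BZ (Bs a e).
by rewrite !E; ring.
Qed.

Section Wirtinger.
Context {R : realType} {n : nat}.
Implicit Types (phi : 'rV[R]_2 -> 'rV[R]_n) (z : 'rV[R]_2).

Lemma dz_complexify phi z j :
  dz_vec (fun w => complexify (phi w)) z 0 j
  = (2^-1 * pd 0 (fun w => phi w 0 j) z) +i* (- (2^-1 * pd 1 (fun w => phi w 0 j) z)).
Proof.
have FE : (fun w => complexify (phi w) 0 j) = (fun w => (phi w 0 j)%:C).
  by apply/funext => w; rewrite mxE.
rewrite mxE FE.
rewrite /dz /partialC /= !derive_cst.
move: ('D_(basis_vec 0) _ z) ('D_(basis_vec 1) _ z) => p0 p1.
have -> : 2^-1 = (2^-1)%:C :> R[i] by rewrite rmorphV ?unitfE ?pnatr_eq0 // rmorph_nat.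
apply/eqP; rewrite eq_complex; apply/andP; split; apply/eqP => /=; ring.
Qed.

End Wirtinger.

(** The modulus is an element of [R[i]] with zero imaginary part; [complex.Re] brings the factor
    back to [R]. *)
Lemma wirtinger_factor_norm {R : realType} (s : nat) (z : 'rV[R]_2) :
  let c := s.+1%:R * toC z ^+ s in
  complex.Re c ^+ 2 + complex.Im c ^+ 2
  = s.+1%:R ^+ 2 * complex.Re (`|toC z| ^+ (2 * s)).
Proof.
move=> c; have : (complex.Re c ^+ 2 + complex.Im c ^+ 2)%:C
    = (s.+1%:R ^+ 2 : R)%:C * `|toC z| ^+ (2 * s).
  rewrite add_Re2_Im2 /c normrM normrX normr_nat exprMn -exprM mulnC.
  by rewrite rmorphXn rmorph_nat.
have -> : `|toC z| ^+ (2 * s) = (complex.Re (`|toC z| ^+ (2 * s)))%:C.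
  by rewrite normc_def -rmorphXn.
by rewrite -rmorphM => /complexI.
Qed.

Section BranchChart.
Context {R : realType} {n : nat}.
Variables (V : set 'rV[R]_n) (G : 'rV[R]_n -> 'M[R]_n).
Variables (U : set 'rV[R]_2) (phi : 'rV[R]_2 -> 'rV[R]_n).
Hypotheses (HG : metric_on V G) (Uo : open U) (Hphi : class_rV 2 U phi).
Hypotheses (UV : forall z, U z -> V (phi z)) (Hconf : conformal_on U G phi).
Variables (s : nat) (d : 'rV[R]_2 -> 'rV[R[i]]_n) (l : 'rV[R]_2 -> 'rV[R]_n).
Let fh z := complexify (phi z).
Hypothesis Hd : forall z, U z -> dz_vec fh z = (s.+1%:R * toC z ^+ s) *: d z.
Hypothesis Hl : forall z, U z ->
  dzbar_vec (dz_vec fh) z = `|toC z| ^+ (2 * s) *: complexify (l z).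

Let c z : R[i] := s.+1%:R * toC z ^+ s.
Let rho z : R := complex.Re (`|toC z| ^+ (2 * s)).
Let Rd z : 'rV[R]_n := map_mx (@complex.Re R) (d z).
Let Id z : 'rV[R]_n := map_mx (@complex.Im R) (d z).

Let phid z : U z -> differentiable phi z.
Proof. exact: class_rV_differentiable. Qed.

(** For real phi_j the two partial derivatives are 2 Re and -2 Im of its z-derivative, which is c
    d_j. *)
Lemma dz_coord z j : U z ->
  pd 0 (fun w => phi w 0 j) z
    = 2 * complex.Re (c z) * Rd z 0 j + - (2 * complex.Im (c z)) * Id z 0 j
  /\ pd 1 (fun w => phi w 0 j) z
    = - (2 * complex.Im (c z)) * Rd z 0 j + - (2 * complex.Re (c z)) * Id z 0 j.
Proof.
move=> Uz; have := congr1 (fun A : 'rV[R[i]]_n => A 0 j) (Hd Uz).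
rewrite dz_complexify !mxE -/(c z); case: (c z) => u v; case: (d z 0 j) => a e.
move: (pd 0 _ z) (pd 1 _ z) => p0 p1 /eqP; rewrite eq_complex => /andP[/eqP /= H0 /eqP /= H1].
by split; lra.
Qed.

Lemma dz_derive z : U z ->
  'D_(basis_vec 0) phi z
    = (2 * complex.Re (c z)) *: Rd z + (- (2 * complex.Im (c z))) *: Id z
  /\ 'D_(basis_vec 1) phi z
    = (- (2 * complex.Im (c z))) *: Rd z + (- (2 * complex.Re (c z))) *: Id z.
Proof.
move=> Uz; split; apply/rowP => j; rewrite derive_coord; try exact: phid.
  by rewrite (dz_coord j Uz).1 [RHS]mxE [X in _ = X + _]mxE [X in _ = _ + X]mxE.
by rewrite (dz_coord j Uz).2 [RHS]mxE [X in _ = X + _]mxE [X in _ = _ + X]mxE.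
Qed.

Lemma laplacian_coord z j : U z ->
  pd 0 (pd 0 (fun w => phi w 0 j)) z + pd 1 (pd 1 (fun w => phi w 0 j)) z
  = 4 * rho z * l z 0 j.
Proof.
move=> Uz; have := congr1 (fun A : 'rV[R[i]]_n => A 0 j) (Hl Uz).
have E0 : (fun w => complex.Re (dz_vec fh w 0 j)) = 2^-1 *: pd 0 (fun w => phi w 0 j).
  by apply/funext => w; rewrite dz_complexify.
have E1 : (fun w => complex.Im (dz_vec fh w 0 j)) = (- 2^-1) *: pd 1 (fun w => phi w 0 j).
  by apply/funext => w; rewrite dz_complexify /= -mulNr.
have [d0 d1] : derivable (pd 0 (fun w => phi w 0 j)) z (basis_vec 0)
   /\ derivable (pd 1 (fun w => phi w 0 j)) z (basis_vec 1).
  have [_ H] := Hphi j.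
  by split; [have [_ [_ H0]] := H 0; have [D _] := H0 0
            | have [_ [_ H0]] := H 1; have [D _] := H0 1]; exact: D.
rewrite [LHS]mxE [RHS]mxE [X in _ = _ * X]mxE /dzbar /partialC E0 E1.
rewrite (deriveZ _ d0) (deriveZ _ d1).
have -> : `|toC z| ^+ (2 * s) = (rho z)%:C by rewrite /rho normc_def -rmorphXn.
have -> : 2^-1 = (2^-1)%:C :> R[i] by rewrite rmorphV ?unitfE ?pnatr_eq0 // rmorph_nat.
move: ('D__ _ z) ('D__ _ z) ('D__ _ z) ('D__ _ z) => p0 p1 p2 p3 /eqP.
(* The real part is the identity for the Laplacian; the imaginary part, dropped here, expresses the
   equality of mixed partial derivatives. *)
rewrite eq_complex => /andP[/eqP /= H0 _].
by rewrite /GRing.scale /= in H0; lra.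
Qed.

(* [Rd] and [Id] are the real and imaginary parts of d: the factor
   |(s + 1) z^s|^2 common to the metric and to the tension field of phi has been
   cancelled. *)
Definition branch_energy z : R :=
  inner (G (phi z)) (Rd z) (Rd z) + inner (G (phi z)) (Id z) (Id z).

Definition branch_mean_curvature z : 'rV[R]_n :=
  (s.+1%:R ^+ 2 * branch_energy z)^-1 *: (l z + s.+1%:R ^+ 2 *:
    (christoffel_form G (phi z) (Rd z) (Rd z) + christoffel_form G (phi z) (Id z) (Id z))).

Lemma factorE z :
  (2 * complex.Re (c z)) ^+ 2 + (- (2 * complex.Im (c z))) ^+ 2 = 4 * (s.+1%:R ^+ 2 * rho z).
Proof.
have := wirtinger_factor_norm s z; rewrite /= -/(c z) -/(rho z).
move: (complex.Re _) (complex.Im _) (_ * rho z) => u v w E; rewrite -E; ring.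
Qed.

Lemma energy_branch z : U z ->
  energy G phi z = 2 * (s.+1%:R ^+ 2 * rho z) * branch_energy z.
Proof.
(* [bilinear_rotation] computes |d_0 phi|^2 + |d_1 phi|^2, which conformality makes twice the
   energy; hence 2 here against 4 in [mean_field_branch]. *)
have K (e a t : R) : e + e = 4 * t * a -> e = 2 * t * a by move=> H; lra.
move=> Uz; have [D0 D1] := dz_derive Uz; have [E _] := Hconf Uz.
have Gs := metric_sym HG (UV Uz).
have L k u u' w : inner (G (phi z)) (k *: u + u') w
    = k * inner (G (phi z)) u w + inner (G (phi z)) u' w by rewrite innerDl innerZl.
have := bilinear_rotation (2 * complex.Re (c z)) (- (2 * complex.Im (c z))) (Rd z) (Id z) L
  (fun u w => innerC u w Gs).
rewrite -D0 -D1 factorE -E -/(energy G phi z) -/(branch_energy z).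
exact: K.
Qed.

Lemma mean_field_branch z k : U z ->
  mean_field G phi z 0 k = 4 * rho z * (l z + s.+1%:R ^+ 2 *:
    (christoffel_form G (phi z) (Rd z) (Rd z) + christoffel_form G (phi z) (Id z) (Id z))) 0 k.
Proof.
move=> Uz; have [D0 D1] := dz_derive Uz.
have L t u u' w : christoffel_form G (phi z) (t *: u + u') w 0 k
    = t * christoffel_form G (phi z) u w 0 k + christoffel_form G (phi z) u' w 0 k.
  by rewrite christoffel_form_linear [LHS]mxE [X in X + _ = _]mxE.
have C u w : christoffel_form G (phi z) u w 0 k = christoffel_form G (phi z) w u 0 k.
  by rewrite (christoffel_formC _ _ HG (UV Uz)).
have := bilinear_rotation (2 * complex.Re (c z)) (- (2 * complex.Im (c z))) (Rd z) (Id z) L C.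
rewrite -D0 -D1 factorE => B; have := laplacian_coord k Uz.
rewrite -!(derive2_phi_coord Uo Hphi _ _ Uz) => La.
rewrite /mean_field !cov_derivE [LHS]mxE [X in X + _ = _]mxE [X in _ + X = _]mxE.
rewrite addrACA La B [in RHS]mxE [X in _ = _ * (_ + X)]mxE [X in _ = _ * (_ + _ * X)]mxE.
move: (christoffel_form _ _ _ _ 0 k + christoffel_form _ _ _ _ 0 k) => S.
by move: (rho z) (l z 0 k) => t m; ring.
Qed.

Lemma branch_mean_curvatureE z : U z -> rho z != 0 -> branch_energy z != 0 ->
  energy G phi z != 0 /\
  (2 * energy G phi z)^-1 *: mean_field G phi z = branch_mean_curvature z.
Proof.
move=> Uz r0 D0; rewrite energy_branch //; split.
  by rewrite !mulf_neq0 ?expf_neq0 ?pnatr_eq0.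
apply/rowP => k; rewrite [LHS]mxE [RHS]mxE mean_field_branch //.
have s0 : s.+1%:R != 0 :> R by rewrite pnatr_eq0.
move: (_ 0 k) r0 D0 s0 => m; move: (rho z) (branch_energy z) (s.+1%:R) => t e a t0 e0 a0.
by field; rewrite a0 e0 t0.
Qed.

End BranchChart.

Section LocalExtension.
Context {R : realType} {n : nat} {r : diff_class} {b : R}.
Hypothesis b1 : b <= 1.
Variables (V : set 'rV[R]_n) (G : 'rV[R]_n -> 'M[R]_n).
Hypotheses (HG : metric_on V G) (Gr : class_on (shift_class r 1) b V G).
Variables (U : set 'rV[R]_2) (phi : 'rV[R]_2 -> 'rV[R]_n).
Hypotheses (Uo : open U) (UV : forall z, U z -> V (phi z)).
Hypothesis Hphi : class_on (shift_class r 2) b U phi.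

Lemma open_class_neq0 (F : 'rV[R]_2 -> R) : class_on r b U F ->
  open (U `&` [set z | F z != 0]).
Proof. by move=> HF; apply: open_neq0 => //; exact: class_on_cont HF. Qed.

Lemma class_conformal_mean_curvature :
  class_on r b (U `&` [set z | energy G phi z != 0])
    (fun z => (2 * energy G phi z)^-1 *: mean_field G phi z).
Proof.
have Er := class_energy b1 HG Gr Uo UV Hphi.
set W := U `&` _; have Wo : open W := open_class_neq0 Er.
have WU : W `<=` U by move=> z [].
apply/(class_on_rVP b r _ Wo) => k.
have S : class_on r b W (fun z => (2 * energy G phi z)^-1 * mean_field G phi z 0 k).
  apply: (class_on_mul b1 Wo); last first.
    exact: class_on_sub Uo Wo WU (class_mean_field b1 HG Gr Uo UV Hphi k).
  apply: (class_on_inv b1 Wo) => [z [_ E0]|]; first by rewrite mulf_neq0 ?pnatr_eq0.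
  exact: (class_on_mul b1 Wo (class_on_cst b r 2 Wo) (class_on_sub Uo Wo WU Er)).
by apply: (class_on_ext Wo _ S) => z _; rewrite [RHS]mxE.
Qed.

Variables (s : nat) (d : 'rV[R]_2 -> 'rV[R[i]]_n) (l : 'rV[R]_2 -> 'rV[R]_n).
Hypotheses (Hd : class_onC (shift_class r 1) b U d) (Hl : class_on r b U l).

Let class_Rd j : class_on r b U (fun z => map_mx (@complex.Re R) (d z) 0 j).
Proof. exact: (class_on_le1 b1 Uo ((class_on_rVP b _ _ Uo).1 Hd.1 j)). Qed.

Let class_Id j : class_on r b U (fun z => map_mx (@complex.Im R) (d z) 0 j).
Proof. exact: (class_on_le1 b1 Uo ((class_on_rVP b _ _ Uo).1 Hd.2 j)). Qed.

Lemma class_branch_energy : class_on r b U (branch_energy G phi d).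
Proof.
apply: (class_on_add Uo).
  exact: (class_inner b1 HG Gr Uo UV Hphi class_Rd class_Rd).
exact: (class_inner b1 HG Gr Uo UV Hphi class_Id class_Id).
Qed.

Lemma class_branch_mean_curvature :
  class_on r b (U `&` [set z | branch_energy G phi d z != 0])
    (branch_mean_curvature G phi s d l).
Proof.
have Er := class_branch_energy.
set W := U `&` _; have Wo : open W := open_class_neq0 Er.
have WU : W `<=` U by move=> z [].
have cst c := class_on_cst b r c Wo.
apply/(class_on_rVP b r _ Wo) => k.
have S : class_on r b W (fun z => (s.+1%:R ^+ 2 * branch_energy G phi d z)^-1
   * (l z 0 k + s.+1%:R ^+ 2 *
     (christoffel_form G (phi z) (map_mx (@complex.Re R) (d z)) (map_mx (@complex.Re R) (d z)) 0 k
      + christoffel_form G (phi z) (map_mx (@complex.Im R) (d z)) (map_mx (@complex.Im R) (d z)) 0 k))).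
  apply: (class_on_mul b1 Wo).
    apply: (class_on_inv b1 Wo) => [z [_ E0]|].
      by rewrite mulf_neq0 ?expf_neq0 ?pnatr_eq0.
    exact: (class_on_mul b1 Wo (cst _) (class_on_sub Uo Wo WU Er)).
  apply: (class_on_add Wo); first exact: class_on_sub Uo Wo WU ((class_on_rVP b r l Uo).1 Hl k).
  apply: (class_on_mul b1 Wo (cst _)); apply: (class_on_sub Uo Wo WU).
  apply: (class_on_add Uo).
    exact: (class_christoffel_form b1 HG Gr Uo UV Hphi k class_Rd class_Rd).
  exact: (class_christoffel_form b1 HG Gr Uo UV Hphi k class_Id class_Id).
apply: (class_on_ext Wo _ S) => z _; rewrite /branch_mean_curvature.
by rewrite [RHS]mxE [X in _ = _ * X]mxE [X in _ = _ * (_ + X)]mxE [X in _ = _ * (_ + _ * X)]mxE.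
Qed.

Lemma branch_energy_gt0 z j : U z -> complex.Re (d z 0 j) != 0 ->
  0 < branch_energy G phi d z.
Proof.
move=> Uz D0; rewrite /branch_energy; apply: ltr_pwDl.
  apply: (metric_pos HG (UV Uz)); apply/eqP => /rowP/(_ j) /eqP.
  by rewrite !mxE (negbTE D0).
have [->|I0] := eqVneq (map_mx (@complex.Im R) (d z)) 0; first by rewrite /inner !mul0mx mxE.
by apply: ltW; exact: (metric_pos HG (UV Uz)).
Qed.

End LocalExtension.

Lemma Re_normC_exp_neq0 {R : realType} (z : 'rV[R]_2) k : z != 0 ->
  complex.Re (`|toC z| ^+ k) != 0.
Proof.
move=> z0; have t0 : toC z != 0.
  apply: contraNneq z0 => -[H0 H1]; apply/eqP/rowP => j.
  by rewrite mxE; case: (ord2 j) => ->.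
have : `|toC z| ^+ k != 0 by rewrite expf_neq0 // normr_eq0.
by rewrite normc_def -rmorphXn fmorph_eq0.
Qed.

(** * Gluing the local extensions into a section along f *)

Section Extension.
Context {R : realType} {n : nat} {r : diff_class} {b : R}.
Context {M : riemann_surface R} {N : real_manifold R (structure_class r) n.+2}.
Variables (g : riemannian_metric N) (f : M -> N).
Hypotheses (b1 : b <= 1) (Hg : metric_class (shift_class r 1) b g).
Hypotheses (Hf : map_class (shift_class r 2) b f) (Hconf : conformal g f).

Notation pair := (@conformal_pair R n r M N f).

(** Existential, whereas [regular_point] quantifies over all coordinate systems: one conformal pair
    with nonzero energy suffices to force the value at p. *)
Definition nondegenerate (p : M) : Prop :=
  exists x y, [/\ pair x y, cdom x p & pair_energy g f x y (cmap x p) != 0].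

Record local_field := LocalField {
  lf_x : chart R M 2;
  lf_y : chart R N n.+2;
  lf_dom : set 'rV[R]_2;
  lf_val : 'rV[R]_2 -> 'rV[R]_n.+2 }.

(* The alternative [nondegenerate p] forces the right value at p when p turns out
   to be regular for another choice of charts. *)
Record extends (p : M) (D : local_field) : Prop := Extends {
  ext_pair : pair (lf_x D) (lf_y D);
  ext_at : cdom (lf_x D) p;
  ext_open : open (lf_dom D);
  ext_mem : lf_dom D (cmap (lf_x D) p);
  ext_class : class_on r b (lf_dom D) (lf_val D);
  ext_val : forall q, cdom (lf_x D) q -> lf_dom D (cmap (lf_x D) q) ->
    q <> p \/ nondegenerate p ->
    pair_energy g f (lf_x D) (lf_y D) (cmap (lf_x D) q) != 0
    /\ lf_val D (cmap (lf_x D) q)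
       = pair_mean_curvature g f (lf_x D) (lf_y D) (cmap (lf_x D) q) }.

Lemma gram_class y : coordN y -> class_on (shift_class r 1) b (cimg y) (gram g y).
Proof. exact: Hg. Qed.

Lemma extends_nondegenerate p : nondegenerate p -> exists D, extends p D.
Proof.
move=> [x [y [P xp E0]]]; have [Hx Hy xy] := P.
have xo : open (cimg x) := @cimg_open _ _ _ x.
have UV z : cimg x z -> cimg y (local_rep f x y z) by exact: local_rep_img.
have HG := metric_on_chart b1 Hg Hy.
have phi2 := local_rep_class Hf (conformal_pair_chart P).
exists (LocalField x y (cimg x `&` [set z | pair_energy g f x y z != 0])
  (pair_mean_curvature g f x y)); split.
- exact: P.
- exact: xp.
- exact: (open_class_neq0 xo (class_energy b1 HG (gram_class Hy) xo UV phi2)).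
- by split=> //; exists p.
- exact: (class_conformal_mean_curvature b1 HG (gram_class Hy) xo UV phi2).
- by rewrite /= => q xq [].
Qed.

Lemma extends_branch p x y (s : nat) d l : pair x y -> cdom x p -> cmap x p = 0 ->
  class_onC (shift_class r 1) b (cimg x) d -> class_on r b (cimg x) l ->
  (forall z, cimg x z ->
     dz_vec (fun z => complexify (local_rep f x y z)) z = (s.+1%:R * toC z ^+ s) *: d z /\
     dzbar_vec (dz_vec (fun z => complexify (local_rep f x y z))) z
       = `|toC z| ^+ (2 * s) *: complexify (l z)) ->
  complex.Re (d 0 0 0) != 0 -> ~ nondegenerate p -> exists D, extends p D.
Proof.
move=> P xp x0 Hd Hl Hdl d0 ng; have [Hx Hy xy] := P.
have xo : open (cimg x) := @cimg_open _ _ _ x.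
have UV z : cimg x z -> cimg y (local_rep f x y z) by exact: local_rep_img.
have HG := metric_on_chart b1 Hg Hy.
have phi2 := local_rep_class Hf (conformal_pair_chart P).
pose G := gram g y; pose phi := local_rep f x y.
have zx : cimg x 0 by rewrite -x0; exists p.
exists (LocalField x y (cimg x `&` [set z | branch_energy G phi d z != 0])
  (branch_mean_curvature G phi s d l)); split.
- exact: P.
- exact: xp.
- exact: (open_class_neq0 xo (class_branch_energy b1 HG (gram_class Hy) xo UV phi2 Hd)).
- by rewrite /= x0; split=> //=; rewrite gt_eqF //; exact: (branch_energy_gt0 HG UV zx d0).
- exact: (class_branch_mean_curvature b1 HG (gram_class Hy) xo UV phi2 s Hd Hl).
(* Degeneracy of p leaves only q <> p, where the coordinate is nonzero and |z|^(2s) can be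
   cancelled. *)
- rewrite /= => q xq [xzq Dq] [qp|/ng //].
  have q0 : cmap x q != 0.
    by apply/eqP => q0; apply: qp; rewrite -(cmapK xq) q0 -x0 cmapK.
  have phi2' := local_rep_C2 b1 Hf (conformal_pair_chart P).
  have [E0 <-] // := branch_mean_curvatureE HG xo phi2' UV (pair_conformal_on Hconf P)
    (fun z zU => (Hdl z zU).1) (fun z zU => (Hdl z zU).2) xzq (Re_normC_exp_neq0 (2 * s) q0) Dq.
Qed.

Section Field.
Variable D : M -> local_field.
Hypothesis HD : forall p, extends p (D p).

(** Each point uses only the local field chosen at that point, transported to [y]; that these
    pointwise choices fit together is the content of [extension_near]. *)
Definition extension (p : M) (y : chart R N n.+2) : 'rV[R]_n.+2 :=
  'D_(lf_val (D p) (cmap (lf_x (D p)) p)) (transition (lf_y (D p)) y)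
    (cmap (lf_y (D p)) (f p)).

Lemma extension_chart p : cdom (lf_y (D p)) (f p).
Proof. by have [_ _ xy] := ext_pair (HD p); apply: xy; exists p => //; exact: ext_at. Qed.

Lemma extension_section_along : section_along f extension.
Proof.
move=> p y y' Hy Hy' yp yp'; rewrite /extension.
set y0 := lf_y (D p); set v := lf_val _ _.
have y0p : cdom y0 (f p) by exact: extension_chart.
have Hy0 : coordN y0 by case: (ext_pair (HD p)).
pose U := cmap y0 @` (cdom y0 `&` (cdom y `&` cdom y')).
pose V := cmap y @` (cdom y `&` cdom y').
have Uo : open U by apply: chart_image_open; apply: openI; exact: cdom_open.
have Vo : open V by apply: chart_image_open; exact: cdom_open.
have UV z : U z -> V (transition y0 y z).
  by move=> [t [t0 [ty ty']] <-]; rewrite transitionE //; exists t.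
have zU : U (cmap y0 (f p)) by exists (f p).
have T1 : class_rV 1 U (transition y0 y).
  apply: (@class_on_rV_fin _ _ _ 0 ler01 (structure_class r)) => //.
  rewrite shift_structure_class; apply: class_on_rV_sub (transition_of_class Hy0 Hy) => //.
    by apply: chart_image_open; exact: cdom_open.
  by move=> _ [t [t0 [ty _]] <-]; exists t.
have T2 : class_rV 1 V (transition y y').
  apply: (@class_on_rV_fin _ _ _ 0 ler01 (structure_class r)) => //.
  by rewrite shift_structure_class; exact: transition_of_class.
have E z : U z -> transition y0 y' z = (transition y y' \o transition y0 y) z.
  by move=> [t [t0 [ty ty']] <-] /=; rewrite !transitionE.
apply: etrans (near_eq_derive _ (near_open Uo zU E)) _.
apply: etrans (derive_comp Uo Vo UV _ T1 T2 zU) _.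
by rewrite transitionE.
Qed.

Lemma extension_mean_curvature p : regular_point f p ->
  is_mean_curvature_vector g f p (extension p).
Proof.
move=> reg; split; first exact: extension_section_along.
move=> x' y' CP /= X1 X2 ort.
have P := ext_pair (HD p); have xp := ext_at (HD p).
have gp : nondegenerate p.
  by exists (lf_x (D p)), (lf_y (D p)); split=> //; exact: (regular_pair_energy b1 Hg Hf P xp reg).
have [_ E] := ext_val (HD p) xp (ext_mem (HD p)) (or_intror gp).
rewrite /extension E; apply: esym.
exact: (pair_mean_curvatureP b1 Hg Hf Hconf P xp CP ort).
Qed.

(** For q <> p the pair chosen at p has nonzero energy at q, so q is nondegenerate; both local
    fields then take the value of the conformal formula at q, on which all pairs agree. *)
Lemma extension_near p q y : coordN y -> cdom y (f q) ->
  cdom (lf_x (D p)) q -> lf_dom (D p) (cmap (lf_x (D p)) q) ->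
  extension q y = 'D_(lf_val (D p) (cmap (lf_x (D p)) q)) (transition (lf_y (D p)) y)
    (cmap (lf_y (D p)) (f q)).
Proof.
move=> Hy yq xq Wq; have [-> //|qp] := pselect (q = p).
have [E0 ->] := ext_val (HD p) xq Wq (or_introl qp).
have gq : nondegenerate q.
  by exists (lf_x (D p)), (lf_y (D p)); split=> //; exact: ext_pair.
have [_ E] := ext_val (HD q) (ext_at (HD q)) (ext_mem (HD q)) (or_intror gq).
rewrite /extension E; apply: esym.
exact: (pair_mean_curvature_agree b1 Hg Hf Hconf (ext_pair (HD p)) (ext_pair (HD q)) xq
  (ext_at (HD q)) Hy yq E0).
Qed.

(** Near p, in arbitrary coordinates, the components are those of the local field at p composed with
    [tau], combined with the partial derivatives of T along f. As [tau] and T are of structure class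
    and f has order r + 2, nothing falls below order r. *)
Lemma extension_section_class : section_class r b f extension.
Proof.
move=> x y [Hx Hy xy]; apply: class_on_rV_local; first exact: cimg_open.
move=> _ [p xp <-].
have [P x0p Wo Wp Hh _] := HD p; have [Hx0 Hy0 xy0] := P.
set x0 := lf_x (D p) in x0p Wp Hx0 xy0 *; set y0 := lf_y (D p) in Hy0 xy0 *.
set W := lf_dom (D p) in Wo Wp Hh *; set h := lf_val (D p) in Hh *.
pose A := cdom x0 `&` cmap x0 @^-1` W.
pose Om := cmap x @` (cdom x `&` A).
have Oo : open Om by apply: chart_image_open; exact: chart_preimage_open.
exists Om; first by split=> //; exists p.
pose V := cmap y0 @` (cdom y0 `&` cdom y).
have Vo : open V by apply: chart_image_open; exact: cdom_open.
have x0o : open (cimg x0) := @cimg_open _ _ _ x0.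
pose tau := transition x x0; pose T := transition y0 y; pose phi := local_rep f x0 y0.
have OW z : Om z -> W (tau z).
  by move=> [q [xq [x0q Wq]] <-]; rewrite /tau transitionE.
have Ox z : Om z -> cimg x0 (tau z).
  by move=> [q [xq [x0q Wq]] <-]; rewrite /tau transitionE //; exists q.
have OV z : Om z -> V (phi (tau z)).
  move=> [q [xq [x0q Wq]] <-]; rewrite /tau transitionE // /phi /local_rep /= cmapK //.
  by exists (f q) => //; split; [apply: xy0 | apply: xy]; exists q.
have Htau k : class_on (shift_class r k) b Om tau.
  apply: (class_on_rV_structure b1) => //.
  apply: class_on_rV_sub (transition_of_class Hx (complex_chart_coord Hx0)) => //.
    by apply: chart_image_open; exact: cdom_open.
  by move=> _ [q [xq [x0q _]] <-]; exists q.
have HT k : class_on (shift_class r k) b V T.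
  by apply: (class_on_rV_structure b1) => //; exact: transition_of_class.
have T1 : class_rV 1 V T by exact: (class_on_rV_fin b1 Vo (HT 1%N)).
have Hphi : class_on (shift_class r 1) b Om (phi \o tau).
  apply: (class_on_rV_comp b1 Oo x0o Ox); last by rewrite shift_class_add; exact: Htau.
  apply: (class_on_rV_le b1 x0o (leqnSn 1)).
  exact: (local_rep_class Hf (conformal_pair_chart P)).
apply/(class_on_rVP b r _ Oo) => j.
have S : class_on r b Om (fun z =>
    \sum_k h (tau z) 0 k * pd k (fun w => T w 0 j) (phi (tau z))).
  apply: (class_on_sum Oo) => k; apply: (class_on_mul b1 Oo).
    exact: (class_on_comp b1 Oo Wo OW ((class_on_rVP b r h Wo).1 Hh k)
      ((class_on_rVP b _ tau Oo).1 (Htau 1%N))).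
  apply: (class_on_comp b1 Oo Vo OV (class_on_pd k Vo ((class_on_rVP b _ T Vo).1 (HT 1%N) j))).
  exact: ((class_on_rVP b _ (phi \o tau) Oo).1 Hphi).
apply: (class_on_ext Oo _ S) => z Oz.
have Td := class_rV_differentiable Vo T1 (OV z Oz).
rewrite -derive_basis_sum; last exact: class_fin_differentiable Vo (OV z Oz) (T1 j).
rewrite -derive_coord //; congr (_ 0 j).
case: Oz => q [xq [x0q Wq]] <-; rewrite cmapK // /tau transitionE //.
rewrite (extension_near Hy _ x0q Wq); last by apply: xy; exists q.
by rewrite /phi /local_rep /= cmapK.
Qed.

End Field.
End Extension.

Theorem proposition3p1 (R : realType) (n : nat) (r : diff_class) (b : R)
    (M : riemann_surface R) (N : real_manifold R (structure_class r) n.+2)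
    (g : riemannian_metric N) (f : M -> N) :
  0 <= b <= 1 ->
  metric_class (shift_class r 1) b g ->
  map_class (shift_class r 2) b f ->
  branched_immersion f ->
  conformal g f ->
  (forall p : M, branch_point f p ->
    exists (x : chart R M 2) (y : chart R N n.+2),
      [/\ complex_chart x, coordN y & f @` cdom x `<=` cdom y] /\
      cdom x p /\ cmap x p = 0 /\
      exists (s : nat) (d : 'rV[R]_2 -> 'rV[R[i]]_n.+2)
             (d1' d2' : 'rV[R]_2 -> R[i]) (l : 'rV[R]_2 -> 'rV[R]_n.+2),
        let fh := fun z => complexify (local_rep f x y z) in
        [/\ (0 < s)%N, class_onC (shift_class r 1) b (cimg x) d
          & class_on r b (cimg x) l] /\
        (forall z, cimg x z ->
           dz_vec fh z = (s.+1%:R * toC z ^+ s) *: d z /\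
           dzbar_vec (dz_vec fh) z = `|toC z| ^+ (2 * s) *: complexify (l z)) /\
        (forall z, cimg x z ->
           d z 0 0 = 2^-1 * (1 + d1' z) /\
           d z 0 1 = - ('i%C / 2) * (1 + d2' z)) /\
        d1' 0 = 0 /\ d2' 0 = 0 /\
        (forall j : 'I_n.+2, (1 < j)%N -> d 0 0 j = 0)) ->
  exists H : M -> chart R N n.+2 -> 'rV[R]_n.+2,
    section_along f H /\
    section_class r b f H /\
    forall p : M, regular_point f p -> is_mean_curvature_vector g f p (H p).
Proof.
move=> /andP[_ b1] Hg Hf [_ Hreg] Hconf Hbr.
have data p : exists D, extends (r := r) (b := b) g f p D.
  have [ng|ng] := pselect (nondegenerate g f p).
    exact: (extends_nondegenerate b1 Hg Hf ng).
  (* By the definition of a branched immersion p would otherwise be regular, and a regular point has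
     nonzero energy in every conformal pair around it. *)
  have bp : branch_point f p.
    apply: contrapT => /Hreg reg; apply: ng.
    have [y ya yp] := atlas_cover (f p).
    have [x P xp] := conformal_pair_exists Hf (atlas_coordinate_system ya) yp.
    by exists x, y; split=> //; exact: (regular_pair_energy b1 Hg Hf P xp reg).
  have [x [y [P [xp [x0 [s [d [d1 [d2 [l [[s0 Hd Hl] [Hdl [Hd12 [d10 _]]]]]]]]]]]]]] := Hbr p bp.
  apply: (extends_branch b1 Hg Hf Hconf P xp x0 Hd Hl Hdl _ ng).
  have zx : cimg x 0 by exists p.
  rewrite (Hd12 0 zx).1 d10 addr0 mulr1.
  have -> : 2^-1 = (2^-1)%:C :> R[i] by rewrite rmorphV ?unitfE ?pnatr_eq0 // rmorph_nat.
  by rewrite /= invr_eq0 pnatr_eq0.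
have [D HD] := choice data.
exists (extension f D); split; first exact: extension_section_along HD.
split; first exact: (extension_section_class b1 Hg Hf Hconf HD).
by move=> p; exact: (extension_mean_curvature b1 Hg Hf Hconf HD).
Qed.
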